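(* Let $q$ satisfy the standing assumptions below, let $S=(S_n)_{n\ge0}$ be the random walk with $S_0=0$ and i.i.d. increments of law $q$, and fix a reference distribution $\alpha\in\mathcal{P}(\mathbb{R})$. Let $\eta:\mathbb{Z}\to\mathcal{P}(\mathbb{R})$ be a stochastic scenery with $|\{z:\eta(z)\neq\alpha\}|<\infty$, and let $X=(X_n)_{n\ge0}$ be the sequence of observations induced by $S$ and $\eta$. Then there is a function $F$ of the observation sequence alone (depending on $q$ and $\alpha$ but not on $\eta$), assigning to $(x_n)_{n\ge0}\in\mathbb{R}^{\mathbb{N}}$ a scenery $F((x_n))\in\mathcal{P}(\mathbb{R})^{\mathbb{Z}}$, such that for every such $\eta$, almost surely $$F\big((X_n)_{n\ge0}\big)=\eta\circ T$$ for some map $T:\mathbb{Z}\to\mathbb{Z}$ which is either a shift $z\mapsto z+c$ or a shift composed with a reflection $z\mapsto -z+c$ ($c\in\mathbb{Z}$; $T$ may depend on $\eta$).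
   Context: Standing assumptions on the probability mass function $q$ on $\mathbb{Z}$: $\sum_z z\,q(z)=0$; $\sum_z z^2q(z)<\infty$; $q(z)=q(-z)$ for all $z$; $\gcd\{n\ge1: q^{*n}(0)>0\}=1$, where $q^{*n}$ is the $n$-fold convolution of $q$; and the additive subgroup generated by the support of $q$ is $\mathbb{Z}$. $\mathcal{P}(\mathbb{R})$ denotes the set of Borel probability measures on $\mathbb{R}$. A stochastic scenery is a map $\eta:\mathbb{Z}\to\mathcal{P}(\mathbb{R})$. The sequence of observations induced by $S$ and $\eta$ is the process $X=(X_n)_{n\ge0}$ such that, conditionally on the whole path $S$, the $X_n$ are independent with $P[X_n\in\cdot\mid S]=\eta(S_n)$. *)

(* Defs.v *)
From HB Require Import structures.
From mathcomp Require Import all_boot all_order all_algebra.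
From mathcomp Require Import all_classical all_reals all_analysis.
Set Implicit Arguments. Unset Strict Implicit. Unset Printing Implicit Defensive.
Import Order.TTheory GRing.Theory Num.Theory.
Local Open Scope classical_set_scope.
Local Open Scope ring_scope.

(* q^{*n}(0) > 0 : some n steps of positive q-probability sum to 0 *)
Definition conv_pow_pos {R : realType} (q : int -> R) (n : nat) : Prop :=
  exists s : seq int, size s = n /\ all (fun z => 0 < q z) s /\ \sum_(z <- s) z = 0.

Definition step_assumptions {R : realType} (q : int -> R) : Prop :=
  (forall z, 0 <= q z) /\
  (\esum_(z in [set: int]) (q z)%:E = 1)%E /\
  (\esum_(z in [set: int]) ((z%:~R ^+ 2 : R) * q z)%:E < +oo)%E /\
  (* mean zero: sum_z z q(z) = 0 (positive and negative parts agree) *)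
  (\esum_(z in [set z : int | (0 < z)%R]) ((z%:~R : R) * q z)%:E =
   \esum_(z in [set z : int | (z < 0)%R]) ((- z%:~R : R) * q z)%:E)%E /\
  (forall z, q z = q (- z)) /\
  (* gcd {n >= 1 : q^{*n}(0) > 0} = 1 *)
  (forall d : nat, (forall n : nat, (1 <= n)%N -> conv_pow_pos q n -> (d %| n)%N) ->
     d = 1%N) /\
  (* the additive subgroup generated by supp q is Z, i.e. it contains 1 *)
  (exists s : seq (int * int),
      all (fun p => 0 < q p.2) s /\ \sum_(p <- s) p.1 * p.2 = 1).

Definition finitely_differs {R : realType} (alpha : probability R R)
    (eta : int -> probability R R) : Prop :=
  finite_set [set z : int | exists A : set R, measurable A /\ eta z A <> alpha A].

(* (S, X) on (Omega, P): S random walk from 0 with steps q, and conditionally on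
   the whole path S, the X_n are independent with laws eta (S_n).  Encoded by
   the finite-dimensional joint laws. *)
Definition walk_observations {R : realType} (d : measure_display)
    (Omega : measurableType d) (P : probability Omega R) (q : int -> R)
    (eta : int -> probability R R) (S : nat -> Omega -> int)
    (X : nat -> Omega -> R) : Prop :=
  (forall n z, measurable [set w | S n w = z]) /\
  (forall n, measurable_fun [set: Omega] (X n)) /\
  (forall (n : nat) (zs : nat -> int) (B : nat -> set R),
      (forall i, measurable (B i)) ->
      P [set w | forall i : nat, (i <= n)%N -> S i w = zs i /\ B i (X i w)] =
      ((zs 0%N == 0)%:R * (\prod_(i < n) q (zs i.+1 - zs i)) *
        (\prod_(i < n.+1) fine (eta (zs i) (B i))))%:E).

(* Main.v *)
(** Weight the observations at even times [2n] by the return probabilities [v n]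
    of the walk. For sets [A_0, ..., A_m] and even lags, the centred product of
    the corresponding indicators of the observations has, given the walk, a mean
    that vanishes unless the walk visits the finite set where [eta] differs from
    [alpha] at all the prescribed times; the weighted sum of these products,
    divided by [sum v n ^ 2], has mean square distance [O (1 / sum v n ^ 2)] to
    the sum over points [z_0, ..., z_m] of the products of [eta (z_i) A_i - alpha
    A_i] and of the transition probabilities. As [v n] is of order [n ^ -1/2], the
    sum of [v n ^ 2] diverges, so the limit is almost surely read off along a
    subsequence that does not depend on [eta].

    The walk estimates use that the even-time transition functions are positive
    definite on the integers, which replaces Fourier analysis. A linear dependence
    between the transition probabilities to distinct distances, as functions of
    time, would make an iterated second difference decay exponentially, which the
    divergence of [sum v n ^ 2] forbids; hence the limits determine the sums over
    chains with prescribed distances between consecutive points. By polynomial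
    interpolation one can also prescribe the values of [eta - alpha] along the
    chain. A chain that keeps returning to an end point of the charged set, by
    jumps over the diameter, fixes every charged point by its distance to that end
    point, which determines [eta] up to a shift and a reflection. *)
Require Import Defs.
From HB Require Import structures.
From mathcomp Require Import all_boot all_order all_algebra.
From mathcomp Require Import all_classical all_reals all_analysis.
From mathcomp Require Import measurable_realfun.
From mathcomp Require Import zify ring lra.
Import Order.TTheory GRing.Theory Num.Theory.
Import numFieldNormedType.Exports.
Local Open Scope classical_set_scope.
Local Open Scope ring_scope.
Set Implicit Arguments.
Unset Strict Implicit.
Unset Printing Implicit Defensive.

(** * Expectation under a symmetric law on the integers *)

(** The characteristic function of [q] is real but may be negative; only its even powers give
    positive definite kernels, hence the even lags. For an even positive definite [g], everything
    rests on the loss [g 0 - A (A g) 0] in two steps. It is comparable with the increment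
    [g 0 - g 1]: finite variance bounds it from above, and writing 1 as a sum of an even number of
    possible steps bounds it from below. The constants do not depend on [g], so the comparison
    applies to the transition functions at all times and to all their iterated second differences;
    the decay of the return probabilities, the summability of their gaps and the independence of the
    transition functions all come from it. The variance of the statistics is delicate because two
    words are correlated through the lag between them and not through the later of the two times;
    the difference is summed by means of the convexity of the return probabilities. [F] is obtained
    by choice: it picks any scenery compatible with the observed limits, so what has to be shown is
    that the limits determine a scenery up to congruence. *)

Section SymmetricExpectation.
Variables (R : realType) (w : nat -> R).
Hypothesis w_ge0 : forall k, 0 <= w k.
Hypothesis w_total : series (fun k => w k *+ 2) @ \oo --> (1 : R).
Hypothesis w_moment2 : cvgn (series (fun k => w k * k%:R ^+ 2)).

Definition quad_bounded (g : int -> R) : Prop :=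
  exists C : R, forall z, `|g z| <= C * (1 + z%:~R ^+ 2).

Definition unif_bounded (g : int -> R) : Prop :=
  exists C : R, forall z, `|g z| <= C.

(** The law gives [w k] to each of k and -k, hence twice [w 0] to 0. Pairing opposite points turns
    expectations into series over [nat] and cancels odd terms one by one. *)
Definition sym_term (g : int -> R) (k : nat) : R := w k * (g k%:Z + g (- k%:Z)).

Definition Esym (g : int -> R) : R := limn (series (sym_term g)).

Definition avg (g : int -> R) (x : int) : R := Esym (fun u => g (x + u)).

Lemma unif_bounded_quad g : unif_bounded g -> quad_bounded g.
Proof.
move=> [C hC]; exists C => z; apply: (le_trans (hC z)).
have C0 : 0 <= C by apply: le_trans (hC 0).
by rewrite ler_peMr // lerDl sqr_ge0.
Qed.

Lemma unif_bounded_cst c : unif_bounded (fun=> c).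
Proof. by exists `|c|. Qed.

Lemma unif_bounded_lin a b f g : unif_bounded f -> unif_bounded g ->
  unif_bounded (fun z => a * f z + b * g z).
Proof.
move=> [C hC] [D hD]; exists (`|a| * C + `|b| * D) => z.
by rewrite (le_trans (ler_normD _ _))// !normrM lerD// ler_wpM2l.
Qed.

Lemma unif_bounded_comp g (s : int -> int) :
  unif_bounded g -> unif_bounded (fun z => g (s z)).
Proof. by move=> [C hC]; exists C => z. Qed.

Lemma unif_boundedM f g : unif_bounded f -> unif_bounded g ->
  unif_bounded (fun z => f z * g z).
Proof.
move=> [C hC] [D hD]; exists (C * D) => z.
by rewrite normrM ler_pM.
Qed.

Lemma unif_bounded_sum (I : Type) (s : seq I) (f : I -> int -> R) :
  (forall i, unif_bounded (f i)) -> unif_bounded (fun z => \sum_(i <- s) f i z).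
Proof.
move=> hf; elim: s => [|i s [D hD]].
  by exists 0 => z; rewrite big_nil normr0.
have [C hC] := hf i; exists (C + D) => z; rewrite big_cons.
by rewrite (le_trans (ler_normD _ _))// lerD.
Qed.

Lemma quad_bounded_lin a b f g : quad_bounded f -> quad_bounded g ->
  quad_bounded (fun z => a * f z + b * g z).
Proof.
move=> [C hC] [D hD]; exists (`|a| * C + `|b| * D) => z.
rewrite (le_trans (ler_normD _ _))// !normrM mulrDl -!mulrA.
by rewrite lerD// ler_wpM2l.
Qed.

Lemma quad_bounded_sq x : quad_bounded (fun u => (x + u)%:~R ^+ 2).
Proof.
exists (2 + 2 * x%:~R ^+ 2) => u; rewrite ger0_norm ?sqr_ge0// rmorphD /=.
move: (x%:~R : R) (u%:~R : R) => a b.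
have h1 := sqr_ge0 (a - b); have h2 := mulr_ge0 (sqr_ge0 a) (sqr_ge0 b).
nra.
Qed.

Lemma unif_boundedZ a f : unif_bounded f -> unif_bounded (fun z => a * f z).
Proof. by move=> [C hC]; exists (`|a| * C) => z; rewrite normrM ler_wpM2l. Qed.

Lemma quad_boundedZ a f : quad_bounded f -> quad_bounded (fun z => a * f z).
Proof.
by move=> [C hC]; exists (`|a| * C) => z; rewrite normrM -mulrA ler_wpM2l.
Qed.

Lemma sym_term_lin a b f g :
  sym_term (fun z => a * f z + b * g z) = a *: sym_term f + b *: sym_term g.
Proof. by apply/funext => k; rewrite /sym_term !fctE /= /GRing.scale /=; ring. Qed.

Lemma cvg_total : cvgn (series w).
Proof.
have -> : w = 2^-1 *: (fun k => w k *+ 2).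
  by apply/funext => k; rewrite /= !fctE /GRing.scale /= -mulr_natr; field.
by apply: is_cvg_seriesZ; apply/cvg_ex; exists 1.
Qed.

Lemma is_cvg_sym_term g : quad_bounded g -> cvgn (series (sym_term g)).
Proof.
move=> [C hC]; apply: normed_cvg.
have C0 : 0 <= C.
  by have := hC 0; rewrite expr0n /= addr0 mulr1; apply: le_trans.
apply: (@series_le_cvg _ _ ((C *+ 2) *: (w + (fun k => w k * k%:R ^+ 2)))).
- by move=> n; exact: normr_ge0.
- move=> n; rewrite /= !fctE /GRing.scale /= mulr_ge0 ?mulrn_wge0//.
  by rewrite addr_ge0// mulr_ge0// sqr_ge0.
- move=> n; rewrite /= !fctE /GRing.scale /= /sym_term normrM (ger0_norm (w_ge0 n)).
  have -> : C *+ 2 * (w n + w n * n%:R ^+ 2) = w n * (C * (1 + n%:R ^+ 2) *+ 2).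
    by ring.
  rewrite ler_wpM2l// mulr2n (le_trans (ler_normD _ _))// lerD//.
  by rewrite (le_trans (hC _))// rmorphN sqrrN.
- by apply/is_cvg_seriesZ/is_cvg_seriesD => //; exact: cvg_total.
Qed.

Lemma cvg_Esym g : quad_bounded g -> series (sym_term g) @ \oo --> Esym g.
Proof. exact: is_cvg_sym_term. Qed.

Lemma eq_Esym f g : f =1 g -> Esym f = Esym g.
Proof. by move=> /funext ->. Qed.

Lemma Esym_lin a b f g : quad_bounded f -> quad_bounded g ->
  Esym (fun z => a * f z + b * g z) = a * Esym f + b * Esym g.
Proof.
move=> hf hg; have cf := is_cvg_sym_term hf; have cg := is_cvg_sym_term hg.
rewrite /Esym sym_term_lin lim_seriesD; try exact: is_cvg_seriesZ.
by rewrite !lim_seriesZ.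
Qed.

Lemma EsymD f g : quad_bounded f -> quad_bounded g ->
  Esym (fun z => f z + g z) = Esym f + Esym g.
Proof.
move=> hf hg; rewrite -[RHS](mul1r (Esym f + _)) mulrDr -Esym_lin//.
by apply: eq_Esym => z; rewrite !mul1r.
Qed.

Lemma EsymZ a f : quad_bounded f -> Esym (fun z => a * f z) = a * Esym f.
Proof.
move=> hf; transitivity (Esym (fun z => a * f z + 0 * f z)).
  by apply: eq_Esym => z; rewrite mul0r addr0.
by rewrite Esym_lin// mul0r addr0.
Qed.

Lemma Esym_cst c : Esym (fun=> c) = c.
Proof.
rewrite /Esym; have -> : sym_term (fun=> c) = c *: (fun k => w k *+ 2).
  by apply/funext => k; rewrite /sym_term !fctE /GRing.scale /= ; ring.
rewrite lim_seriesZ; last by apply/cvg_ex; exists 1.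
by rewrite (cvg_lim _ w_total)// [LHS]mulr1.
Qed.

Lemma Esym_le f g : quad_bounded f -> quad_bounded g ->
  (forall z, f z <= g z) -> Esym f <= Esym g.
Proof.
move=> hf hg fg; apply: lim_series_le; try exact: is_cvg_sym_term.
by move=> n; rewrite ler_wpM2l// lerD.
Qed.

Lemma Esym_opp g : Esym (fun z => g (- z)) = Esym g.
Proof.
by congr (limn (series _)); apply/funext => k; rewrite /sym_term opprK addrC.
Qed.

Lemma Esym_sum (I : Type) (s : seq I) (f : I -> int -> R) :
  (forall i, unif_bounded (f i)) ->
  Esym (fun z => \sum_(i <- s) f i z) = \sum_(i <- s) Esym (f i).
Proof.
move=> hf; elim: s => [|i s IH].
  rewrite big_nil -[RHS](Esym_cst 0).
  by apply: eq_Esym => z; rewrite big_nil.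
rewrite big_cons -IH -EsymD; first by apply: eq_Esym => z; rewrite big_cons.
  exact/unif_bounded_quad.
exact/unif_bounded_quad/unif_bounded_sum.
Qed.

Lemma Esym_norm_le f C : (forall z, `|f z| <= C) -> `|Esym f| <= C.
Proof.
move=> hf; have bf : quad_bounded f by apply: unif_bounded_quad; exists C.
have bc c : quad_bounded (fun=> c) by exact/unif_bounded_quad/unif_bounded_cst.
rewrite ler_norml -[X in X <= _]Esym_cst -[X in _ && (_ <= X)]Esym_cst.
by rewrite !Esym_le//= => z; have := hf z; rewrite ler_norml => /andP[].
Qed.

Lemma Esym_partial_le g n : quad_bounded g -> (forall z, 0 <= g z) ->
  series (sym_term g) n <= Esym g.
Proof.
move=> hg g0; apply: nondecreasing_cvgn_le; last exact: is_cvg_sym_term.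
apply/nondecreasing_seqP => k; rewrite /series /= big_nat_recr//= lerDl.
by rewrite mulr_ge0// addr_ge0.
Qed.

Lemma avg_bounded g : unif_bounded g -> unif_bounded (avg g).
Proof. by move=> [C hC]; exists C => z; apply: Esym_norm_le => u. Qed.

Lemma avg_lin a b f g x : unif_bounded f -> unif_bounded g ->
  avg (fun z => a * f z + b * g z) x = a * avg f x + b * avg g x.
Proof.
by move=> hf hg; apply: Esym_lin; apply/unif_bounded_quad/unif_bounded_comp.
Qed.

Lemma avg_cst c x : avg (fun=> c) x = c.
Proof. exact: Esym_cst. Qed.

Lemma avg_even g : (forall z, g (- z) = g z) -> forall z, avg g (- z) = avg g z.
Proof.
by move=> ge z; rewrite /avg -Esym_opp; apply: eq_Esym => u; rewrite -opprD ge.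
Qed.

Lemma avg_shift g y x : avg (fun z => g (z + y)) x = avg g (x + y).
Proof. by apply: eq_Esym => u; rewrite addrAC. Qed.

Lemma avg_sq x : avg (fun z => z%:~R ^+ 2) x = x%:~R ^+ 2 + Esym (fun u => u%:~R ^+ 2).
Proof.
have qc c : quad_bounded (fun=> c) by exact/unif_bounded_quad/unif_bounded_cst.
have q0 : quad_bounded (fun u => u%:~R ^+ 2).
  by have [C hC] := quad_bounded_sq 0; exists C => z; have := hC z; rewrite add0r.
rewrite -[X in X + _]Esym_cst -EsymD//; congr (limn (series _)).
apply/funext => k; rewrite /sym_term !rmorphD !rmorphN /=; congr (_ * _); ring.
Qed.

End SymmetricExpectation.

(** * Positive definite functions on the integers *)

Section PositiveDefinite.
Variable R : realType.
Implicit Types g : int -> R.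

Definition quad_form g (s : seq (R * int)) : R :=
  \sum_(a <- s) \sum_(b <- s) a.1 * b.1 * g (a.2 - b.2).

Definition psd g : Prop := forall s, 0 <= quad_form g s.

Definition even_fun g : Prop := forall z, g (- z) = g z.

Definition diff2 (y : int) g (x : int) : R := g x - (g (x + y) + g (x - y)) / 2.

Lemma psd_ge0 g : psd g -> 0 <= g 0.
Proof. by move=> /(_ [:: (1, 0)]); rewrite /quad_form !big_seq1 /= !mul1r subrr. Qed.

Lemma psd_abs g : psd g -> even_fun g -> forall z, `|g z| <= g 0.
Proof.
move=> pg eg z.
have h t := pg [:: (1, 0); (t, z)].
have := h 1; have := h (-1).
rewrite /quad_form !big_cons !big_nil /= !subrr !sub0r subr0 eg.
rewrite ler_norml; lra.
Qed.

Lemma psd_le g : psd g -> even_fun g -> forall z, g z <= g 0.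
Proof. by move=> pg eg z; have := psd_abs pg eg z; rewrite ler_norml => /andP[]. Qed.

(** The weights 1, -(1 + t), t at the points 0, x, x + y sum to zero, so the quadratic form involves
    only increments of [g]. This is the triangle inequality for the square root of g 0 - g, with a
    free parameter in place of the roots; t = n gives the exact square in the induction on
    distances. *)
Lemma psd_triangle g t x y : psd g -> even_fun g ->
  t * (g 0 - g (x + y)) <= (1 + t) * (g 0 - g x) + t * (1 + t) * (g 0 - g y).
Proof.
move=> pg eg.
have := pg [:: (1, 0); (- (1 + t), x); (t, x + y)].
rewrite /quad_form !big_cons !big_nil /= !subrr !sub0r !subr0 !eg.
have -> : x - (x + y) = - y by ring.
have -> : x + y - x = y by ring.
rewrite eg => h.
have {h} : 0 <= 2 * ((1 + t) * (g 0 - g x) + t * (1 + t) * (g 0 - g y) - t * (g 0 - g (x + y))).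
  by apply: (le_trans h); rewrite le_eqVlt; apply/orP; left; apply/eqP; ring.
lra.
Qed.

Lemma psd_increment_nat g (n : nat) : psd g -> even_fun g ->
  g 0 - g n%:Z <= n%:R ^+ 2 * (g 0 - g 1).
Proof.
move=> pg eg; elim: n => [|n IH]; first by rewrite subrr expr0n mul0r.
have [->|n0] := eqVneq n 0%N; first by rewrite expr1n mul1r.
have := @psd_triangle g n%:R n%:Z 1 pg eg.
have -> : (n%:Z + 1 = n.+1%:Z) by lia.
have np : 0 < n%:R :> R by rewrite ltr0n lt0n.
move=> h; rewrite -(ler_pM2l np) (le_trans h)//.
have -> : n.+1%:R = n%:R + 1 :> R by rewrite -natr1.
have := ler_wpM2l (_ : 0 <= 1 + n%:R :> R) IH; rewrite addr_ge0 // => /(_ erefl).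
nra.
Qed.

Lemma psd_increment g (z : int) : psd g -> even_fun g ->
  g 0 - g z <= z%:~R ^+ 2 * (g 0 - g 1).
Proof.
move=> pg eg; case: z => n; first exact: psd_increment_nat.
by rewrite NegzE eg rmorphN sqrrN; exact: psd_increment_nat.
Qed.

Lemma diff2_even y g : even_fun g -> even_fun (diff2 y g).
Proof.
move=> eg z; rewrite /diff2 eg; congr (_ - _ / _).
by rewrite addrC -opprD eg (_ : - z + y = - (z - y)) ?eg// opprB addrC.
Qed.

Lemma diff2_at0 y g : even_fun g -> diff2 y g 0 = g 0 - g y.
Proof. by move=> eg; rewrite /diff2 add0r sub0r eg; field. Qed.

(** Twice the form at a configuration is the form of [g] at the configuration minus its translate by
    [y]. In Fourier terms, [diff2 y] multiplies by 1 - cos (y theta), which is non-negative. *)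
Lemma diff2_psd y g : psd g -> psd (diff2 y g).
Proof.
move=> pg s.
have := pg (s ++ [seq (- a.1, a.2 + y) | a <- s]).
rewrite /quad_form big_cat /= big_map.
under eq_bigr do rewrite big_cat /= big_map.
under [X in _ + X]eq_bigr do rewrite big_cat /= big_map.
rewrite -big_split /=.
suff -> : \sum_(i <- s) (\sum_(i0 <- s) i.1 * i0.1 * g (i.2 - i0.2) +
    \sum_(j <- s) i.1 * (- j.1) * g (i.2 - (j.2 + y)) +
   (\sum_(i0 <- s) - i.1 * i0.1 * g (i.2 + y - i0.2) +
    \sum_(j <- s) - i.1 * (- j.1) * g (i.2 + y - (j.2 + y)))) =
    2 * \sum_(a <- s) \sum_(b <- s) a.1 * b.1 * diff2 y g (a.2 - b.2).
  by rewrite pmulr_rge0.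
rewrite mulr_sumr; apply: eq_bigr => a _; rewrite -!big_split mulr_sumr /=.
apply: eq_bigr => b _; rewrite /diff2.
have -> : a.2 - (b.2 + y) = a.2 - b.2 - y by ring.
have -> : a.2 + y - b.2 = a.2 - b.2 + y by ring.
have -> : a.2 + y - (b.2 + y) = a.2 - b.2 by ring.
by field.
Qed.

(** The mixture convolves [g] with the autocorrelation of the weights [T]; its form at [s] is the
    form of [g] at all sums of a point of [s] and a point of [T]. *)
Lemma psd_mixture g (T : seq (R * int)) : psd g ->
  psd (fun x => \sum_(p <- T) \sum_(p' <- T) p.1 * p'.1 * g (x + p.2 - p'.2)).
Proof.
move=> pg s.
have := pg [seq (a.1 * p.1, a.2 + p.2) | a <- s, p <- T].
rewrite /quad_form big_allpairs_dep /=.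
suff -> : \sum_(i <- s) \sum_(j <- T) \sum_(b <- [seq (a.1 * p.1, a.2 + p.2) | a <- s, p <- T])
    i.1 * j.1 * b.1 * g (i.2 + j.2 - b.2) =
  \sum_(a <- s) \sum_(b <- s) a.1 * b.1 *
    (\sum_(p <- T) \sum_(p' <- T) p.1 * p'.1 * g (a.2 - b.2 + p.2 - p'.2)) by [].
apply: eq_bigr => a _.
under eq_bigr do rewrite big_allpairs_dep /=.
rewrite exchange_big; apply: eq_bigr => b _ /=.
rewrite mulr_sumr; apply: eq_bigr => p _; rewrite mulr_sumr; apply: eq_bigr => p' _.
have -> : a.2 + p.2 - (b.2 + p'.2) = a.2 - b.2 + p.2 - p'.2 by ring.
by ring.
Qed.

Lemma psd_lim (gn : nat -> int -> R) g :
  (forall n, psd (gn n)) -> (forall x, (gn ^~ x) @ \oo --> g x) -> psd g.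
Proof.
move=> pgn cg s.
have cq : (fun n => quad_form (gn n) s) @ \oo --> quad_form g s.
  apply: cvg_big => [|a _]; first exact: add_continuous.
  apply: cvg_big => [|b _]; first exact: add_continuous.
  by apply: cvgMr; exact: cg.
rewrite -(cvg_lim _ cq)//; apply: limr_ge; first by apply/cvg_ex; exists (quad_form g s).
by apply: nearW => n; exact: pgn.
Qed.

Definition delta0 (z : int) : R := (z == 0)%:R.

Lemma delta0_even : even_fun delta0.
Proof. by move=> z; rewrite /delta0 oppr_eq0. Qed.

(** The form is the sum over sites of the squared total weight at the site. *)
Lemma delta0_psd : psd delta0.
Proof.
move=> s; rewrite /quad_form.
pose U := undup [seq a.2 | a <- s].
have H a b : a \in s -> b \in s -> a.1 * b.1 * delta0 (a.2 - b.2) =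
    \sum_(z <- U) (a.1 * (a.2 == z)%:R) * (b.1 * (b.2 == z)%:R).
  move=> as_ bs; rewrite (bigD1_seq a.2) ?undup_uniq ?mem_undup ?map_f//=.
  rewrite eqxx big1 => [|z zn]; last first.
    by rewrite eq_sym (negPf zn) mulr0 mul0r.
  by rewrite /delta0 subr_eq0 addr0 mulr1 mulrA eq_sym.
rewrite (_ : \sum_(a <- s) _ = \sum_(z <- U) (\sum_(a <- s) a.1 * (a.2 == z)%:R) ^+ 2);
  last first.
  transitivity (\sum_(a <- s) \sum_(b <- s) \sum_(z <- U)
      (a.1 * (a.2 == z)%:R) * (b.1 * (b.2 == z)%:R)).
    by apply: eq_big_seq => a as_; apply: eq_big_seq => b bs; exact: H.
  under eq_bigr do rewrite exchange_big.
  rewrite exchange_big; apply: eq_bigr => z _ /=.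
  by rewrite expr2 mulr_suml; apply: eq_bigr => a _; rewrite mulr_sumr.
by apply: sumr_ge0 => z _; exact: sqr_ge0.
Qed.

End PositiveDefinite.

(** * The two-step averaging operator *)

Section EvenWalk.
Variables (R : realType) (w : nat -> R).
Hypothesis w_ge0 : forall k, 0 <= w k.
Hypothesis w_total : series (fun k => w k *+ 2) @ \oo --> (1 : R).
Hypothesis w_moment2 : cvgn (series (fun k => w k * k%:R ^+ 2)).

Local Notation E := (Esym w).
Local Notation A := (avg w).
Implicit Types g : int -> R.

Lemma quad_bounded_bounded_comp g (s : int -> int) :
  unif_bounded g -> quad_bounded (fun z => g (s z)).
Proof. by move=> bg; apply/unif_bounded_quad/unif_bounded_comp. Qed.
Hint Resolve quad_bounded_bounded_comp : core.

Lemma Esym_atom g a : quad_bounded g -> (forall z, 0 <= g z) -> w `|a|%N * g a <= E g.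
Proof.
move=> qg g0.
apply: le_trans (Esym_partial_le w_ge0 w_total w_moment2 (`|a|%N.+1) qg g0).
rewrite /series /= big_nat_recr//= (@le_trans _ _ (sym_term w g `|a|%N))//.
  rewrite /sym_term ler_wpM2l//; case: a => n /=.
    by rewrite lerDl.
  by rewrite NegzE lerDr.
by rewrite lerDr sumr_ge0// => k _; rewrite mulr_ge0// addr_ge0.
Qed.

Definition mass n : R := series (fun k => w k *+ 2) n.

Lemma mass_le1 n : mass n <= 1.
Proof.
rewrite /mass -(cvg_lim _ w_total)//.
apply: (@nondecreasing_cvgn_le _ (series (fun k => w k *+ 2))).
  apply/nondecreasing_seqP => k; rewrite /series /= big_nat_recr//= lerDl.
  by rewrite mulrn_wge0.
by apply/cvg_ex; exists 1.
Qed.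

Lemma partial_normE g C n : (forall z, `|g z| <= C) ->
  `|series (sym_term w g) n| <= C * mass n.
Proof.
move=> hC; rewrite /mass /series /= mulr_sumr (le_trans (ler_norm_sum _ _ _))//.
apply: ler_sum => k _; rewrite /sym_term normrM ger0_norm//.
rewrite -[w k *+ 2]mulr_natr mulrCA ler_wpM2l// mulr_natr mulr2n.
by rewrite (le_trans (ler_normD _ _))// lerD.
Qed.

Lemma series_sym_term_lin a b f g n :
  series (sym_term w (fun z => a * f z + b * g z)) n =
  a * series (sym_term w f) n + b * series (sym_term w g) n.
Proof.
rewrite sym_term_lin /series /= !mulr_sumr -big_split /=.
by apply: eq_bigr.
Qed.

(** Truncation is monotone only for non-negative functions, so it is applied to C + g and C - g. *)
Lemma Esym_tail g C n : (forall z, `|g z| <= C) ->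
  `|E g - series (sym_term w g) n| <= C * (1 - mass n).
Proof.
move=> hC.
have bg : quad_bounded g by apply: unif_bounded_quad; exists C.
have bc : quad_bounded (fun=> C) by exact/unif_bounded_quad/unif_bounded_cst.
have mc : series (sym_term w (fun=> C)) n = C * mass n.
  rewrite /mass /series /= mulr_sumr; apply: eq_bigr => k _.
  by rewrite /sym_term; ring.
have H b : `|b| <= 1 -> C * mass n + b * series (sym_term w g) n <= C + b * E g.
  move=> b1.
  have := @Esym_partial_le _ w w_ge0 w_total w_moment2 (fun z => 1 * C + b * g z) n
     (quad_bounded_lin 1 b bc bg).
  have eL : E (fun z => 1 * C + b * g z) = 1 * E (fun=> C) + b * E g.
    exact: (Esym_lin w_ge0 w_total w_moment2 1 b bc bg).
  rewrite eL (@series_sym_term_lin 1 b (fun=> C)) mc !mul1r Esym_cst//; apply.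
  move=> z; have hz := hC z.
  suff : - (b * g z) <= C by rewrite -subr_ge0 opprK.
  apply: le_trans (ler_norm _) _; rewrite normrN normrM (le_trans _ hz)//.
  by rewrite ler_piMl.
have h1 := H 1 (eq_ind_r (fun x => x <= 1) (lexx _) (normr1 R)).
have h2 := H (-1) (eq_ind_r (fun x => x <= 1) (lexx _) (normrN1 R)).
rewrite ler_norml; apply/andP; split; lra.
Qed.

(** By symmetry the second step may be reversed, so averaging twice is a limit of mixtures over
    differences of two truncated steps, the autocorrelation form of [psd_mixture]. A single
    averaging has no such form. *)
Lemma avg2_psd g : unif_bounded g -> psd g -> psd (A (A g)).
Proof.
move=> [C hC] pg.
pose T n : seq (R * int) :=
  [seq (w k, k%:Z) | k <- iota 0 n] ++ [seq (w k, - k%:Z) | k <- iota 0 n].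
have TE n f : series (sym_term w f) n = \sum_(p <- T n) p.1 * f p.2.
  rewrite /series /= big_cat /= !big_map -big_split /= /index_iota subn0.
  by apply: eq_bigr => k _; rewrite /sym_term mulrDr.
apply: (@psd_lim _ (fun n x =>
  \sum_(p <- T n) \sum_(p' <- T n) p.1 * p'.1 * g (x + p.2 - p'.2))).
  by move=> n; exact: psd_mixture.
move=> x.
have -> : A (A g) x = E (fun a => E (fun b => g (x + a - b))).
  by apply: eq_Esym => a; rewrite /avg -Esym_opp.
have C0 : 0 <= C by apply: le_trans (hC 0).
apply/cvgrPdist_le => e e0.
have h : (fun n => (C *+ 2) * (1 - mass n)) @ \oo --> (0 : R).
  rewrite -(mulr0 (C *+ 2)); apply: cvgMr; rewrite -(subrr 1).
  by apply: cvgB; [exact: cvg_cst | exact: w_total].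
move/cvgr0Pnorm_le : h => /(_ _ e0); apply: filterS => n.
apply: le_trans; apply: le_trans (ler_norm _).
have -> : \sum_(p <- T n) \sum_(p' <- T n) p.1 * p'.1 * g (x + p.2 - p'.2) =
    series (sym_term w (fun a => series (sym_term w (fun b => g (x + a - b))) n)) n.
  rewrite TE; apply: eq_bigr => p _; rewrite TE mulr_sumr.
  by apply: eq_bigr => p' _; rewrite mulrA.
set F := fun a => E (fun b => g (x + a - b)).
set G := fun a => series (sym_term w (fun b => g (x + a - b))) n.
have FC a : `|F a| <= C by apply: Esym_norm_le.
have FG a : `|F a - G a| <= C * (1 - mass n) by apply: Esym_tail.
have -> : E F - series (sym_term w G) n =
  (E F - series (sym_term w F) n) + series (sym_term w (fun a => 1 * F a + (- 1) * G a)) n.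
  by rewrite series_sym_term_lin; ring.
rewrite (le_trans (ler_normD _ _))// mulr2n mulrDl lerD ?Esym_tail//.
apply: (le_trans (@partial_normE _ (C * (1 - mass n)) n _)).
  by move=> z; rewrite mul1r mulN1r.
by rewrite ler_piMr ?mass_le1// mulr_ge0// subr_ge0 mass_le1.
Qed.

(** The two-step displacement and its opposite have the same law; averaging over both turns the loss
    into a mixture of second differences. *)
Lemma avg2_gapE g x : unif_bounded g ->
  g x - A (A g) x = E (fun a => E (fun b => diff2 (a + b) g x)).
Proof.
move=> bg.
have e1 : A (A g) x = E (fun a => E (fun b => g (x + (a + b)))).
  by apply: eq_Esym => a; apply: eq_Esym => b; rewrite addrA.
have e2 : A (A g) x = E (fun a => E (fun b => g (x - (a + b)))).
  rewrite e1 -Esym_opp; apply: eq_Esym => a; rewrite -Esym_opp.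
  by apply: eq_Esym => b; rewrite opprD.
have bE (s : int -> int -> int) : unif_bounded (fun a => E (fun b => g (s a b))).
  by have [C hC] := bg; exists C => a; apply: Esym_norm_le.
have -> : (fun a => E (fun b => diff2 (a + b) g x)) =
  (fun a => 1 * g x + (- 2^-1) *
     (1 * E (fun b => g (x + (a + b))) + 1 * E (fun b => g (x - (a + b))))).
  apply/funext => a; rewrite -Esym_lin//; try exact: quad_bounded_bounded_comp.
  rewrite -[g x in RHS](Esym_cst w_total) -Esym_lin//; last first.
  - by apply: quad_bounded_lin; exact: quad_bounded_bounded_comp.
  - exact/unif_bounded_quad/unif_bounded_cst.
  by apply: eq_Esym => b; rewrite /diff2; field.
rewrite !Esym_lin//; try exact/unif_bounded_quad/bE.
- by rewrite Esym_cst// -e1 -e2; field.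
- exact/unif_bounded_quad/unif_bounded_cst.
- by apply: quad_bounded_lin; exact/unif_bounded_quad/bE.
Qed.

Lemma diff2_bounded y g : unif_bounded g -> unif_bounded (diff2 y g).
Proof.
move=> bg; have -> : diff2 y g = fun x => 1 * g x + (- 2^-1) * (1 * g (x + y) + 1 * g (x - y)).
  by apply/funext => x; rewrite /diff2; field.
by apply: unif_bounded_lin => //; apply: unif_bounded_lin; exact: unif_bounded_comp.
Qed.

Lemma avg2_gap_psd g : unif_bounded g -> psd g -> psd (fun x => g x - A (A g) x).
Proof.
move=> bg pg s; rewrite /quad_form.
under eq_bigr do under eq_bigr do rewrite avg2_gapE//.
have [C hC] := bg.
have dC y x : `|diff2 y g x| <= C *+ 2.
  rewrite /diff2 (le_trans (ler_normB _ _))// mulr2n lerD// normrM.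
  rewrite [`|2^-1|]ger0_norm ?invr_ge0// ler_pdivrMr// mulr_natr mulr2n.
  by rewrite (le_trans (ler_normD _ _))// lerD.
have bd1 x a : unif_bounded (fun b => diff2 (a + b) g x) by exists (C *+ 2).
have bd2 x : unif_bounded (fun a => E (fun b => diff2 (a + b) g x)).
  by exists (C *+ 2) => a; apply: Esym_norm_le.
rewrite (_ : \sum_(a <- s) _ = E (fun a => E (fun b => quad_form (diff2 (a + b) g) s))).
  have b0 : quad_bounded (fun=> 0 : R) by exact/unif_bounded_quad/unif_bounded_cst.
  have bq a : unif_bounded (fun b => quad_form (diff2 (a + b) g) s).
    by apply: unif_bounded_sum => c; apply: unif_bounded_sum => d; exact: unif_boundedZ.
  rewrite -[X in X <= _](Esym_cst w_total); apply: Esym_le => //; last first.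
    move=> z; rewrite -[X in X <= _](Esym_cst w_total); apply: Esym_le => //.
      exact: unif_bounded_quad.
    by move=> b; exact: diff2_psd.
  apply: unif_bounded_quad.
  rewrite (_ : (fun a => _) = fun a => \sum_(c <- s) \sum_(d <- s)
     c.1 * d.1 * E (fun b => diff2 (a + b) g (c.2 - d.2))).
    by apply: unif_bounded_sum => c; apply: unif_bounded_sum => d; exact: unif_boundedZ.
  apply/funext => a; rewrite Esym_sum//; last first.
    by move=> c; apply: unif_bounded_sum => d; exact: unif_boundedZ.
  apply: eq_bigr => c _; rewrite Esym_sum//; last by move=> d; exact: unif_boundedZ.
  by apply: eq_bigr => d _; rewrite EsymZ//; exact: unif_bounded_quad.
transitivity (E (fun a => \sum_(c <- s) \sum_(d <- s)
     c.1 * d.1 * E (fun b => diff2 (a + b) g (c.2 - d.2)))).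
  rewrite Esym_sum//; last by move=> c; apply: unif_bounded_sum => d; exact: unif_boundedZ.
  apply: eq_bigr => c _; rewrite Esym_sum//; last by move=> d; exact: unif_boundedZ.
  by apply: eq_bigr => d _; rewrite EsymZ//; exact: unif_bounded_quad.
apply: eq_Esym => a; rewrite Esym_sum//; last first.
  by move=> c; apply: unif_bounded_sum => d; exact: unif_boundedZ.
apply: eq_bigr => c _; rewrite Esym_sum//; last by move=> d; exact: unif_boundedZ.
by apply: eq_bigr => d _; rewrite EsymZ//; exact: unif_bounded_quad.
Qed.

Lemma avg2_gap0E g : unif_bounded g -> even_fun g ->
  g 0 - A (A g) 0 = E (fun a => E (fun b => g 0 - g (a + b))).
Proof.
move=> bg eg; rewrite avg2_gapE//; apply: eq_Esym => a; apply: eq_Esym => b.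
by rewrite diff2_at0.
Qed.

Definition step_var : R := E (fun u => u%:~R ^+ 2).

Lemma gap_bounded g : unif_bounded g -> unif_bounded (fun z => g 0 - g z).
Proof.
move=> [C hC]; exists (C + C) => z.
by rewrite (le_trans (ler_normB _ _))// lerD.
Qed.

Lemma quad_bounded_id : quad_bounded (fun u => u%:~R ^+ 2 : R).
Proof.
by have [C hC] := @quad_bounded_sq R 0; exists C => z; have := hC z; rewrite add0r.
Qed.

Lemma step_var_ge0 : 0 <= step_var.
Proof.
rewrite -[X in X <= _](Esym_cst w_total); apply: Esym_le => //.
- exact/unif_bounded_quad/unif_bounded_cst.
- exact: quad_bounded_id.
- by move=> z; exact: sqr_ge0.
Qed.

(** Increments grow at most quadratically with the distance, and the two-step displacement has
    second moment [step_var *+ 2]. *)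
Lemma avg2_gap_le g : unif_bounded g -> psd g -> even_fun g ->
  g 0 - A (A g) 0 <= step_var *+ 2 * (g 0 - g 1).
Proof.
move=> bg pg eg; rewrite avg2_gap0E//.
set d := g 0 - g 1.
have bgap := gap_bounded bg.
have inner a : E (fun b => g 0 - g (a + b)) <= d * (1 * a%:~R ^+ 2 + 1 * step_var).
  have qs := @quad_bounded_sq R a.
  rewrite !mul1r -(avg_sq w_ge0 w_total w_moment2) /avg -EsymZ//; apply: Esym_le => //.
  - exact: (quad_bounded_bounded_comp _ bgap).
  - exact: quad_boundedZ.
  - by move=> b; rewrite mulrC; exact: psd_increment.
have qv : quad_bounded (fun a => 1 * a%:~R ^+ 2 + 1 * step_var).
  apply: quad_bounded_lin; first exact: quad_bounded_id.
  exact/unif_bounded_quad/unif_bounded_cst.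
have -> : step_var *+ 2 * d = E (fun a => d * (1 * a%:~R ^+ 2 + 1 * step_var)).
  rewrite EsymZ// Esym_lin//; first by rewrite Esym_cst// -/step_var; ring.
    exact: quad_bounded_id.
  exact/unif_bounded_quad/unif_bounded_cst.
apply: Esym_le => //.
- apply: unif_bounded_quad; have [C hC] := bgap; exists C => a.
  by apply: Esym_norm_le.
- exact: quad_boundedZ.
Qed.

Variable t : seq int.
Hypothesis t_pos : all (fun z => 0 < w `|z|%N) t.
Hypothesis t_even : ~~ odd (size t).
Hypothesis t_sum : \sum_(z <- t) z = 1.

Lemma avg2_gap_atom g a b : unif_bounded g -> psd g -> even_fun g ->
  w `|a|%N * w `|b|%N * (g 0 - g (a + b)) <= g 0 - A (A g) 0.
Proof.
move=> bg pg eg; rewrite avg2_gap0E//; have bgap := gap_bounded bg.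
have gap0 z : 0 <= g 0 - g z by rewrite subr_ge0 psd_le.
have inner z : quad_bounded (fun y => g 0 - g (z + y)).
  exact: (quad_bounded_bounded_comp _ bgap).
rewrite -mulrA; apply: le_trans (Esym_atom a _ _).
- by rewrite ler_wpM2l// (Esym_atom b).
- apply: unif_bounded_quad; have [C hC] := bgap; exists C => z.
  by apply: Esym_norm_le.
- move=> z; rewrite -[X in X <= _](Esym_cst w_total); apply: Esym_le => //.
  exact/unif_bounded_quad/unif_bounded_cst.
Qed.

(** The steps of [t] are consumed in pairs. Each pair is a possible two-step displacement, whose
    increment is at most a constant times the loss, and [psd_triangle] with parameter 1 adds the
    pairs up at the price of a factor 2. *)
Lemma avg2_gap_ge : exists2 C, 0 < C & forall g, unif_bounded g -> psd g -> even_fun g ->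
  g 0 - g 1 <= C * (g 0 - A (A g) 0).
Proof.
rewrite -t_sum.
have [n] := ubnP (size t); move: t_pos t_even; clear t_sum.
elim: n t => // n IH [|a [|b s]]//= ; first by move=> _ _ _; exists 1 => // g bg pg eg;
  rewrite big_nil subrr mul1r; exact: (psd_ge0 (avg2_gap_psd bg pg)).
move=> /and3P[a0 b0 s0]; rewrite negbK => so sn.
have [|C C0 hC] := IH s s0 so; first by lia.
pose K := 2 * (w `|a|%N * w `|b|%N)^-1 + 2 * C.
have ab0 : 0 < w `|a|%N * w `|b|%N by rewrite mulr_gt0.
exists K; first by rewrite addr_gt0// mulr_gt0// invr_gt0.
move=> g bg pg eg; rewrite !big_cons addrA.
have h1 := hC g bg pg eg; have h2 := avg2_gap_atom a b bg pg eg.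
have := @psd_triangle _ g 1 (a + b) (\sum_(j <- s) j) pg eg.
have h3 : g 0 - g (a + b) <= (w `|a|%N * w `|b|%N)^-1 * (g 0 - A (A g) 0).
  by rewrite mulrC ler_pdivlMr// mulrC.
set G := g 0 - A (A g) 0 in h1 h3 *.
have -> : K * G = 2 * ((w `|a|%N * w `|b|%N)^-1 * G) + 2 * (C * G) by rewrite /K; ring.
lra.
Qed.

End EvenWalk.

(** * Return probabilities *)

Section ReturnProbabilities.
Variables (R : realType) (w : nat -> R).
Hypothesis w_ge0 : forall k, 0 <= w k.
Hypothesis w_total : series (fun k => w k *+ 2) @ \oo --> (1 : R).
Hypothesis w_moment2 : cvgn (series (fun k => w k * k%:R ^+ 2)).

Local Notation A := (avg w).
Local Notation D := (diff2 1).
Implicit Types g : int -> R.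

Variable C1 : R.
Hypothesis C1_gt0 : 0 < C1.
Hypothesis gap_ge : forall g, unif_bounded g -> psd g -> even_fun g ->
  g 0 - g 1 <= C1 * (g 0 - A (A g) 0).

Definition avg2 g := A (A g).
(** The law of the walk at time 2n. *)
Definition ret n : int -> R := iter n avg2 (@delta0 R).
Definition v n : R := ret n 0.
Definition V n : R := \sum_(i < n) v i ^+ 2.

Lemma avg2_bounded g : unif_bounded g -> unif_bounded (avg2 g).
Proof. by move=> bg; do 2! apply: avg_bounded => //. Qed.

Lemma avg2_even g : even_fun g -> even_fun (avg2 g).
Proof. by move=> eg; do 2! apply: avg_even. Qed.

Lemma delta0_bounded : unif_bounded (@delta0 R).
Proof. by exists 1 => z; rewrite /delta0; case: (z == 0); rewrite ?normr1 ?normr0. Qed.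

Definition nice g := [/\ unif_bounded g, psd g & even_fun g].

Lemma nice_delta0 : nice (@delta0 R).
Proof.
by split; [exact: delta0_bounded | exact: delta0_psd | exact: delta0_even].
Qed.

Lemma nice_avg2 g : nice g -> nice (avg2 g).
Proof.
move=> [bg pg eg]; split; [exact: avg2_bounded | | exact: avg2_even].
exact: avg2_psd.
Qed.

Lemma nice_diff2 g : nice g -> nice (D g).
Proof.
by move=> [bg pg eg]; split; [exact: diff2_bounded|exact: diff2_psd|exact: diff2_even].
Qed.

Lemma nice_ret n : nice (ret n).
Proof. by elim: n => [|n IH]; [exact: nice_delta0 | exact: nice_avg2]. Qed.

Lemma nice_iter_diff2 j g : nice g -> nice (iter j D g).
Proof. by move=> ng; elim: j => //= j IH; exact: nice_diff2. Qed.

Lemma nice_avg2_le g : nice g -> avg2 g 0 <= g 0.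
Proof.
move=> [bg pg eg]; rewrite -subr_ge0.
exact: psd_ge0 (avg2_gap_psd w_ge0 w_total w_moment2 bg pg).
Qed.

Lemma v_ge0 n : 0 <= v n.
Proof. by have [_ p _] := nice_ret n; exact: psd_ge0. Qed.

Lemma v_decr n : v n.+1 <= v n.
Proof. exact: nice_avg2_le (nice_ret n). Qed.

Lemma v_mono m n : (m <= n)%N -> v n <= v m.
Proof.
move=> /subnKC <-; elim: (n - m)%N => [|k IH]; first by rewrite addn0.
by rewrite addnS (le_trans (v_decr _)).
Qed.

Lemma v_0 : v 0 = 1.
Proof. by rewrite /v /ret /= /delta0 eqxx. Qed.

Lemma v_le1 n : v n <= 1.
Proof. by rewrite -v_0 v_mono. Qed.

(** The loss [g - avg2 g] is again positive definite, so its value at 0 does not increase under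
    [avg2]. *)
Lemma v_convex n : v n.+1 - v n.+2 <= v n - v n.+1.
Proof.
have [bg pg eg] := nice_ret n.
have ng : nice (fun x => 1 * ret n x + (-1) * avg2 (ret n) x).
  split.
  - by apply: unif_bounded_lin => //; exact: avg2_bounded.
  - have := avg2_gap_psd w_ge0 w_total w_moment2 bg pg; congr psd.
    by apply/funext => x; rewrite mul1r mulN1r.
  - by move=> z; rewrite eg avg2_even.
have := nice_avg2_le ng; rewrite /avg2.
have -> : A (fun x => 1 * ret n x + (-1) * avg2 (ret n) x) =
  fun x => 1 * A (ret n) x + (-1) * A (avg2 (ret n)) x.
  by apply/funext => x; rewrite avg_lin//; exact: avg2_bounded.
rewrite avg_lin//; try exact: avg_bounded.
- by rewrite !mul1r !mulN1r.
- by apply: avg_bounded => //; exact: avg2_bounded.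
Qed.

(** * Decay of the return probabilities *)

Definition gap n : R := v n - ret n 1.

Lemma gap_ge0 n : 0 <= gap n.
Proof. by have [_ p e] := nice_ret n; rewrite subr_ge0 psd_le. Qed.

Lemma ret_le n z : ret n z <= v n.
Proof. by have [_ p e] := nice_ret n; exact: psd_le. Qed.

Lemma ret_gap n z : v n - ret n z <= z%:~R ^+ 2 * gap n.
Proof. by have [_ p e] := nice_ret n; exact: psd_increment. Qed.

Lemma gap_le n : gap n <= C1 * (v n - v n.+1).
Proof. by have [b p e] := nice_ret n; exact: gap_ge. Qed.

(** Each gap costs a decrement of [v], and the decrements telescope below [v 0 = 1]. *)
Lemma sum_gap_le n : \sum_(i < n) gap i <= C1.
Proof.
apply: (@le_trans _ _ (\sum_(i < n) C1 * (v i - v i.+1))).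
  by apply: ler_sum => i _; exact: gap_le.
rewrite -mulr_sumr ler_piMr// ?(ltW C1_gt0)//.
have -> : \sum_(i < n) (v i - v i.+1) = v 0 - v n.
  elim: n => [|n IH]; first by rewrite big_ord0 subrr.
  by rewrite big_ord_recr /= IH; ring.
by rewrite v_0 lerBlDr lerDl v_ge0.
Qed.

(** The probability of a block of consecutive sites, a finite substitute for the total mass that
    obeys the same recursion as [ret]. *)
Definition window n L x : R := \sum_(i < L) ret n (x + i%:Z).

Lemma window_bounded n L : unif_bounded (window n L).
Proof.
by apply: unif_bounded_sum => i; apply: unif_bounded_comp; have [] := nice_ret n.
Qed.

Lemma window_recE n L : window n.+1 L = A (A (window n L)).
Proof.
have H g : unif_bounded g ->
    A (fun x => \sum_(i < L) g (x + i%:Z)) = fun x => \sum_(i < L) A g (x + i%:Z).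
  move=> bg; apply/funext => x; rewrite /avg Esym_sum//.
    by apply: eq_bigr => i _; apply: eq_Esym => u; rewrite addrAC.
  by move=> i; exact: (@unif_bounded_comp _ g (fun u => x + u + i%:Z)).
have [bg _ _] := nice_ret n.
by rewrite /window !H//; exact: avg_bounded.
Qed.

Lemma ret_ge0 n z : 0 <= ret n z.
Proof.
suff: forall n, forall z, 0 <= ret n z by [].
clear n z; elim=> [|n IH] z; first by rewrite /ret /= /delta0 ler0n.
have [bg _ _] := nice_ret n.
have AE g x : unif_bounded g -> (forall z, 0 <= g z) -> 0 <= A g x.
  move=> b h; rewrite -[X in X <= _](Esym_cst w_total 0); apply: Esym_le => //.
    exact/unif_bounded_quad/unif_bounded_cst.
  exact/unif_bounded_quad/unif_bounded_comp.
by apply: (AE); [exact: avg_bounded | move=> y; exact: AE].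
Qed.

Lemma window_le1 n L x : window n L x <= 1.
Proof.
elim: n x => [|n IH] x.
  rewrite /window /ret /=; case: (pselect (exists i : 'I_L, x + i%:Z = 0)).
    move=> [i xi]; rewrite (bigD1 i)//= big1 ?addr0 => [|j ji].
      by rewrite /delta0; case: (_ == _).
    rewrite /delta0; case: eqP => //= xj; case/eqP: ji; apply/val_inj => /=; lia.
  move=> h; rewrite big1// => i _; rewrite /delta0; case: eqP => //= xi.
  by case: h; exists i.
have AE g y : unif_bounded g -> (forall z, g z <= 1) -> A g y <= 1.
  move=> b h; rewrite -[X in _ <= X](Esym_cst w_total 1); apply: Esym_le => //.
    exact/unif_bounded_quad/unif_bounded_comp.
  exact/unif_bounded_quad/unif_bounded_cst.
have bw := window_bounded n L.
by rewrite window_recE AE//; [exact: avg_bounded | move=> z; exact: AE].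
Qed.

(** Sites within distance L of the origin have probability at least [v n - L ^ 2 * gap n], and L of
    them carry mass at most 1. With L just above 2 / v n one has 2 <= L * v n <= 3, hence 1 <= L ^ 3
    * gap n; the constant 27 is 3 ^ 3. *)
Lemma v_cube_le n : v n ^+ 3 <= 27 * gap n.
Proof.
have [v0|vn0] := eqVneq (v n) 0.
  by rewrite v0 expr0n mulr_ge0 ?gap_ge0.
have vp : 0 < v n by rewrite lt_neqAle eq_sym vn0 v_ge0.
pose L := (Num.truncn (2 / v n)).+1.
have h0 : 0 <= 2 / v n by rewrite divr_ge0 ?v_ge0.
have /andP[L1 L2] := Num.Theory.truncn_itv h0.
have Llow : 2 <= L%:R * v n by rewrite -ler_pdivrMr// ltW.
have Lup : L%:R * v n <= 3.
  rewrite /L -natr1 mulrDl mul1r.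
  have := ler_wpM2r (v_ge0 n) L1; rewrite divfK// => h.
  have := v_le1 n; lra.
have := window_le1 n L 0; rewrite /window => wl.
have : L%:R * v n - L%:R * (L%:R ^+ 2 * gap n) <= 1.
  apply: le_trans wl.
  have -> : L%:R * v n - L%:R * (L%:R ^+ 2 * gap n) =
      \sum_(i < L) (v n - L%:R ^+ 2 * gap n).
    by rewrite sumr_const card_ord -mulr_natl; ring.
  apply: ler_sum => i _; rewrite add0r lerBlDr -lerBlDl.
  apply: (le_trans (ret_gap _ _)); rewrite ler_wpM2r ?gap_ge0//.
  by rewrite lerXn2r ?nnegrE// -[X in _ <= X]/(L%:Z%:~R) ler_int lez_nat ltnW.
set l := L%:R; move=> h1.
have h2 : 1 <= l ^+ 3 * gap n.
  have -> : l ^+ 3 * gap n = l * (l ^+ 2 * gap n) by ring.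
  rewrite -/l in Llow; lra.
have h3 : (l * v n) ^+ 3 <= 27.
  have -> : 27 = 3 ^+ 3 :> R by ring.
  by rewrite lerXn2r ?nnegrE// mulr_ge0 ?v_ge0.
have lp : 0 < l ^+ 3 by rewrite exprn_gt0// ltr0n.
rewrite -(ler_pM2l lp) -exprMn (le_trans h3)//; lra.
Qed.

(** By the cube bound [v] loses at least v n ^ 3 / C per unit of time, a discrete form of y' = - y ^
    3 / C, whose solutions decay like n ^ -1/2. With s = v n ^ 2 / C the induction closes because (1
    + s) (1 - s) ^ 2 <= 1. *)
Lemma v_sq_le : exists2 C, 0 < C & forall n, n%:R * v n ^+ 2 <= C.
Proof.
pose C := 27 * C1; have Cp : 0 < C by rewrite mulr_gt0.
exists C => //; elim=> [|n IH]; first by rewrite mul0r ltW.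
set a := v n in IH *; set b := v n.+1.
have a0 : 0 <= a := v_ge0 n; have b0 : 0 <= b := v_ge0 n.+1.
have h : a ^+ 3 <= C * (a - b).
  apply: (le_trans (v_cube_le n)); rewrite /C -mulrA ler_pM2l//; exact: gap_le.
have [az|an0] := eqVneq a 0.
  have -> : b = 0 by apply/eqP; rewrite eq_le b0 andbT -az v_decr.
  by rewrite expr0n mulr0 ltW.
have ap : 0 < a by rewrite lt_neqAle eq_sym an0.
pose s := a ^+ 2 / C.
have s0 : 0 <= s by rewrite divr_ge0 ?sqr_ge0 ?ltW.
have aE : a ^+ 2 = C * s by rewrite mulrC divfK// gt_eqF.
have bs : b <= a * (1 - s).
  rewrite -(ler_pM2l Cp).
  have -> : C * (a * (1 - s)) = C * a - a * (C * s) by ring.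
  have e3 : a ^+ 3 = a * (C * s) by rewrite exprS aE.
  rewrite -e3; lra.
have s1 : 0 <= 1 - s by rewrite -(pmulr_rge0 _ ap) (le_trans b0).
have ns : n%:R * s <= 1.
  by rewrite -(ler_pM2l Cp) mulr1 mulrCA -aE.
have b2 : b ^+ 2 <= (a * (1 - s)) ^+ 2 by rewrite lerXn2r ?nnegrE// mulr_ge0.
apply: (@le_trans _ _ (n.+1%:R * (a * (1 - s)) ^+ 2)); first by rewrite ler_wpM2l.
rewrite exprMn aE.
have -> : n.+1%:R * (C * s * (1 - s) ^+ 2) = C * ((n%:R * s + s) * (1 - s) ^+ 2).
  by rewrite -natr1; ring.
rewrite ler_piMr ?(ltW Cp)//.
apply: (@le_trans _ _ ((1 + s) * (1 - s) ^+ 2)).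
  by rewrite ler_wpM2r ?sqr_ge0// lerD2r.
have -> : (1 + s) * (1 - s) ^+ 2 = (1 - s ^+ 2) * (1 - s) by ring.
have s2 := sqr_ge0 s.
have : s ^+ 2 <= 1 by rewrite expr_le1//; lra.
nra.
Qed.

Lemma avg_ge_parabola g c x : unif_bounded g ->
  (forall z, c - z%:~R ^+ 2 <= g z) -> c - step_var w - x%:~R ^+ 2 <= A g x.
Proof.
move=> bg h.
have -> : c - step_var w - x%:~R ^+ 2 = 1 * Esym w (fun=> c) + (-1) * A (fun z => z%:~R ^+ 2) x.
  by rewrite (avg_sq w_ge0 w_total w_moment2) (Esym_cst w_total) /step_var; ring.
have qc : @quad_bounded R (fun=> c) by exact/unif_bounded_quad/unif_bounded_cst.
have qs := @quad_bounded_sq R x.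
rewrite /avg -(Esym_lin w_ge0 w_total w_moment2 1 (-1) qc qs); apply: Esym_le => //.
- exact: quad_bounded_lin.
- exact/unif_bounded_quad/unif_bounded_comp.
- by move=> z; rewrite mul1r mulN1r.
Qed.

(** Chebyshev's inequality propagated in time: L ^ 2 times the indicator of [-L, L] lies above L ^ 2
    - x ^ 2, and each averaging lowers such a parabola by the variance of a step. *)
Lemma window_ge n L x :
  L%:R ^+ 2 - n%:R * (step_var w *+ 2) - x%:~R ^+ 2 <=
  L%:R ^+ 2 * window n (L.*2.+1) (x - L%:Z).
Proof.
elim: n x => [|n IH] x.
  rewrite mul0r subr0.
  have w0 : 0 <= window 0 L.*2.+1 (x - L%:Z).
    by apply: sumr_ge0 => i _; exact: ret_ge0.
  have [xL|xL] := leqP `|x|%N L.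
    have iL : (`|L%:Z - x|%N < L.*2.+1)%N by lia.
    rewrite /window (bigD1 (Ordinal iL))//=.
    have -> : x - L%:Z + `|L%:Z - x|%N = 0 by lia.
    rewrite /ret /= {1}/delta0 eqxx mulrDr mulr1 lerD2l.
    apply: (@le_trans _ _ 0); first by rewrite oppr_le0 sqr_ge0.
    by apply: mulr_ge0; [exact: sqr_ge0 | apply: sumr_ge0 => i _; exact: (ret_ge0 0)].
  apply: (@le_trans _ _ 0); last by rewrite mulr_ge0 ?sqr_ge0.
  rewrite subr_le0 -[x%:~R ^+ 2]real_normK ?num_real// -intr_norm.
  by rewrite lerXn2r ?nnegrE// -[L%:R]/(L%:Z%:~R) ler_int; lia.
pose f y := L%:R ^+ 2 * window n L.*2.+1 (y - L%:Z).
have bf : unif_bounded f.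
  by apply: unif_boundedZ; apply: unif_bounded_comp; exact: window_bounded.
have fE : L%:R ^+ 2 * window n.+1 L.*2.+1 (x - L%:Z) = A (A f) x.
  have AZ c h : unif_bounded h -> A (fun y => c * h (y - L%:Z)) = fun y => c * A h (y - L%:Z).
    move=> bh; apply/funext => y; rewrite /avg EsymZ//.
      by congr (_ * _); apply: eq_Esym => u; rewrite addrAC.
    by apply/unif_bounded_quad; exact: (@unif_bounded_comp _ h (fun u => y + u - L%:Z)).
  rewrite /f AZ; last exact: window_bounded.
  rewrite AZ; last by apply: avg_bounded => //; exact: window_bounded.
  by rewrite window_recE.
rewrite fE.
have := @avg_ge_parabola (A f) (L%:R ^+ 2 - n%:R * (step_var w *+ 2) - step_var w) x.
have -> : L%:R ^+ 2 - n%:R * (step_var w *+ 2) - step_var w - step_var w - x%:~R ^+ 2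
   = L%:R ^+ 2 - n.+1%:R * (step_var w *+ 2) - x%:~R ^+ 2 by rewrite -natr1; ring.
apply; first exact: avg_bounded.
by move=> y; exact: avg_ge_parabola.
Qed.

(** Stated at squares so that the half-width L = m * S is an integer multiple of the square root of
    the time. As S ^ 2 is at least four times the variance, half of the mass lies on 2L + 1 <= 3L
    sites, none more likely than the origin. *)
Lemma v_lower : exists2 c, 0 < c & forall m : nat, (0 < m)%N -> c <= (m ^ 2)%:R * v (m ^ 2) ^+ 2.
Proof.
have [S0 hS0] : exists S0 : nat, 4 * step_var w <= S0%:R.
  have h0 : 0 <= 4 * step_var w by rewrite mulr_ge0// step_var_ge0.
  have /andP[_ h] := Num.Theory.truncn_itv h0.
  by exists (Num.truncn (4 * step_var w)).+1; exact: ltW.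
pose S := S0.+1.
have hS : 4 * step_var w <= S%:R ^+ 2.
  apply: (le_trans hS0); rewrite /S -natrX ler_nat; nia.
exists ((36 * S%:R ^+ 2)^-1); first by rewrite invr_gt0 mulr_gt0// exprn_gt0// ltr0n.
move=> m m0; pose L := (m * S)%N.
have Lp : (0 < L)%N by rewrite muln_gt0 m0.
have := window_ge (m ^ 2) L 0; rewrite expr0n /= subr0.
have wu : window (m ^ 2) L.*2.+1 (0 - L%:Z) <= L.*2.+1%:R * v (m ^ 2).
  rewrite /window (le_trans (ler_sum _ (fun i _ => ret_le _ _)))//.
  by rewrite sumr_const card_ord mulr_natl.
move=> h.
have hv : (m ^ 2)%:R * (step_var w *+ 2) <= L%:R ^+ 2 / 2.
  rewrite /L natrM exprMn natrX -[X in _ <= X]mulrA ler_wpM2l ?sqr_ge0//.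
  rewrite -mulr_natr; lra.
have L2p : 0 < L%:R ^+ 2 :> R by rewrite exprn_gt0// ltr0n.
have h2 : 1 / 2 <= L.*2.+1%:R * v (m ^ 2).
  rewrite -(ler_pM2l L2p); apply: le_trans (ler_wpM2l (ltW L2p) wu).
  apply: le_trans h; lra.
have L3 : L.*2.+1%:R <= 3 * L%:R :> R by rewrite -natrM ler_nat; lia.
have h3 : 1 <= 6 * (L%:R * v (m ^ 2)).
  have := ler_wpM2r (v_ge0 (m ^ 2)) L3; rewrite -mulrA; lra.
have h4 : 1 <= (6 * (L%:R * v (m ^ 2))) ^+ 2 by exact: exprn_ege1.
rewrite -div1r ler_pdivrMr; last by rewrite mulr_gt0// exprn_gt0// ltr0n.
apply: (le_trans h4); rewrite /L natrM natrX le_eqVlt; apply/orP; left; apply/eqP; ring.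
Qed.

Lemma V_ge0 n : 0 <= V n.
Proof. by apply: sumr_ge0 => i _; exact: sqr_ge0. Qed.

Lemma V_mono m n : (m <= n)%N -> V m <= V n.
Proof.
move=> /subnKC <-; elim: (n - m)%N => [|k IH]; first by rewrite addn0.
by rewrite addnS /V big_ord_recr /= (le_trans IH)// lerDl sqr_ge0.
Qed.

(** Powers of 4 are squares, so [v_lower] makes each block from 4 ^ k to 4 ^ (k + 1) contribute at
    least c / 2. *)
Lemma V_unbounded M : exists n, M <= V n.
Proof.
have [c c0 hc] := v_lower.
have key k : k%:R * (c / 2) <= V (4 ^ k).
  elim: k => [|k IH]; first by rewrite mul0r V_ge0.
  have -> : (4 ^ k.+1 = 4 ^ k + 3 * 4 ^ k)%N by rewrite expnS; lia.
  rewrite /V big_split_ord /= -natr1 mulrDl mul1r lerD//.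
  apply: (@le_trans _ _ (\sum_(i < 3 * 4 ^ k) v (4 ^ k.+1) ^+ 2)).
    rewrite sumr_const card_ord -mulr_natl.
    have /hc : (0 < 2 ^ k.+1)%N by rewrite expn_gt0.
    rewrite -expnM mulnC expnM -[(2 ^ 2)%N]/4%N => h.
    have : 4 * ((3 * 4 ^ k)%:R * v (4 ^ k.+1) ^+ 2) = 3 * ((4 ^ k.+1)%:R * v (4 ^ k.+1) ^+ 2).
      by rewrite expnS !natrM; ring.
    lra.
  apply: ler_sum => i _; rewrite lerXn2r ?nnegrE ?v_ge0// v_mono// expnS.
  have := ltn_ord i; lia.
have c2 : 0 < c / 2 by rewrite divr_gt0.
have [M0|M0] := leP M 0; first by exists 0%N; rewrite (le_trans M0)// V_ge0.
have h0 : 0 <= M / (c / 2) by rewrite divr_ge0// ltW.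
have /andP[_ h] := Num.Theory.truncn_itv h0.
exists (4 ^ (Num.truncn (M / (c / 2))).+1)%N; apply: le_trans (key _).
by rewrite -ler_pdivrMr// ltW.
Qed.

Lemma v_small e : 0 < e -> exists m, v m <= e.
Proof.
move=> e0; have [C C0 hC] := v_sq_le.
apply: contrapT => /forallNP h.
have h0 : 0 <= C / e ^+ 2 by rewrite divr_ge0 ?sqr_ge0// ltW.
have /andP[_] := Num.Theory.truncn_itv h0.
set m := (Num.truncn _).+1 => hm.
have e2 : 0 < e ^+ 2 by rewrite exprn_gt0.
rewrite ltr_pdivrMr// in hm.
have := hC m; have /negP := h m; rewrite -ltNge => vm.
have : m%:R * e ^+ 2 <= m%:R * v m ^+ 2.
  by rewrite ler_wpM2l// lerXn2r ?nnegrE ?(ltW e0) ?v_ge0// ltW.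
by move=> /le_trans/[apply]; rewrite leNgt hm.
Qed.

(** In Fourier terms, the mean of (1 - cos) ^ j times the 2n-th power of the characteristic
    function. *)
Definition ediff j n : R := iter j D (ret n) 0.

Lemma diff2_avg g : unif_bounded g -> D (A g) = A (D g).
Proof.
move=> bg; apply/funext => x.
have -> : D g = fun x => 1 * g x + (- 2^-1) * (1 * g (x + 1) + 1 * g (x - 1)).
  by apply/funext => y; rewrite /diff2; field.
rewrite avg_lin//; last by apply: unif_bounded_lin; exact: unif_bounded_comp.
rewrite (@avg_lin _ _ _ _ _ 1 1 (fun x => g (x + 1)) (fun x => g (x - 1)))//;
  try exact: unif_bounded_comp.
by rewrite !avg_shift /diff2; field.
Qed.

Lemma iter_diff2_ret j n : iter j D (ret n.+1) = avg2 (iter j D (ret n)).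
Proof.
elim: j => // j IH; rewrite !iterS IH /avg2.
have [bg _ _] := nice_iter_diff2 j (nice_ret n).
by rewrite !diff2_avg//; exact: avg_bounded.
Qed.

Lemma ediff_ge0 j n : 0 <= ediff j n.
Proof. by have [_ p _] := nice_iter_diff2 j (nice_ret n); exact: psd_ge0. Qed.

(** Together with [ediff_lower]: up to constants, [ediff j.+1] is the time decrement of
    [ediff j]. *)
Lemma ediff_upper j n : ediff j.+1 n <= C1 * (ediff j n - ediff j n.+1).
Proof.
have [b p e] := nice_iter_diff2 j (nice_ret n).
by rewrite /ediff iterS diff2_at0// iter_diff2_ret; exact: gap_ge.
Qed.

Lemma ediff_lower j n : ediff j n - ediff j n.+1 <= step_var w *+ 2 * ediff j.+1 n.
Proof.
have [b p e] := nice_iter_diff2 j (nice_ret n).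
by rewrite /ediff iterS diff2_at0// iter_diff2_ret; exact: avg2_gap_le.
Qed.

Lemma ediff_decr j n : ediff j n.+1 <= ediff j n.
Proof. by rewrite /ediff iter_diff2_ret nice_avg2_le//; apply/nice_iter_diff2/nice_ret. Qed.

Lemma ediff_double j k n : ediff (j + k) n <= 2 ^+ k * ediff j n.
Proof.
elim: k => [|k IH]; first by rewrite addn0 expr0 mul1r.
apply: (@le_trans _ _ (2 * ediff (j + k) n)); last first.
  by rewrite exprS -mulrA ler_pM2l.
rewrite addnS /ediff iterS.
have [b p e] := nice_iter_diff2 (j + k) (nice_ret n).
rewrite diff2_at0//; have := psd_abs p e 1; rewrite ler_norml => /andP[]; lra.
Qed.

Definition expdecay (u : nat -> R) : Prop :=
  exists rho C : R, [/\ 0 <= rho, rho < 1 & forall n, u n.+1 <= C * rho ^+ n].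

(** The decrements of [ediff j] are bounded by [ediff j.+1], and [ediff j] becomes arbitrarily small
    because it is at most 2 ^ j * v n; so it is bounded by the tail of a geometric series, whose sum
    gives K. *)
Lemma expdecay_ediff j : expdecay (ediff j.+1) -> expdecay (ediff j).
Proof.
move=> [rho [C [r0 r1 hC]]].
have r1' : 0 < 1 - rho by rewrite subr_gt0.
pose B := step_var w *+ 2.
have B0 : 0 <= B by rewrite mulrn_wge0// step_var_ge0.
pose K := B * C / (1 - rho).
have KE : B * C = K * (1 - rho) by rewrite /K divfK// gt_eqF.
have step n m : ediff j n.+1 <= ediff j (n + m).+1 + K * rho ^+ n * (1 - rho ^+ m).
  elim: m => [|m IH]; first by rewrite addn0 expr0 subrr mulr0 addr0.
  apply: (le_trans IH); rewrite addnS.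
  have h1 := ediff_lower j (n + m).+1; have h2 := ler_wpM2l B0 (hC (n + m)%N).
  have e1 : B * (C * rho ^+ (n + m)) = K * (1 - rho) * (rho ^+ n * rho ^+ m).
    by rewrite mulrA KE exprD.
  rewrite -/B in h1; rewrite e1 in h2.
  have -> : K * rho ^+ n * (1 - rho ^+ m.+1) = K * rho ^+ n * (1 - rho ^+ m) +
      K * (1 - rho) * (rho ^+ n * rho ^+ m) by rewrite exprS; ring.
  lra.
have K0 : 0 <= K.
  rewrite /K divr_ge0 ?(ltW r1')// mulr_ge0//.
  by have := hC 0%N; rewrite expr0 mulr1; apply: le_trans; exact: ediff_ge0.
exists rho, K; split=> // n; apply/ler_addgt0Pr => e e0.
have [|m hm] := @v_small (e / 2 ^+ j); first by rewrite divr_gt0// exprn_gt0.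
apply: (le_trans (step n m)); rewrite addrC lerD//.
  by apply: ler_piMr; [rewrite mulr_ge0 ?exprn_ge0 | rewrite lerBlDr lerDl exprn_ge0].
have := ediff_double 0 j (n + m).+1; rewrite add0n; move/le_trans; apply.
rewrite mulrC -ler_pdivlMr ?exprn_gt0//; apply: le_trans hm; apply: (@v_mono m (n + m).+1); lia.
Qed.

Lemma not_expdecay_v : ~ expdecay (ediff 0).
Proof.
move=> [rho [C [r0 r1 hC]]].
have r1' : 0 < 1 - rho by rewrite subr_gt0.
have C0 : 0 <= C by have := hC 0%N; rewrite expr0 mulr1; apply: le_trans; exact: ediff_ge0.
have geo n : (1 - rho) * \sum_(i < n) rho ^+ i = 1 - rho ^+ n.
  elim: n => [|n IH]; first by rewrite big_ord0 mulr0 subrr.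
  by rewrite big_ord_recr /= mulrDr IH exprS; ring.
have [n hn] := V_unbounded (1 + C / (1 - rho) + 1).
have : V n <= 1 + C / (1 - rho).
  apply: (le_trans (V_mono (leqnSn n))); rewrite /V big_ord_recl v_0 expr1n lerD2l.
  rewrite ler_pdivlMr// mulrC.
  apply: (@le_trans _ _ ((1 - rho) * \sum_(i < n) C * rho ^+ i)).
    rewrite ler_pM2l//; apply: ler_sum => i _; apply: le_trans (hC i).
    by rewrite expr2 ler_piMr ?v_ge0 ?v_le1.
  by rewrite -mulr_sumr mulrCA geo; apply: ler_piMr => //; rewrite lerBlDr lerDl exprn_ge0.
lra.
Qed.

Lemma not_expdecay_ediff j : ~ expdecay (ediff j).
Proof. by elim: j => [|j IH]; [exact: not_expdecay_v | move/expdecay_ediff]. Qed.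

(** Let j0 be the first index with a non-zero coefficient. The relation bounds [ediff j0] by a
    multiple of [ediff j0.+1], since all later differences are at most constant multiples of the
    latter; and [ediff j0.+1] is bounded by the decrement of [ediff j0]. A sequence dominated by its
    own decrement decays geometrically. *)
Lemma ediff_indep M (b : nat -> R) :
  (forall n, \sum_(j < M) b j * ediff j n.+1 = 0) -> forall j, (j < M)%N -> b j = 0.
Proof.
move=> hb j jM; apply/eqP/contraT => bj.
have ex : exists i, (i < M)%N && (b i != 0) by exists j; rewrite jM bj.
case: (ex_minnP ex) => j0 /andP[j0M bj0] jmin.
exfalso; apply: (@not_expdecay_ediff j0).
pose B := \sum_(i < M) `|b i| * 2 ^+ i.
have B0 : 0 <= B by apply: sumr_ge0 => i _; rewrite mulr_ge0// exprn_ge0.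
have bp : 0 < `|b j0| by rewrite normr_gt0.
have key n : `|b j0| * ediff j0 n.+1 <= B * ediff j0.+1 n.+1.
  have := hb n; rewrite (bigD1 (Ordinal j0M))//= => /eqP; rewrite addr_eq0 => /eqP e1.
  rewrite -[ediff j0 n.+1]ger0_norm ?ediff_ge0// -normrM e1 normrN.
  rewrite (le_trans (ler_norm_sum _ _ _))// /B mulr_suml.
  rewrite [X in _ <= X](bigD1 (Ordinal j0M))//=.
  rewrite (le_trans (_ : _ <= \sum_(i < M | i != Ordinal j0M)
      `|b i| * 2 ^+ i * ediff j0.+1 n.+1))//.
    apply: ler_sum => i ij0.
    have [lt|ge] := ltnP i j0.
      have -> : b i = 0.
        by apply/eqP/contraT => bi; have := jmin i; rewrite bi ltn_ord leqNgt lt => /(_ isT).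
      by rewrite mul0r normr0 !mul0r.
    have lt : (j0 < i)%N.
      by rewrite ltn_neqAle ge andbT eq_sym; apply: contra ij0 => /eqP h; apply/eqP/val_inj.
    rewrite normrM -mulrA ler_wpM2l// ger0_norm ?ediff_ge0//.
    have := ediff_double j0.+1 (i - j0.+1) n.+1; rewrite subnKC// => /le_trans; apply.
    by rewrite ler_wpM2r ?ediff_ge0// ler_weXn2l ?ler1n// leq_subr.
  by rewrite lerDr mulr_ge0 ?ediff_ge0// mulr_ge0// exprn_ge0.
(* The second summand keeps K positive and rho non-negative. *)
pose K := B * C1 + `|b j0| *+ 2.
have K0 : 0 < K by rewrite ltr_wpDl ?pmulrn_lgt0// mulr_ge0// ltW.
pose rho := 1 - `|b j0| / K.
have rE : K * (1 - rho) = `|b j0| by rewrite /rho opprB addrC subrK mulrC divfK// gt_eqF.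
have r1 : rho < 1 by rewrite /rho ltrBlDr ltrDl divr_gt0.
have r0 : 0 <= rho.
  rewrite /rho subr_ge0 ler_pdivrMr// mul1r /K mulr2n.
  have := mulr_ge0 B0 (ltW C1_gt0); lra.
exists rho, (ediff j0 1); split => //; elim=> [|n IH]; first by rewrite expr0 mulr1.
apply: (@le_trans _ _ (rho * ediff j0 n.+1)); last first.
  by rewrite exprS mulrCA ler_wpM2l.
rewrite -(ler_pM2l K0).
have h1 := ler_wpM2l B0 (ediff_upper j0 n.+1); have h2 := key n.
have h3 : 0 <= ediff j0 n.+1 - ediff j0 n.+2 by rewrite subr_ge0 ediff_decr.
have h4 := mulr_ge0 (ltW bp) h3.
have h5 : K * (ediff j0 n.+1 - ediff j0 n.+2) >= `|b j0| * ediff j0 n.+1.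
  rewrite /K mulrDl mulr2n mulrDl -mulrA; lra.
have -> : K * (rho * ediff j0 n.+1) = K * ediff j0 n.+1 - `|b j0| * ediff j0 n.+1.
  by rewrite -rE; ring.
lra.
Qed.

(* The coefficients of the Chebyshev polynomial of degree [d] in the variable
   [1 - cos]. *)
Lemma even_fun_expand d : exists c : nat -> R,
  [/\ c d != 0, forall j, (d < j)%N -> c j = 0 &
   forall g, even_fun g -> forall M, (d < M)%N ->
     g d%:Z = \sum_(j < M) c j * iter j D g 0].
Proof.
pose P d := exists c : nat -> R,
  [/\ c d != 0, forall j, (d < j)%N -> c j = 0 &
   forall g, even_fun g -> forall M, (d < M)%N ->
     g d%:Z = \sum_(j < M) c j * iter j D g 0].
suff: P d /\ P d.+1 by case.
elim: d => [|d [[a [ad a0 ag]] [b [bd b0 bg]]]].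
  split.
    exists (fun j => (j == 0)%:R); split=> [|[]//|g eg [//|M] _]; first by rewrite oner_eq0.
    by rewrite big_ord_recl /= mul1r big1 ?addr0// => i _; rewrite mul0r.
  exists (fun j => (j == 0)%:R - (j == 1)%:R); split=> [|[|[]]//|g eg [//|[//|M]] _].
  - by rewrite /= sub0r oppr_eq0 oner_eq0.
  - by move=> n _; rewrite subrr.
  - rewrite !big_ord_recl /= big1 ?addr0 => [|i _]; last by rewrite subrr mul0r.
    by rewrite diff2_at0//; ring.
split; first by exists b.
exists (fun j => 2 * b j - a j - 2 * (if j is i.+1 then b i else 0)); split.
- have -> : b d.+2 = 0 by apply: b0.
  have -> : a d.+2 = 0 by apply: a0; lia.
  by rewrite mulr0 subr0 sub0r oppr_eq0 mulf_neq0 ?pnatr_eq0.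
- case=> // j dj.
  have -> : b j.+1 = 0 by apply: b0; lia.
  have -> : a j.+1 = 0 by apply: a0; lia.
  have -> : b j = 0 by apply: b0; lia.
  by ring.
move=> g eg [//|M] dM.
have -> : g d.+2%:Z = 2 * g d.+1%:Z - g d%:Z - 2 * D g d.+1%:Z.
  rewrite /diff2.
  have -> : d.+1%:Z + 1 = d.+2%:Z by lia.
  have -> : d.+1%:Z - 1 = d%:Z by lia.
  by field.
rewrite (bg g eg M.+1) ?(ag g eg M.+1); try lia.
rewrite (bg (D g) (diff2_even _ eg) M); last lia.
rewrite !mulr_sumr -!sumrB.
have -> : \sum_(i < M) 2 * (b i * iter i D (D g) 0) =
   \sum_(j < M.+1) 2 * ((if j : nat is i.+1 then b i else 0) * iter j D g 0).
  rewrite big_ord_recl /= mul0r mulr0 add0r; apply: eq_bigr => i _.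
  by rewrite /= -iterSr.
by rewrite -sumrB; apply: eq_bigr => j _; ring.
Qed.

(** The value at distance d is a combination of differences at 0 of order at most d, with a non-zero
    coefficient at order d. The relation is thus triangular and its last coefficient vanishes. Times
    start at 1 because the lags of a word are positive. *)
Lemma ret_indep M (beta : nat -> R) :
  (forall k, \sum_(d < M) beta d * ret k.+1 d%:Z = 0) ->
  forall d, (d < M)%N -> beta d = 0.
Proof.
have [c hc] := choice even_fun_expand.
elim: M => // M IH hb.
have bM : beta M = 0.
  have := @ediff_indep M.+1 (fun j => \sum_(d < M.+1) beta d * c d j).
  have [cM _ _] := hc M.
  move=> /(_ _ M (ltnSn M)); rewrite big_ord_recr /= big1 ?add0r => [h|i _]; last first.
    by have [_ -> //] := hc i; rewrite mulr0.
  apply/eqP; have := cM; apply: contraNT => bM.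
  suff : beta M * c M M = 0 by move/eqP; rewrite mulf_eq0 (negPf bM).
  apply: h => n; rewrite -[RHS](hb n).
  under eq_bigr do rewrite mulr_suml.
  rewrite exchange_big; apply: eq_bigr => d _.
  have [_ _ hd] := hc d; have [_ _ er] := nice_ret n.+1.
  rewrite (hd _ er M.+1) ?ltn_ord// mulr_sumr.
  by apply: eq_bigr => j _; rewrite mulrA.
move=> d; rewrite ltnS leq_eqVlt => /orP[/eqP -> //|]; apply: IH => k.
by have := hb k; rewrite big_ord_recr /= bM mul0r addr0.
Qed.

(** * Correlation sums of the return probabilities *)

Lemma v_convex_lin j n : v j - v (j + n) <= n%:R * (v j - v j.+1).
Proof.
have mono k : v (j + k) - v (j + k).+1 <= v j - v j.+1.
  elim: k => [|k IH]; first by rewrite addn0.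
  by rewrite addnS (le_trans (v_convex _)).
elim: n => [|n IH]; first by rewrite addn0 subrr mul0r.
by rewrite addnS -natr1 mulrDl mul1r; have := mono n; lra.
Qed.

(** The sum is split at j = n. Below n, v (n + j) is at most v n and the partial sums of [v] are of
    order sqrt n. Beyond n, convexity bounds the drop over n steps by n single decrements, and v (n
    + j) times such a decrement is at most a decrement of v ^ 2, so the sum telescopes to n * v n ^
    2. *)
Lemma cov_sum_le : exists2 C, 0 <= C & forall n N,
  \sum_(j < N) v (n + j) * (v j - v (n + j)) <= C.
Proof.
have [C C0 hC] := v_sq_le; set c := Num.sqrt C.
have c0 : 0 <= c by exact: sqrtr_ge0.
have vc n : v n * Num.sqrt n%:R <= c.
  rewrite -(ler_pXn2r (ltn0Sn 1)) ?nnegrE//; last by rewrite mulr_ge0 ?v_ge0 ?sqrtr_ge0.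
  by rewrite exprMn !sqr_sqrtr ?(ltW C0)// mulrC.
(* Comparison with an integral: v n is at most c / sqrt n, and 1 / s <= 2 (s - u) for consecutive
   square roots u < s. *)
have sumv n : \sum_(j < n) v j.+1 <= 2 * c * Num.sqrt n%:R.
  elim: n => [|n IH]; first by rewrite big_ord0 sqrtr0 mulr0.
  rewrite big_ord_recr /=.
  have := vc n.+1; set s := Num.sqrt n.+1%:R => hs; pose u := Num.sqrt (n%:R : R).
  have s2 : s ^+ 2 = n.+1%:R by rewrite sqr_sqrtr.
  have u2 : u ^+ 2 = n%:R by rewrite sqr_sqrtr.
  have sp : 0 < s by rewrite sqrtr_gt0.
  have u0 : 0 <= u by exact: sqrtr_ge0.
  have us : u <= s by rewrite ler_sqrt// ler_nat.
  have su : s ^+ 2 - u ^+ 2 = 1 by rewrite s2 u2 -natr1; ring.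
  suff : v n.+1 <= 2 * c * (s - u) by rewrite -/u in IH; lra.
  rewrite -(ler_pM2r sp) (le_trans hs)//.
  have h1 : (s - u) * (s + u) <= (s - u) * (2 * s) by rewrite ler_wpM2l ?subr_ge0//; lra.
  have h2 : (s - u) * (s + u) = 1 by rewrite -su; ring.
  have -> : 2 * c * (s - u) * s = c * ((s - u) * (2 * s)) by ring.
  by apply: ler_peMr => //; lra.
exists (1 + 2 * c * c + C); first by rewrite addr_ge0 ?(ltW C0)// addr_ge0// mulr_ge0// mulr_ge0.
move=> n N.
have t0 j : 0 <= v (n + j) * (v j - v (n + j)).
  by rewrite mulr_ge0 ?v_ge0// subr_ge0 v_mono// leq_addl.
apply: (@le_trans _ _ (\sum_(j < n + N) v (n + j) * (v j - v (n + j)))).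
  rewrite addnC big_split_ord /= lerDl; apply: sumr_ge0 => i _; exact: t0.
rewrite big_split_ord /= lerD//.
  apply: (@le_trans _ _ (v n * \sum_(j < n) v j)).
    rewrite mulr_sumr; apply: ler_sum => j _; apply: ler_pM => //.
    - exact: v_ge0.
    - by rewrite subr_ge0 v_mono// leq_addl.
    - by apply: v_mono; rewrite leq_addr.
    - by rewrite lerBlDr lerDl v_ge0.
  have h : \sum_(j < n) v j <= 1 + 2 * c * Num.sqrt n%:R.
    apply: (@le_trans _ _ (\sum_(j < n.+1) v j)).
      by rewrite big_ord_recr /= lerDl v_ge0.
    by rewrite big_ord_recl v_0 lerD2l; exact: sumv.
  apply: (le_trans (ler_wpM2l (v_ge0 n) h)).
  rewrite mulrDr mulr1 lerD ?v_le1//.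
  have -> : v n * (2 * c * Num.sqrt n%:R) = 2 * c * (v n * Num.sqrt n%:R) by ring.
  by rewrite ler_wpM2l ?mulr_ge0.
apply: (@le_trans _ _ (n%:R * \sum_(i < N) (v (n + i) ^+ 2 - v (n + i).+1 ^+ 2))).
  rewrite mulr_sumr; apply: ler_sum => i _.
  set j := (n + i)%N.
  have -> : v j ^+ 2 - v j.+1 ^+ 2 = (v j + v j.+1) * (v j - v j.+1) by ring.
  rewrite mulrCA; apply: ler_pM.
  - exact: v_ge0.
  - by rewrite subr_ge0 v_mono// leq_addl.
  - by rewrite (@le_trans _ _ (v j)) ?lerDl ?v_ge0// v_mono// leq_addl.
  - by rewrite [(n + j)%N]addnC; exact: v_convex_lin.
apply: le_trans (hC n); rewrite ler_wpM2l//.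
have -> : \sum_(i < N) (v (n + i) ^+ 2 - v (n + i).+1 ^+ 2) = v n ^+ 2 - v (n + N) ^+ 2.
  elim: N => [|N IH]; first by rewrite big_ord0 addn0 subrr.
  by rewrite big_ord_recr /= IH addnS; ring.
by rewrite lerBlDr lerDl sqr_ge0.
Qed.

End ReturnProbabilities.

(** * Words of weighted jumps *)

Section SecondMoment.
Variables (R : realType) (a d : nat -> R) (C1 C2 : R).
Hypothesis a_ge0 : forall n, 0 <= a n.
Hypothesis a_le1 : forall n, a n <= 1.
Hypothesis a_mono : forall m n, (m <= n)%N -> a n <= a m.
Hypothesis d_ge0 : forall n, 0 <= d n.
Hypothesis d_sum : forall n, \sum_(i < n) d i <= C1.
Hypothesis cov : forall L N, \sum_(j < N) a (L + j) * (a j - a (L + j)) <= C2.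

Lemma sum_shift_le (s N : nat) (phi : nat -> R) : (forall j, 0 <= phi j) ->
  \sum_(m < N | (s <= m)%N) phi (m - s)%N <= \sum_(j < N) phi j.
Proof.
move=> p0; have [sN|Ns] := leqP s N; last first.
  rewrite big1 ?sumr_ge0// => m sm; exfalso; have := ltn_ord m; lia.
have [k ->] : exists k, N = (s + k)%N by exists (N - s)%N; lia.
rewrite big_mkcond big_split_ord /= big1 ?add0r => [|i _]; last first.
  by rewrite leqNgt ltn_ord.
rewrite addnC big_split_ord /=.
rewrite (le_trans (_ : _ <= \sum_(i < k) phi i))//.
  by apply: ler_sum => i _; rewrite leq_addr addKn.
by rewrite lerDl sumr_ge0.
Qed.

Variables (m1 : nat -> R) (m2 : nat -> nat -> R) (H B : R) (K : nat).
Hypothesis B_ge0 : 0 <= B.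
Hypothesis m1_close : forall n, `|m1 n - H * a n| <= B * d n.
Hypothesis m2_sym : forall n m, m2 n m = m2 m n.
Hypothesis m2_le1 : forall n m, m2 n m <= 1.
(** The second word sees the first only through the lag j that remains after the first has ended, K
    units after its initial observation. The product is thus close to H ^ 2 * a n * a j and not to H
    ^ 2 * a n * a m with m = n + K + 1 + j; [cov] pays for the difference. *)
Hypothesis m2_close : forall n j,
  `|m2 n (n + K.+1 + j) - H ^+ 2 * a n * a j| <= B * (a j * d n + a n * d j).

Let W N := \sum_(n < N) a n ^+ 2.

Let C2_ge0 : 0 <= C2.
Proof. by have := cov 0 0; rewrite big_ord0. Qed.

Let C1_ge0 : 0 <= C1.
Proof. by have := d_sum 0; rewrite big_ord0. Qed.

Let far n j := H ^+ 2 * a n ^+ 2 * (a (n + K.+1 + j) * (a j - a (n + K.+1 + j))) +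
  B * (d n * a j ^+ 2 + a n ^+ 2 * d j).

Let far_ge0 n j : 0 <= far n j.
Proof.
apply: addr_ge0; last by rewrite mulr_ge0// addr_ge0// mulr_ge0// sqr_ge0.
apply: mulr_ge0; first by rewrite mulr_ge0// sqr_ge0.
by rewrite mulr_ge0// subr_ge0 a_mono// leq_addl.
Qed.

Let near n j := if (j <= K)%N then a n ^+ 2 else 0.

Let near_ge0 n j : 0 <= near n j.
Proof. by rewrite /near; case: ifP => // _; exact: sqr_ge0. Qed.

(** The error of an ordered pair. For overlapping words only [m2 <= 1] is used; there are K + 1 of
    them for each n. *)
Let T n m := (if (n <= m)%N then near n (m - n)%N else 0) +
  (if (n + K.+1 <= m)%N then far n (m - (n + K.+1))%N else 0).

Let T_ge0 n m : 0 <= T n m.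
Proof. by rewrite /T addr_ge0//; case: ifP. Qed.

Let pair_le_ordered n m : (n <= m)%N ->
  a n * a m * m2 n m <= H ^+ 2 * (a n ^+ 2 * a m ^+ 2) + T n m.
Proof.
move=> nm; rewrite /T nm.
have aa0 : 0 <= a n * a m by rewrite mulr_ge0.
have [far_m|near_m] := leqP (n + K.+1) m; last first.
  have -> : near n (m - n) = a n ^+ 2 by rewrite /near ifT//; lia.
  apply: (@le_trans _ _ (a n * a m)).
    by rewrite ler_piMr.
  rewrite addr0 -[a n * a m]add0r lerD//.
    by apply: mulr_ge0; [exact: sqr_ge0 | apply: mulr_ge0; exact: sqr_ge0].
  by rewrite expr2 ler_wpM2l// a_mono.
have mE : m = (n + K.+1 + (m - (n + K.+1)))%N by rewrite subnKC.
set j := (m - (n + K.+1))%N in mE *.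
have jm : a m <= a j by apply: a_mono; lia.
have -> : m2 n m = m2 n (n + K.+1 + j) by rewrite -mE.
have := m2_close n j; rewrite ler_norml => /andP[_]; rewrite lerBlDr => h.
apply: (le_trans (ler_wpM2l aa0 h)); rewrite /far -mE.
have e1 : a n * a m * (a j * d n) <= d n * a j ^+ 2.
  have -> : a n * a m * (a j * d n) = (a n * a m) * (d n * a j) by ring.
  rewrite [X in _ <= X](_ : _ = a j * (d n * a j)); last by ring.
  rewrite ler_wpM2r ?mulr_ge0// (le_trans _ jm)// ler_piMl//.
have e2 : a n * a m * (a n * d j) <= a n ^+ 2 * d j.
  have -> : a n * a m * (a n * d j) = a m * (a n ^+ 2 * d j) by ring.
  by rewrite ler_piMl// mulr_ge0// sqr_ge0.
have := ler_wpM2l B_ge0 (lerD e1 e2).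
set X := a n * a m * (a j * d n) + _; set Y := d n * _ + _ => hXY.
have -> : a n * a m * (B * (a j * d n + a n * d j) + H ^+ 2 * a n * a j) =
  B * X + H ^+ 2 * (a n ^+ 2 * a m * a j) by rewrite /X; ring.
have -> : H ^+ 2 * (a n ^+ 2 * a m ^+ 2) + (near n (m - n) +
  (H ^+ 2 * a n ^+ 2 * (a m * (a j - a m)) + B * Y)) =
  near n (m - n) + (B * Y + H ^+ 2 * (a n ^+ 2 * a m * a j)) by ring.
by rewrite -[X in X <= _]add0r lerD// lerD2r.
Qed.

Let pair_le n m :
  a n * a m * m2 n m <= H ^+ 2 * (a n ^+ 2 * a m ^+ 2) + (T n m + T m n).
Proof.
have [nm|/ltnW mn] := leqP n m.
  by apply: (le_trans (pair_le_ordered nm)); rewrite lerD2l lerDl.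
have := pair_le_ordered mn; rewrite m2_sym [a m * _]mulrC [a m ^+ 2 * _]mulrC => h.
by apply: (le_trans h); rewrite lerD2l lerDr.
Qed.

Let T_sum n N : \sum_(m < N) T n m <=
  K.+1%:R * a n ^+ 2 + (H ^+ 2 * a n ^+ 2 * C2 + B * (d n * W N + a n ^+ 2 * C1)).
Proof.
rewrite big_split /= -!big_mkcond /=; apply: lerD.
  apply: (le_trans (sum_shift_le n N (near_ge0 n))).
  have h M : \sum_(j < M) near n j <= (minn M K.+1)%:R * a n ^+ 2.
    elim: M => [|M IH]; first by rewrite big_ord0 min0n mul0r.
    rewrite big_ord_recr /= /near; case: ifP => MK.
      have -> : minn M.+1 K.+1 = (minn M K.+1).+1 by lia.
      by rewrite -natr1 mulrDl mul1r lerD.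
    rewrite addr0 (le_trans IH)// ler_wpM2r ?sqr_ge0// ler_nat; lia.
  apply: (le_trans (h N)); rewrite ler_wpM2r ?sqr_ge0// ler_nat; exact: geq_minr.
apply: (le_trans (sum_shift_le (n + K.+1) N (far_ge0 n))).
rewrite big_split /= -!mulr_sumr big_split /= -!mulr_sumr.
apply: lerD.
  by apply: ler_wpM2l; [apply: mulr_ge0; exact: sqr_ge0 | exact: cov].
apply: ler_wpM2l => //; apply: lerD; first exact: lexx.
by apply: ler_wpM2l; [exact: sqr_ge0 | exact: d_sum].
Qed.

(** The left side is an expanded mean square. The terms of order W N ^ 2 cancel, and the errors are
    linear in [W N] because the sums of [d] and the sums in [cov] are bounded. *)
Lemma second_moment_le N :
  \sum_(n < N) \sum_(m < N) a n * a m * m2 n m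
    - 2 * (H * W N) * \sum_(n < N) a n * m1 n + (H * W N) ^+ 2 <=
  (2 * (K.+1%:R + H ^+ 2 * C2 + B * C1 + B * C1) + 2 * (`|H| * (B * C1))) * W N.
Proof.
have W0 : 0 <= W N by apply: sumr_ge0 => n _; exact: sqr_ge0.
have dW : \sum_(n < N) d n * W N <= C1 * W N by rewrite -mulr_suml ler_wpM2r.
have Tle : \sum_(n < N) \sum_(m < N) T n m <=
    (K.+1%:R + H ^+ 2 * C2 + B * C1 + B * C1) * W N.
  apply: le_trans; first by apply: ler_sum => n _; exact: T_sum.
  rewrite !big_split /= -!mulr_sumr -mulr_suml big_split /= -!mulr_sumr -!mulr_suml.
  rewrite -/(W N).
  have dW' := ler_wpM2l B_ge0 dW; rewrite -mulr_suml in dW'.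
  rewrite mulrDr; move: dW'; set x := B * (_ * W N); set y := B * (W N * C1) => dW'.
  have -> : y = B * C1 * W N by rewrite /y; ring.
  have e1 : H ^+ 2 * W N * C2 = H ^+ 2 * C2 * W N by ring.
  rewrite e1 !mulrDl; lra.
have q1 : \sum_(n < N) \sum_(m < N) a n * a m * m2 n m <=
    (H * W N) ^+ 2 + 2 * \sum_(n < N) \sum_(m < N) T n m.
  apply: (@le_trans _ _ (\sum_(n < N) \sum_(m < N)
      (H ^+ 2 * (a n ^+ 2 * a m ^+ 2) + (T n m + T m n)))).
    by apply: ler_sum => n _; apply: ler_sum => m _; exact: pair_le.
  under eq_bigr do rewrite big_split /= big_split /=.
  rewrite !big_split /= [X in _ + (_ + X)]exchange_big /= -mulr2n -[X in _ + X]mulr_natl.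
  rewrite lerD2r le_eqVlt; apply/orP; left; apply/eqP.
  rewrite exprMn [W N ^+ 2]expr2 mulr_suml mulr_sumr; apply: eq_bigr => n _.
  by rewrite /W -!mulr_sumr.
have q2 : `|\sum_(n < N) a n * m1 n - H * W N| <= B * C1.
  rewrite /W mulr_sumr -sumrB (le_trans (ler_norm_sum _ _ _))//.
  apply: (@le_trans _ _ (\sum_(n < N) B * d n)); last by rewrite -mulr_sumr ler_wpM2l.
  apply: ler_sum => n _.
  have -> : a n * m1 n - H * a n ^+ 2 = a n * (m1 n - H * a n) by ring.
  by rewrite normrM ger0_norm// (le_trans _ (m1_close n))// ler_piMl.
have q3 : - (H * W N) * (\sum_(n < N) a n * m1 n - H * W N) <= `|H| * (B * C1) * W N.
  apply: (le_trans (ler_norm _)); rewrite normrM normrN normrM (ger0_norm W0).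
  rewrite -[X in _ <= X]mulrA [B * C1 * _]mulrC -mulrA ler_wpM2l// ler_wpM2l//.
move: q1 q3 Tle; set X := \sum_(n < N) \sum_(m < N) a n * a m * _.
set Y := \sum_(n < N) a n * m1 n; set Z := \sum_(n < N) \sum_(m < N) T n m.
move=> q1 q3 q4.
have -> : X - 2 * (H * W N) * Y + (H * W N) ^+ 2 =
  X - (H * W N) ^+ 2 + 2 * (- (H * W N) * (Y - H * W N)) by ring.
rewrite [X in _ <= X]mulrDl -[2 * _ * W N]mulrA -[2 * (`|H| * _) * W N]mulrA; lra.
Qed.

End SecondMoment.

(** * Path weights through a finite set *)

Section Words.
Variables (R : realType) (I : Type) (rk : nat -> int -> R) (f : I -> int -> R) (Ds : seq int).

(* Weight of the paths that start at [x] and run through the word: the pair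
   [(k, i)] contributes a jump of kernel [rk k] to a point weighted by [f i]. *)
Fixpoint word_sum (u : seq (nat * I)) (g : int -> R) (x : int) : R :=
  if u is (k, i) :: u' then
    \sum_(y <- Ds) rk k (x - y) * (f i y * word_sum u' g y)
  else g x.

(** The sum without its first kernel: a long first jump reaches all points of [Ds] with nearly the
    same probability, which factors out. *)
Definition word_total i u g : R := \sum_(y <- Ds) f i y * word_sum u g y.

Lemma word_sum_cat u1 u2 g x : word_sum (u1 ++ u2) g x = word_sum u1 (word_sum u2 g) x.
Proof.
elim: u1 x => [//|[k i] u1 IH] x /=.
by apply: eq_bigr => y _; rewrite IH.
Qed.

Lemma word_sum_lin a b u g g' x :
  word_sum u (fun z => a * g z + b * g' z) x = a * word_sum u g x + b * word_sum u g' x.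
Proof.
elim: u x => [//|[k i] u IH] x /=; rewrite !mulr_sumr -big_split /=.
by apply: eq_bigr => y _; rewrite IH; ring.
Qed.

Lemma eq_word_sum u g g' x : (0 < size u)%N -> {in Ds, g =1 g'} -> word_sum u g x = word_sum u g' x.
Proof.
move=> + gg'; elim: u x => [//|[k i] u IH] x _ /=.
apply: eq_big_seq => y yD; congr (_ * (_ * _)).
by case: u IH => [|ki u] IH; [exact: gg' | exact: IH].
Qed.

Lemma word_total_lin a b i u g g' :
  word_total i u (fun z => a * g z + b * g' z) = a * word_total i u g + b * word_total i u g'.
Proof.
rewrite /word_total !mulr_sumr -big_split /=.
by apply: eq_bigr => y _; rewrite word_sum_lin; ring.
Qed.

Lemma eq_word_total i u g g' : {in Ds, g =1 g'} -> word_total i u g = word_total i u g'.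
Proof.
move=> gg'; apply: eq_big_seq => y yD; case: u => [|ki u]; first by rewrite /= gg'.
by rewrite (@eq_word_sum _ g g').
Qed.

Lemma word_total_rcons i u k j g :
  word_total i (rcons u (k, j)) g =
  word_total i u (fun x => \sum_(y <- Ds) rk k (x - y) * (f j y * g y)).
Proof. by rewrite -cats1; apply: eq_bigr => y _; rewrite word_sum_cat. Qed.

Variables vk dk : nat -> R.
Hypothesis f_le1 : forall i z, `|f i z| <= 1.
Hypothesis rk_ge0 : forall k z, 0 <= rk k z.
Hypothesis rk_le : forall k z, rk k z <= vk k.
Hypothesis vk_le1 : forall k, vk k <= 1.
Hypothesis rk_gap : forall k z, vk k - rk k z <= z%:~R ^+ 2 * dk k.
Hypothesis dk_ge0 : forall k, 0 <= dk k.

Local Notation sz := ((size Ds)%:R : R).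

Let vk_ge0 k : 0 <= vk k.
Proof. exact: le_trans (rk_ge0 k 0) (rk_le k 0). Qed.

Lemma sum_const_le (F : int -> R) c : {in Ds, forall y, F y <= c} ->
  \sum_(y <- Ds) F y <= sz * c.
Proof.
move=> h; rewrite big_seq; apply: (@le_trans _ _ (\sum_(y <- Ds | y \in Ds) c)).
  exact: ler_sum.
by rewrite -big_seq big_const_seq count_predT iter_addr_0 mulr_natl.
Qed.

Lemma word_sum_le u g G : 0 <= G -> {in Ds, forall y, `|g y| <= G} ->
  {in Ds, forall x, `|word_sum u g x| <= sz ^+ size u * G}.
Proof.
move=> G0 hg; elim: u => [|[k i] u IH] x xD /=; first by rewrite expr0 mul1r hg.
rewrite (le_trans (ler_norm_sum _ _ _))// exprS -mulrA sum_const_le// => y yD.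
rewrite !normrM (ger0_norm (rk_ge0 _ _)) mulrA -[X in _ <= X]mul1r.
by rewrite ler_pM ?mulr_ge0 ?IH// mulr_ile1// (le_trans (rk_le _ _)).
Qed.

Lemma word_sum_cons_le n i u g G x : 0 <= G -> {in Ds, forall y, `|g y| <= G} ->
  `|word_sum ((n, i) :: u) g x| <= vk n * (sz ^+ (size u).+1 * G).
Proof.
move=> G0 hg /=; rewrite (le_trans (ler_norm_sum _ _ _))//.
have -> : vk n * (sz ^+ (size u).+1 * G) = sz * (vk n * (sz ^+ size u * G)).
  by rewrite exprS; ring.
apply: sum_const_le => y yD; rewrite !normrM (ger0_norm (rk_ge0 _ _)).
rewrite ler_pM// -[X in _ <= X]mul1r ler_pM//; exact: (word_sum_le u G0 hg).
Qed.

Lemma word_total_le i u g G : 0 <= G -> {in Ds, forall y, `|g y| <= G} ->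
  `|word_total i u g| <= sz ^+ (size u).+1 * G.
Proof.
move=> G0 hg; rewrite (le_trans (ler_norm_sum _ _ _))// exprS -mulrA.
apply: sum_const_le => y yD; rewrite normrM -[X in _ <= X]mul1r ler_pM//.
exact: (word_sum_le u G0 hg).
Qed.

(** One bound for all squared distances within [Ds] and from the starting point 0. *)
Definition spread : R := \sum_(x <- 0 :: Ds) \sum_(y <- Ds) (x - y)%:~R ^+ 2.

Lemma le_spread x y : x \in 0 :: Ds -> y \in Ds -> (x - y)%:~R ^+ 2 <= spread.
Proof.
move=> xD yD; rewrite /spread (big_rem x xD) /= (big_rem y yD) /= -addrA lerDl.
rewrite addr_ge0 ?sumr_ge0// => [z _|z _]; first exact: sqr_ge0.
by apply: sumr_ge0 => t _; exact: sqr_ge0.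
Qed.

Lemma spread_ge0 : 0 <= spread.
Proof. by apply: sumr_ge0 => x _; apply: sumr_ge0 => y _; exact: sqr_ge0. Qed.

Lemma word_sum_cons_close n i u g G x : 0 <= G -> {in Ds, forall y, `|g y| <= G} ->
  x \in 0 :: Ds ->
  `|word_sum ((n, i) :: u) g x - vk n * word_total i u g|
     <= spread * (sz ^+ (size u).+1 * G) * dk n.
Proof.
move=> G0 hg xD /=; rewrite /word_total mulr_sumr -sumrB.
rewrite (le_trans (ler_norm_sum _ _ _))//.
have -> : spread * (sz ^+ (size u).+1 * G) * dk n =
   sz * (spread * dk n * (sz ^+ size u * G)) by rewrite exprS; ring.
apply: sum_const_le => y yD; rewrite -mulrBl !normrM; apply: ler_pM => //.
  rewrite distrC ger0_norm ?subr_ge0// (le_trans (rk_gap _ _))//.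
  by rewrite ler_wpM2r// le_spread.
rewrite -[X in _ <= X]mul1r ler_pM//; exact: (word_sum_le u G0 hg).
Qed.

(** The first word ends at a point of [Ds], from which the second word has sum H * vk j up to an
    error of order dk j. The constant part comes out by linearity; the error gains the factor vk n
    of the first jump. *)
Lemma word_moments_close i u : exists2 B, 0 <= B &
  let H := word_total i u (fun=> 1) in
  (forall n, `|word_sum ((n, i) :: u) (fun=> 1) 0 - H * vk n| <= B * dk n) /\
  (forall n j, `|word_sum (((n, i) :: u) ++ (j, i) :: u) (fun=> 1) 0 - H ^+ 2 * vk n * vk j|
     <= B * (vk j * dk n + vk n * dk j)).
Proof.
set H := word_total i u (fun=> 1).
have one_le : {in Ds, forall y : int, `|(fun=> 1 : R) y| <= 1} by move=> y _; rewrite normr1.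
pose q := sz ^+ (size u).+1; have q0 : 0 <= q by rewrite exprn_ge0.
have Hq : `|H| <= q by have := word_total_le i u ler01 one_le; rewrite mulr1.
have S0 := spread_ge0.
have close x n : x \in 0 :: Ds ->
    `|word_sum ((n, i) :: u) (fun=> 1) x - H * vk n| <= spread * q * dk n.
  by move=> xD; have := word_sum_cons_close n i u ler01 one_le xD; rewrite mulr1 mulrC.
exists (spread * q + q * (spread * q)).
  by rewrite addr_ge0 ?mulr_ge0.
split=> [n|n j].
  apply: (le_trans (close 0 n (mem_head _ _))).
  by rewrite ler_wpM2r// lerDl !mulr_ge0.
rewrite word_sum_cat.
pose err y := word_sum ((j, i) :: u) (fun=> 1) y - H * vk j.
have errE : {in Ds, word_sum ((j, i) :: u) (fun=> 1) =1
    fun y => (H * vk j) * 1 + 1 * err y}.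
  by move=> y _; rewrite /err; ring.
rewrite (eq_word_sum _ _ errE)// (word_sum_lin (H * vk j) 1 _ (fun=> 1)).
have he : {in Ds, forall y, `|err y| <= spread * q * dk j}.
  by move=> y yD; apply: close; rewrite in_cons yD orbT.
have G0 : 0 <= spread * q * dk j by rewrite !mulr_ge0.
have h1 := word_sum_cons_le n i u 0 G0 he; rewrite -/q in h1.
have h2 := close 0 n (mem_head _ _).
set m1 := word_sum ((n, i) :: u) (fun=> 1) 0 in h2 *.
set m2 := word_sum ((n, i) :: u) err 0 in h1 *.
have -> : H * vk j * m1 + 1 * m2 - H ^+ 2 * vk n * vk j = H * vk j * (m1 - H * vk n) + m2.
  by ring.
apply: (le_trans (ler_normD _ _)).
have h3 : `|H * vk j * (m1 - H * vk n)| <= q * vk j * (spread * q * dk n).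
  rewrite normrM ler_pM// normrM (ger0_norm (vk_ge0 j)) ler_wpM2r//.
apply: (le_trans (lerD h3 h1)).
have -> : q * vk j * (spread * q * dk n) + vk n * (q * (spread * q * dk j)) =
  q * (spread * q) * (vk j * dk n + vk n * dk j) by ring.
rewrite ler_wpM2r ?lerDr ?mulr_ge0//.
by rewrite addr_ge0 ?mulr_ge0.
Qed.

End Words.

(** * Recovering a coloured finite set from its word totals *)

Section ColourOperators.
Variables (R : realType) (I : Type) (Ds : seq int).
Implicit Types (f : I -> int -> R) (phi psi : int -> R) (c : I -> R).

(** For a scenery, [I] consists of the rationals, and the colour of a site lists the values of eta -
    alpha on all rational rays. *)
Definition colour f (x : int) : I -> R := fun i => f i x.

Definition colour_ind f c (x : int) : R := (`[< colour f x = c >])%:R.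

Definition adj (d : nat) psi (x : int) : R :=
  \sum_(y <- Ds) (`|x - y|%N == d)%:R * psi y.

Definition colour_step f d c phi : int -> R := adj d (fun y => colour_ind f c y * phi y).

Lemma eq_adj d phi psi x : {in Ds, phi =1 psi} -> adj d phi x = adj d psi x.
Proof. by move=> h; apply: eq_big_seq => y yD; rewrite h. Qed.

Lemma adj0 psi x : uniq Ds -> x \in Ds -> adj 0 psi x = psi x.
Proof.
move=> uD xD; rewrite /adj (bigD1_seq x)//= subrr eqxx mul1r big1 ?addr0// => y yx.
by rewrite (_ : (_ == _) = false) ?mul0r//; apply/negbTE; move: yx; apply: contra; lia.
Qed.

Lemma sum_gt0_ex (F : int -> R) : 0 < \sum_(y <- Ds) F y -> exists2 y, y \in Ds & 0 < F y.
Proof.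
move=> h; apply: contrapT => /forall2NP hn; move: h; rewrite ltNge big_seq sumr_le0// => y yD.
by rewrite leNgt; apply/negP => Fy; case: (hn y).
Qed.

Lemma sum_gt0 (F : int -> R) y : (forall z, 0 <= F z) -> y \in Ds -> 0 < F y ->
  0 < \sum_(z <- Ds) F z.
Proof. by move=> F0 yD Fy; rewrite (big_rem y)//= ltr_pwDl// sumr_ge0. Qed.

Lemma colour_ind_ge0 f c x : 0 <= colour_ind f c x.
Proof. exact: ler0n. Qed.

Lemma colour_ind_eq f c x : colour f x = c -> colour_ind f c x = 1.
Proof. by move=> h; rewrite /colour_ind asboolT. Qed.

Lemma colour_step_ge0 f d c phi : (forall z, 0 <= phi z) ->
  forall z, 0 <= colour_step f d c phi z.
Proof.
by move=> h z; apply: sumr_ge0 => y _; rewrite mulr_ge0// mulr_ge0// colour_ind_ge0.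
Qed.

Lemma colour_step_gt0 f d c phi x y : (forall z, 0 <= phi z) -> y \in Ds ->
  `|x - y|%N = d -> colour f y = c -> 0 < phi y -> 0 < colour_step f d c phi x.
Proof.
move=> p0 yD xy cy py; apply: (sum_gt0 _ yD) => [z|].
  by rewrite mulr_ge0// mulr_ge0// colour_ind_ge0.
by rewrite xy eqxx colour_ind_eq// !mul1r.
Qed.

Lemma colour_step_ex f d c phi x : 0 < colour_step f d c phi x ->
  exists y, [/\ y \in Ds, `|x - y|%N = d, colour f y = c & 0 < phi y].
Proof.
move=> /sum_gt0_ex[y yD]; case: eqP => xy; last by rewrite mul0r ltxx.
rewrite /colour_ind; case: asboolP => cy; last by rewrite mul0r mulr0 ltxx.
by rewrite !mul1r => py; exists y.
Qed.

(* Interpolation: a product of shifted coordinates vanishing at every colour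
   other than [c] but not at [c]. *)
Lemma colour_separator f c (s : seq int) : exists2 L : seq (I * R),
  \prod_(p <- L) (c p.1 - p.2) != 0 &
  {in s, forall x, colour f x <> c -> \prod_(p <- L) (f p.1 x - p.2) = 0}.
Proof.
elim: s => [|x s [L L0 hL]]; first by exists [::] => //; rewrite big_nil oner_eq0.
have [cx|cx] := pselect (colour f x = c).
  by exists L => // y; rewrite inE => /orP[/eqP -> //|]; exact: hL.
have [i hi] : exists i, f i x <> c i.
  by apply: contrapT => /forallNP h; apply: cx; apply/funext => i; apply: contrapT; exact: h.
exists ((i, f i x) :: L); first by rewrite big_cons mulf_neq0//= subr_eq0 eq_sym; apply/eqP.
move=> y; rewrite inE big_cons => /orP[/eqP -> _|ys cy] /=.
  by rewrite subrr mul0r.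
by rewrite hL// mulr0.
Qed.

End ColourOperators.

(** * Transferring tests between functions with equal totals *)

Section Matching.
Variables (R : realType) (I : Type) (rk : nat -> int -> R) (Ds : seq int).
Hypothesis Ds_uniq : uniq Ds.
Hypothesis rk_even : forall k z, rk k (- z) = rk k z.
Hypothesis rk_indep : forall M (beta : nat -> R),
  (forall k, \sum_(d < M) beta d * rk k d%:Z = 0) -> forall d, (d < M)%N -> beta d = 0.
Implicit Types (f : I -> int -> R) (phi : int -> R).

Local Notation wt f := (word_total rk f Ds).

(** Two end weights that no word tells apart. From the constant 1 on, the relation survives
    multiplication by the values, jumps of a fixed distance and, for non-zero colours, restriction
    to a colour, so such tests have the same outcome on both sides. *)
Definition matched f f' phi phi' : Prop := forall i u, wt f i u phi = wt f' i u phi'.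

Lemma matched_sym f f' phi phi' : matched f f' phi phi' -> matched f' f phi' phi.
Proof. by move=> h i u. Qed.

Lemma matched_lin f f' a b phi phi' psi psi' :
  matched f f' phi phi' -> matched f f' psi psi' ->
  matched f f' (fun z => a * phi z + b * psi z) (fun z => a * phi' z + b * psi' z).
Proof. by move=> h1 h2 i u; rewrite !word_total_lin h1 h2. Qed.

Lemma eq_matched f f' phi phi' psi psi' :
  {in Ds, phi =1 psi} -> {in Ds, phi' =1 psi'} ->
  matched f f' phi phi' -> matched f f' psi psi'.
Proof.
move=> h h' m i u; rewrite -(eq_word_total _ _ _ _ h) -(eq_word_total _ _ _ _ h').
exact: m.
Qed.

Lemma word_total_sum f i u M (b : nat -> R) (g : nat -> int -> R) :
  wt f i u (fun z => \sum_(d < M) b d * g d z) = \sum_(d < M) b d * wt f i u (g d).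
Proof.
elim: M => [|M IH].
  have h := word_total_lin rk f Ds 0 0 i u (fun=> 0) (fun=> 0).
  rewrite big_ord0; transitivity (0 * wt f i u (fun=> 0) + 0 * wt f i u (fun=> 0)).
    by rewrite -h; apply: eq_word_total => z _; rewrite big_ord0 /= mulr0 addr0.
  by rewrite !mul0r addr0.
rewrite big_ord_recr /= -IH -[X in X + _]mul1r -word_total_lin.
by apply: eq_word_total => z _; rewrite big_ord_recr /= mul1r.
Qed.

(** Appending a letter gives one relation for each time k, in which the kernel depends only on the
    distance of two points; independence in k separates the distances. *)
Lemma matched_adj f f' phi phi' j d : matched f f' phi phi' ->
  matched f f' (adj Ds d (fun y => f j y * phi y)) (adj Ds d (fun y => f' j y * phi' y)).
Proof.
move=> m i u.
pose M := ((\sum_(x <- Ds) \sum_(y <- Ds) `|x - y|)%N + d).+1.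
have hM x y : x \in Ds -> y \in Ds -> (`|x - y|%N < M)%N.
  move=> xD yD; rewrite ltnS (big_rem x)//= (big_rem y)//= -!addnA leq_addr//.
pose psi := fun y => f j y * phi y; pose psi' := fun y => f' j y * phi' y.
suff : wt f i u (adj Ds d psi) - wt f' i u (adj Ds d psi') = 0.
  by move/eqP; rewrite subr_eq0 => /eqP.
have dM : (d < M)%N by rewrite ltnS leq_addl.
apply: (@rk_indep M (fun d => wt f i u (adj Ds d psi) - wt f' i u (adj Ds d psi')) _ d dM).
move=> k.
have conv g : {in Ds, (fun x => \sum_(e < M) rk k e%:Z * adj Ds e g x) =1
    fun x => \sum_(y <- Ds) rk k (x - y) * g y}.
  move=> x xD; rewrite /adj; under eq_bigr do rewrite mulr_sumr.
  rewrite exchange_big; apply: eq_big_seq => y yD.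
  rewrite (bigD1 (Ordinal (hM x y xD yD)))//= eqxx mul1r big1 ?addr0 => [|e ne].
    by case: (x - y) => n //=; rewrite NegzE rk_even.
  rewrite (_ : (_ == _) = false) ?mul0r ?mulr0//; apply/negbTE; move: ne.
  by apply: contra => /eqP h; apply/eqP/val_inj; rewrite /= h.
have E1 := m i (rcons u (k, j)); rewrite !word_total_rcons in E1.
rewrite -(eq_word_total _ _ _ _ (conv psi)) -(eq_word_total _ _ _ _ (conv psi')) in E1.
rewrite (word_total_sum f i u M (fun d => rk k d%:Z) (fun e => adj Ds e psi)) in E1.
rewrite (word_total_sum f' i u M (fun d => rk k d%:Z) (fun e => adj Ds e psi')) in E1.
apply/eqP; under eq_bigr do rewrite mulrBl; rewrite sumrB subr_eq0; apply/eqP.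
under eq_bigr do rewrite mulrC; rewrite E1.
by apply: eq_bigr => e _; rewrite mulrC.
Qed.

Lemma matched_mul f f' phi phi' j : matched f f' phi phi' ->
  matched f f' (fun y => f j y * phi y) (fun y => f' j y * phi' y).
Proof. by move=> /(@matched_adj _ _ _ _ j 0); apply: eq_matched => x xD; rewrite adj0. Qed.

Lemma matched_prod f f' phi phi' (L : seq (I * R)) : matched f f' phi phi' ->
  matched f f' (fun y => \prod_(p <- L) (f p.1 y - p.2) * phi y)
               (fun y => \prod_(p <- L) (f' p.1 y - p.2) * phi' y).
Proof.
move=> m; elim: L => [|[j t] L IH].
  by move: m; apply: eq_matched => x _; rewrite big_nil mul1r.
have := matched_lin 1 (- t) (matched_mul j IH) IH.
by apply: eq_matched => x _; rewrite big_cons /=; ring.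
Qed.

(** The product of the separators of both functions vanishes at every other colour present; dividing
    by its value at [c] gives the indicator. Words weight each of their points by a value, so one
    factor [f j0] is left for the next letter to supply, which asks for a non-zero [c j0]. *)
Lemma matched_colour_aux f f' phi phi' c j0 : c j0 != 0 -> matched f f' phi phi' ->
  exists psi psi', [/\ matched f f' psi psi',
    {in Ds, forall x, f j0 x * psi x = colour_ind f c x * phi x} &
    {in Ds, forall x, f' j0 x * psi' x = colour_ind f' c x * phi' x}].
Proof.
move=> cj m.
have [L1 n1 h1] := colour_separator f c Ds; have [L2 n2 h2] := colour_separator f' c Ds.
pose L := L1 ++ L2.
pose kappa := (c j0 * \prod_(p <- L) (c p.1 - p.2))^-1.
have nL : c j0 * \prod_(p <- L) (c p.1 - p.2) != 0 by rewrite big_cat !mulf_neq0.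
have key (ff : I -> int -> R) g x :
    (colour ff x <> c -> \prod_(p <- L) (ff p.1 x - p.2) = 0) ->
    ff j0 x * (kappa * (\prod_(p <- L) (ff p.1 x - p.2) * g x) +
               0 * (\prod_(p <- L) (ff p.1 x - p.2) * g x)) = colour_ind ff c x * g x.
  move=> h; rewrite /colour_ind; case: asboolP => [cx|/h ->];
    last by rewrite !mul0r !mulr0 addr0 mulr0.
  rewrite mul0r addr0 mul1r.
  have -> : \prod_(p <- L) (ff p.1 x - p.2) = \prod_(p <- L) (c p.1 - p.2).
    by apply: eq_bigr => p _; rewrite -cx.
  have -> : ff j0 x = c j0 by rewrite -cx.
  rewrite mulrCA mulrA mulrA -[kappa * _ * _]mulrA [kappa * _]mulrC divff ?mul1r//.
exists (fun x => kappa * (\prod_(p <- L) (f p.1 x - p.2) * phi x) +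
                 0 * (\prod_(p <- L) (f p.1 x - p.2) * phi x)).
exists (fun x => kappa * (\prod_(p <- L) (f' p.1 x - p.2) * phi' x) +
                 0 * (\prod_(p <- L) (f' p.1 x - p.2) * phi' x)).
split.
- by apply: matched_lin; exact: matched_prod.
- by move=> x xD; apply: key => cx; rewrite big_cat /= h1// mul0r.
- by move=> x xD; apply: key => cx; rewrite big_cat /= h2// mulr0.
Qed.

Lemma matched_colour_step f f' phi phi' c j0 d : c j0 != 0 -> matched f f' phi phi' ->
  matched f f' (colour_step Ds f d c phi) (colour_step Ds f' d c phi').
Proof.
move=> cj /(matched_colour_aux cj)[psi [psi' [m e e']]].
by have := @matched_adj _ _ _ _ j0 d m; apply: eq_matched => x _; exact: eq_adj.
Qed.

Lemma matched_colour_total f f' phi phi' c j0 : c j0 != 0 -> matched f f' phi phi' ->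
  \sum_(x <- Ds) colour_ind f c x * phi x = \sum_(x <- Ds) colour_ind f' c x * phi' x.
Proof.
move=> cj /(matched_colour_aux cj)[psi [psi' [m e e']]].
have := m j0 [::]; rewrite /word_total /= => h.
transitivity (\sum_(y <- Ds) f j0 y * psi y).
  by apply: eq_big_seq => x xD; rewrite e.
by rewrite h; apply: eq_big_seq => x xD; rewrite e'.
Qed.

Definition charged f (x : int) : Prop := exists i, f i x != 0.

Lemma charged_in f x : (forall i z, z \notin Ds -> f i z = 0) -> charged f x -> x \in Ds.
Proof. by move=> fs [i]; apply: contraNT => xD; rewrite fs. Qed.

Lemma colour_charged f g x y : colour f x = colour g y -> charged g y -> charged f x.
Proof. by move=> h [i gi]; exists i; rewrite -[f i x]/(colour f x i) h. Qed.

Lemma seq_minmax (s : seq int) : s != [::] -> exists lo hi,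
  [/\ lo \in s, hi \in s & {in s, forall x, lo <= x <= hi}].
Proof.
elim: s => // a s IH _; have [->|sn] := eqVneq s [::].
  by exists a, a; split; rewrite ?mem_head// => x; rewrite inE => /eqP ->; rewrite lexx.
have [lo [hi [los his h]]] := IH sn.
exists (Num.min a lo), (Num.max a hi); split.
- by rewrite inE minEle; case: ifP => _; rewrite ?eqxx ?los ?orbT.
- by rewrite inE maxEle; case: ifP => _; rewrite ?eqxx ?his ?orbT.
- move=> x; rewrite inE ge_min le_max => /orP[/eqP ->|/h /andP[-> ->]]; first by rewrite !lexx.
  by rewrite !orbT.
Qed.

Section Pair.
Variables f f' : I -> int -> R.
Hypothesis f_supp : forall i z, z \notin Ds -> f i z = 0.
Hypothesis same_totals : matched f f' (fun=> 1) (fun=> 1).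

(** The test prescribing both colours and the distance has a positive total for [f], hence for [f'];
    its terms are non-negative, so some pair realises it. *)
Lemma charged_distance x y : charged f x -> charged f y ->
  exists x' y', [/\ charged f' x', charged f' y' & `|x' - y'|%N = `|x - y|%N].
Proof.
move=> cx cy; have [i ci] := cx; have [j cj] := cy.
have m := matched_colour_step (c := colour f y) (j0 := j) `|x - y|%N cj same_totals.
have := matched_colour_total (c := colour f x) (j0 := i) ci m.
set lhs := \sum_(z <- Ds) _; set rhs := \sum_(z <- Ds) _ => E.
have xD := charged_in f_supp cx; have yD := charged_in f_supp cy.
have : 0 < lhs.
  apply: (sum_gt0 (y := x)) => // [z|].
    by rewrite mulr_ge0 ?colour_ind_ge0// colour_step_ge0.
  by rewrite colour_ind_eq// mul1r (colour_step_gt0 (y := y)).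
rewrite E => /sum_gt0_ex[x' x'D].
rewrite /colour_ind; case: asboolP => cx'; last by rewrite mul0r ltxx.
rewrite mul1r => /colour_step_ex[y' [y'D d cy' _]].
by exists x', y'; split=> //; [exact: colour_charged cx' cx | exact: colour_charged cy' cy].
Qed.

End Pair.

(** * Reading the charged points from an end point *)

Section Congruent.
Variables f f' : I -> int -> R.
Hypothesis f_supp : forall i z, z \notin Ds -> f i z = 0.
Hypothesis same_totals : matched f f' (fun=> 1) (fun=> 1).

Variables (x1 xm : int).
Hypothesis x1c : charged f x1.
Hypothesis xmc : charged f xm.
Hypothesis f_between : forall x, charged f x -> x1 <= x <= xm.
Variables (lo hi : int).
Hypothesis f'_between : forall x, charged f' x -> lo <= x <= hi.
Hypothesis same_diam : hi - lo = xm - x1.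

Let Delta := `|xm - x1|%N.
Let c1 := colour f x1.
Let cm := colour f xm.

(** The invariant: among charged points, [phi'] is positive only at ends of the charged set of [f'],
    from which every distance in [L] shows the same colour as from [x1]. The two cases are the two
    orientations. Non-negativity allows a positive sum to be traced back to a path. *)
Let oriented (L : seq nat) phi phi' := [/\ matched f f' phi phi',
  forall z, 0 <= phi z, forall z, 0 <= phi' z, 0 < phi x1 &
  forall z, charged f' z -> 0 < phi' z ->
    (z = lo /\ forall d : nat, d \in L -> colour f' (lo + d%:Z) = colour f (x1 + d%:Z)) \/
    (z = hi /\ forall d : nat, d \in L -> colour f' (hi - d%:Z) = colour f (x1 + d%:Z))].

Let x1m : x1 <= xm. Proof. by have := f_between x1c => /andP[]. Qed.

Let c1_charged z : colour f' z = c1 -> charged f' z.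
Proof. by move=> h; exact: colour_charged h x1c. Qed.

Let cm_charged z : colour f' z = cm -> charged f' z.
Proof. by move=> h; exact: colour_charged h xmc. Qed.

(** Only the two ends have a charged point at the distance of the diameter. *)
Let oriented_nil : exists phi phi', oriented [::] phi phi'.
Proof.
have [j cj] := xmc; have [i ci] := x1c.
pose phi := colour_step Ds f Delta cm (fun=> 1); pose phi' := colour_step Ds f' Delta cm (fun=> 1).
exists phi, phi'; split.
- exact: (matched_colour_step (j0 := j)).
- exact: colour_step_ge0.
- exact: colour_step_ge0.
- by apply: (colour_step_gt0 (y := xm)) => //; [exact: charged_in xmc | rewrite /Delta; lia].
- move=> z cz /colour_step_ex[y [yD zy cy _]].
  have := f'_between cz; have := f'_between (cm_charged cy).
  rewrite /Delta in zy => h1 h2.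
  have [e|e] : z = lo \/ z = hi by lia.
    by left.
  by right.
Qed.

(* A round trip of length [d] from an end point and back is only ambiguous when it
   turns at the midpoint; two jumps over the diameter keep the walk at end points. *)
Let oriented_cons d L phi phi' : oriented L phi phi' -> charged f (x1 + d%:Z) ->
  (d.*2 != Delta)%N -> exists psi psi', oriented (d :: L) psi psi'.
Proof.
move=> o cd dD; have [m p0 p0' px hz] := o; have [i ci] := x1c; have [j cj] := xmc.
have [k ck] := cd; set cc := colour f (x1 + d%:Z).
pose q := colour_step Ds f d cc (colour_step Ds f d c1 phi).
pose q' := colour_step Ds f' d cc (colour_step Ds f' d c1 phi').
pose psi := colour_step Ds f Delta cm (colour_step Ds f Delta c1 q).
pose psi' := colour_step Ds f' Delta cm (colour_step Ds f' Delta c1 q').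
have q0 z : 0 <= q z by do 2! apply: colour_step_ge0.
have q0' z : 0 <= q' z by do 2! apply: colour_step_ge0.
exists psi, psi'; split.
- apply: (matched_colour_step (j0 := j)) => //; apply: (matched_colour_step (j0 := i)) => //.
  apply: (matched_colour_step (j0 := k)) => //; exact: (matched_colour_step (j0 := i)).
- by do 2! apply: colour_step_ge0.
- by do 2! apply: colour_step_ge0.
- apply: (colour_step_gt0 (y := xm)) => //.
  + exact: colour_step_ge0.
  + exact: charged_in xmc.
  + by rewrite /Delta; lia.
  apply: (colour_step_gt0 (y := x1)) => //; first exact: charged_in x1c.
  apply: (colour_step_gt0 (y := x1 + d%:Z)) => //.
  + exact: colour_step_ge0.
  + exact: charged_in cd.
  + lia.
  apply: (colour_step_gt0 (y := x1)) => //; first exact: charged_in x1c.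
  lia.
- move=> z cz /colour_step_ex[y [_ zy cy /colour_step_ex[t [_ yt ct]]]].
  move=> /colour_step_ex[s [_ ts cs /colour_step_ex[r [_ sr cr pr]]]].
  have hz1 := f'_between cz; have hy := f'_between (cm_charged cy).
  have ht := f'_between (c1_charged ct); have hr := f'_between (c1_charged cr).
  have hs := f'_between (colour_charged cs cd).
  have sd := same_diam; rewrite /Delta in zy yt dD.
  (* Both z and t lie at full diameter from y, so they are the same end. *)
  have zt : z = t by lia.
  subst t.
  have [[rlo hL]|[rhi hL]] := hz r (c1_charged cr) pr.
    have zl : z = lo by lia.
    left; split=> // e; rewrite inE => /orP[/eqP ->|]; last exact: hL.
    by rewrite -/cc -cs; congr (colour f' _); lia.
  have zh : z = hi by lia.
  right; split=> // e; rewrite inE => /orP[/eqP ->|]; last exact: hL.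
  by rewrite -/cc -cs; congr (colour f' _); lia.
Qed.

Let oriented_all (L : seq nat) : {in L, forall d : nat, charged f (x1 + d%:Z)} ->
  {in L, forall d : nat, (d.*2 != Delta)%N} -> exists phi phi', oriented L phi phi'.
Proof.
elim: L => [|d L IH] h1 h2; first exact: oriented_nil.
have [||phi [phi' o]] := IH.
- by move=> e eL; apply: h1; rewrite inE eL orbT.
- by move=> e eL; apply: h2; rewrite inE eL orbT.
by apply: (oriented_cons o); [apply: h1 | apply: h2]; rewrite mem_head.
Qed.

(** The midpoint is equally far from both ends, so a round trip to it would lose the orientation. A
    single last jump without return is harmless. *)
Lemma charged_embedding : exists c : int,
  (forall x, charged f x -> forall i, f' i (x + c) = f i x) \/
  (forall x, charged f x -> forall i, f' i (- x + c) = f i x).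
Proof.
pose L := [seq d <- iota 0 Delta.+1 | `[< charged f (x1 + d%:Z) >] && (d.*2 != Delta)%N].
have [||phi [phi' [m p0 p0' px hz]]] := @oriented_all L.
- by move=> d; rewrite mem_filter => /andP[/andP[/asboolP]].
- by move=> d; rewrite mem_filter => /andP[/andP[]].
(* The midpoint, if charged, is visited last. *)
have [d0 [cd0 hd0]] : exists d0 : nat, charged f (x1 + d0%:Z) /\
    forall d : nat, charged f (x1 + d%:Z) -> d.*2 = Delta -> d = d0.
  case: (pselect (exists d : nat, charged f (x1 + d%:Z) /\ d.*2 = Delta)).
    by move=> [d [cd dD]]; exists d; split=> // e _; lia.
  (* Without a charged midpoint the distance 0 serves: the last jump stays at [x1]. *)
  move=> h; exists 0%N; split; first by rewrite addr0.
  by move=> d cd dD; case: h; exists d.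
have [i ci] := x1c; have [k ck] := cd0.
have m2 := matched_colour_step (c := c1) (j0 := i) d0 ci m.
have := matched_colour_total (c := colour f (x1 + d0%:Z)) (j0 := k) ck m2.
set lhs := \sum_(z <- Ds) _; set rhs := \sum_(z <- Ds) _ => E.
have : 0 < lhs.
  apply: (sum_gt0 (y := x1 + d0%:Z)).
  - by move=> z; rewrite mulr_ge0 ?colour_ind_ge0// colour_step_ge0.
  - exact: charged_in cd0.
  rewrite colour_ind_eq// mul1r; apply: (colour_step_gt0 (y := x1)) => //.
    exact: charged_in x1c.
  lia.
rewrite E => /sum_gt0_ex[y _].
rewrite /colour_ind; case: asboolP => cy; last by rewrite mul0r ltxx.
rewrite mul1r => /colour_step_ex[z [_ yz cz pz]].
have hy := f'_between (colour_charged cy cd0); have hzz := f'_between (c1_charged cz).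
have inL (d : nat) : charged f (x1 + d%:Z) -> d \in L \/ d = d0.
  move=> cd; have [e|ne] := eqVneq d.*2 Delta; first by right; exact: hd0.
  left; rewrite mem_filter ne andbT mem_iota /=; apply/andP; split; first exact/asboolP.
  by have := f_between cd; rewrite /Delta; lia.
have xE x : charged f x -> exists d : nat, x = x1 + d%:Z.
  by move=> /f_between h; exists `|x - x1|%N; lia.
have [[zlo hL]|[zhi hL]] := hz z (c1_charged cz) pz.
  exists (lo - x1); left => x cx j; have [d xd] := xE x cx; subst x.
  suff : colour f' (lo + d%:Z) = colour f (x1 + d%:Z).
    by move/(congr1 (@^~ j)); rewrite /colour => <-; congr (f' j _); lia.
  have [/hL //|dd] := inL d cx; rewrite dd -cy; congr (colour f' _); lia.
exists (hi + x1); right => x cx j; have [d xd] := xE x cx; subst x.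
suff : colour f' (hi - d%:Z) = colour f (x1 + d%:Z).
  by move/(congr1 (@^~ j)); rewrite /colour => <-; congr (f' j _); lia.
have [/hL //|dd] := inL d cx; rewrite dd -cy; congr (colour f' _); lia.
Qed.

End Congruent.

Lemma matched_embedding f f' :
  (forall i z, z \notin Ds -> f i z = 0) -> (forall i z, z \notin Ds -> f' i z = 0) ->
  matched f f' (fun=> 1) (fun=> 1) ->
  exists c : int,
    (forall x, charged f x -> forall i, f' i (x + c) = f i x) \/
    (forall x, charged f x -> forall i, f' i (- x + c) = f i x).
Proof.
move=> fs fs' m.
have ext (g : I -> int -> R) : (forall i z, z \notin Ds -> g i z = 0) -> (exists x, charged g x) ->
    exists lo hi, [/\ charged g lo, charged g hi & forall x, charged g x -> lo <= x <= hi].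
  move=> gs [x cx]; pose s := [seq x <- Ds | `[< charged g x >]].
  have mem_s y : charged g y -> y \in s.
    by move=> cy; rewrite mem_filter (charged_in gs cy) andbT; apply/asboolP.
  have sn : s != [::] by apply/eqP => s0; have := mem_s x cx; rewrite s0.
  have [lo [hi [los his h]]] := seq_minmax sn; exists lo, hi; split.
  - by move: los; rewrite mem_filter => /andP[/asboolP].
  - by move: his; rewrite mem_filter => /andP[/asboolP].
  - by move=> y /mem_s; exact: h.
case: (pselect (exists x, charged f x)) => [[x cx]|nf]; last first.
  by exists 0; left => x cx; case: nf; exists x.
have [x1 [xm [c1 cm fb]]] := ext f fs (ex_intro _ x cx).
have [x' [y' [cx' cy' d']]] := charged_distance fs m c1 cm.
have [lo [hi [clo chi fb']]] := ext f' fs' (ex_intro _ x' cx').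
have [x'' [y'' [cx'' cy'' d'']]] := charged_distance fs' (matched_sym m) clo chi.
apply: (charged_embedding fs m c1 cm fb fb').
(* Each diameter occurs as a distance in the other charged set, so they are equal. *)
have := fb x1 c1; have := fb' lo clo; have := fb _ cx''; have := fb _ cy''.
have := fb' _ cx'; have := fb' _ cy'; lia.
Qed.

(** Embeddings in both directions force charged sets of equal size, so the first embedding is onto
    and uncharged points correspond as well. *)
Lemma matched_congruent f f' :
  (forall i z, z \notin Ds -> f i z = 0) -> (forall i z, z \notin Ds -> f' i z = 0) ->
  matched f f' (fun=> 1) (fun=> 1) ->
  exists c : int,
    (forall z i, f' i z = f i (z + c)) \/ (forall z i, f' i z = f i (- z + c)).
Proof.
move=> fs fs' m.
pose S (g : I -> int -> R) := [seq x <- Ds | `[< charged g x >]].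
have memS (g : I -> int -> R) y : (forall i z, z \notin Ds -> g i z = 0) ->
    (y \in S g) <-> charged g y.
  move=> gs; rewrite mem_filter; split=> [/andP[/asboolP //]|cy].
  by rewrite (charged_in gs cy) andbT; apply/asboolP.
have notch (g : I -> int -> R) y i : ~ charged g y -> g i y = 0.
  by move=> n; apply/eqP; apply: contrapT => /negP gi; apply: n; exists i.
have size_le (g g' : I -> int -> R) T : (forall i z, z \notin Ds -> g i z = 0) ->
    (forall i z, z \notin Ds -> g' i z = 0) -> injective T ->
    (forall x, charged g x -> forall i, g' i (T x) = g i x) ->
    {subset [seq T x | x <- S g] <= S g'} /\ uniq [seq T x | x <- S g].
  move=> gs gs' injT h; split; last by rewrite map_inj_uniq// filter_uniq.
  move=> _ /mapP[x /(memS g x gs) cx ->]; apply/(memS g' _ gs').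
  by have [i ci] := cx; exists i; rewrite h.
have shift_inj (c : int) : injective (fun x => x + c) by move=> x y; lia.
have refl_inj (c : int) : injective (fun x => - x + c) by move=> x y; lia.
have S_le : (size (S f') <= size (S f))%N.
  have [c [h|h]] := matched_embedding fs' fs (matched_sym m).
    have [sub un] := size_le _ _ _ fs' fs (shift_inj c) h.
    by have := uniq_leq_size un sub; rewrite size_map.
  have [sub un] := size_le _ _ _ fs' fs (refl_inj c) h.
  by have := uniq_leq_size un sub; rewrite size_map.
have onto T Tinv : injective T -> cancel Tinv T ->
    (forall x, charged f x -> forall i, f' i (T x) = f i x) ->
    forall z i, f' i z = f i (Tinv z).
  move=> injT TK h z i.
  have [sub un] := size_le _ _ _ fs fs' injT h.
  have le : (size (S f') <= size [seq T x | x <- S f])%N by rewrite size_map.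
  have [_ eqS] := uniq_min_size un sub le.
  case: (pselect (charged f (Tinv z))) => [ch|nch]; first by rewrite -h// TK.
  rewrite (notch f)//; apply: notch => cz; apply: nch.
  have := (memS f' z fs').2 cz; rewrite -eqS => /mapP[x /(memS f x fs) cx zx].
  by rewrite zx (_ : Tinv (T x) = x)//; apply: injT; rewrite TK.
have [c [h|h]] := matched_embedding fs fs' m.
  exists (- c); left => z i.
  by apply: (onto (fun x => x + c) (fun z => z + - c)) => // y; rewrite subrK.
exists c; right => z i.
by apply: (onto (fun x => - x + c) (fun z => - z + c)) => // y; lia.
Qed.

End Matching.

(** * The step distribution *)

Section StepLaw.
Variables (R : realType) (q : int -> R).

Lemma sum_subset_le (F : int -> R) (s t : seq int) : (forall z, 0 <= F z) -> uniq s ->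
  {subset s <= t} -> \sum_(z <- s) F z <= \sum_(z <- t) F z.
Proof.
move=> F0; elim: s t => [|a s IH] t /=; first by rewrite big_nil sumr_ge0.
move=> /andP[as_ us] st; have at_ : a \in t by rewrite st// mem_head.
rewrite big_cons (big_rem a at_)/= lerD2l; apply: IH => // x xs.
have : x \in a :: rem a t by rewrite -(perm_mem (perm_to_rem at_)) st// inE xs orbT.
by rewrite inE => /orP[/eqP xa|//]; rewrite -xa xs in as_.
Qed.

Lemma sum_le_esum (F : int -> R) (s : seq int) : uniq s ->
  ((\sum_(z <- s) F z)%:E <= \esum_(z in [set: int]) (F z)%:E)%E.
Proof.
move=> us; apply: ereal_sup_ubound; exists [set` s]; first by split => //; exact: finite_seq.
by rewrite -fsbig_seq// sumEFin.
Qed.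

Lemma lt_esum_sum (F : int -> R) (c : R) :
  (c%:E < \esum_(z in [set: int]) (F z)%:E)%E ->
  exists2 s : seq int, uniq s & c < \sum_(z <- s) F z.
Proof.
move=> /ereal_sup_gt[_ [X [Xfin _] <-] h].
exists (finmap.enum_fset (fset_set X)); first exact: finmap.fset_uniq.
by move: h; rewrite fsbig_finite//= sumEFin lte_fin.
Qed.

(* Halved at [0], which [sym_term] counts twice. *)
Definition half_law (k : nat) : R := if k is 0 then q 0 / 2 else q k%:Z.

(** The integers from -n to n, used to compare unordered sums over [int] with series over [nat]. *)
Definition segment n : seq int := [seq Posz k | k <- iota 0 n.+1] ++ [seq Negz k | k <- iota 0 n].

Lemma segment_uniq n : uniq (segment n).
Proof.
rewrite cat_uniq !map_inj_uniq ?iota_uniq //; try by move=> x y [].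
by rewrite andbT; apply/hasPn => x /mapP[k _ ->]; apply/negP => /mapP[].
Qed.

Lemma segment_total (s : seq int) : exists n, {subset s <= segment n}.
Proof.
exists (\sum_(z <- s) `|z|)%N => z zs.
have : (`|z| <= \sum_(z <- s) `|z|)%N by rewrite (big_rem z)//= leq_addr.
move: (\sum_(z <- s) _)%N => n zn; rewrite mem_cat; case: z zn {zs} => k kn; apply/orP.
  by left; apply/mapP; exists k => //; rewrite mem_iota; lia.
by right; apply/mapP; exists k => //; rewrite mem_iota; lia.
Qed.

Lemma sum_segment (F : int -> R) n :
  \sum_(z <- segment n) F z = F 0 + \sum_(k < n) (F k.+1%:Z + F (- k.+1%:Z)).
Proof.
rewrite /segment big_cat !big_map /= big_cons -addrA big_split /=; congr (_ + _).
rewrite -[1%N]addn0 iotaDl big_map; congr (_ + _).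
  by rewrite -[n in iota _ n]subn0 big_mkord.
rewrite -[n in iota _ n]subn0 big_mkord.
by apply: eq_bigr => k _; rewrite NegzE.
Qed.

Hypothesis hq : step_assumptions q.

Let q_ge0 z : 0 <= q z. Proof. by have [h _] := hq. Qed.
Let q_even z : q (- z) = q z. Proof. by have [_ [_ [_ [_ [h _]]]]] := hq; rewrite -h. Qed.

Lemma half_law_ge0 k : 0 <= half_law k.
Proof. by case: k => [|k] /=; rewrite ?divr_ge0. Qed.

Lemma half_law_abs z : 0 < q z -> 0 < half_law `|z|%N.
Proof.
by case: z => [[|n]|n] /=; rewrite ?NegzE ?q_even// => h; rewrite divr_gt0.
Qed.

Lemma sum_segment_half n : \sum_(z <- segment n) q z = series (fun k => half_law k *+ 2) n.+1.
Proof.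
have q0 : q 0 = q 0 / 2 *+ 2 by field.
rewrite sum_segment /series /= big_mkord big_ord_recl {1}q0.
by congr (_ + _); apply: eq_bigr => k _; rewrite q_even mulr2n.
Qed.

Lemma half_law_total : series (fun k => half_law k *+ 2) @ \oo --> (1 : R).
Proof.
have [_ [tot _]] := hq.
apply/cvgrPdist_le => e e0.
have /lt_esum_sum[s us hs] : ((1 - e)%:E < \esum_(z in [set: int]) (q z)%:E)%E.
  by rewrite tot lte_fin ltrBlDr ltrDl.
have [n0 hn0] := segment_total s.
exists n0.+1 => //= -[//|n] nn.
have le1 : series (fun k => half_law k *+ 2) n.+1 <= 1.
  by rewrite -sum_segment_half -lee_fin -tot sum_le_esum// segment_uniq.
rewrite ger0_norm ?subr_ge0// lerBlDr -lerBlDl (le_trans (ltW hs))//.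
rewrite -sum_segment_half; apply: sum_subset_le => // z /hn0.
rewrite /segment !mem_cat => /orP[/mapP[k]|/mapP[k]]; rewrite mem_iota => kn ->; apply/orP.
  by left; apply/mapP; exists k => //; rewrite mem_iota; move: nn => /=; lia.
by right; apply/mapP; exists k => //; rewrite mem_iota; move: nn => /=; lia.
Qed.

Lemma half_law_moment2 : cvgn (series (fun k => half_law k * k%:R ^+ 2)).
Proof.
have [_ [_ [fin _]]] := hq.
set M := (\esum_(z in [set: int]) _)%E in fin.
have t0 k : 0 <= half_law k * k%:R ^+ 2 by rewrite mulr_ge0 ?half_law_ge0 ?sqr_ge0.
apply: nondecreasing_is_cvgn.
  apply/nondecreasing_seqP => k; rewrite /series /= big_nat_recr//= lerDl.
  exact: t0.
have M0 : (0 <= M)%E by apply: esum_ge0 => z _; rewrite lee_fin mulr_ge0 ?sqr_ge0.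
exists (fine M) => _ [n _ <-].
rewrite -lee_fin fineK ?ge0_fin_numE//.
apply: le_trans (sum_le_esum (fun z => z%:~R ^+ 2 * q z) (segment_uniq n)).
rewrite lee_fin sum_segment mulr0z expr0n /= mul0r add0r /series /= big_mkord.
apply: (@le_trans _ _ (\sum_(k < n.+1) half_law k * k%:R ^+ 2)).
  by rewrite big_ord_recr /= lerDl t0.
rewrite big_ord_recl /= expr0n /= mulr0 add0r; apply: ler_sum => k _.
by rewrite mulrC lerDl mulr_ge0// sqr_ge0.
Qed.

(** Generation of the group writes 1 as a sum of possible steps, negative multiples using opposite
    steps. If their number is odd, a closed loop of odd length is appended; without one, 2 would
    divide all return times. *)
Lemma aperiodic_steps : exists t : seq int,
  [/\ all (fun z => 0 < half_law `|z|%N) t, ~~ odd (size t) & \sum_(z <- t) z = 1].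
Proof.
have [_ [_ [_ [_ [_ [ap [s [sp s1]]]]]]]] := hq.
have [t0 [tp t1]] : exists t : seq int, all (fun z => 0 < q z) t /\ \sum_(z <- t) z = 1.
  rewrite -s1; elim: s sp {s1} => [|[a z] s IH] /=; first by exists [::]; rewrite !big_nil.
  move=> /andP[qz /IH[t [tp ts]]].
  case: a => n.
    exists (nseq n z ++ t); rewrite all_cat tp andbT all_nseq qz orbT; split=> //.
    by rewrite big_cat big_cons /= ts big_nseq iter_addr_0 -mulr_natl natz.
  exists (nseq n.+1 (- z) ++ t); rewrite all_cat tp andbT all_nseq q_even qz orbT; split=> //.
  rewrite big_cat big_cons /= ts; congr (_ + _).
  by rewrite -[_ :: _]/(nseq n.+1 (- z)) big_nseq iter_addr_0 NegzE mulNrn mulNr -mulr_natl natz.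
have [c [cp co c0]] : exists c : seq int,
    [/\ all (fun z => 0 < q z) c, odd (size c) & \sum_(z <- c) z = 0].
  apply: contrapT => /forallNP h.
  suff /ap : forall n : nat, (1 <= n)%N -> conv_pow_pos q n -> (2 %| n)%N by [].
  move=> n _ [c [<- [cp c0]]]; rewrite dvdn2; apply/negP => co.
  by apply: (h c).
have pos u : all (fun z => 0 < q z) u -> all (fun z => 0 < half_law `|z|%N) u.
  by apply: sub_all => z; exact: half_law_abs.
have [todd|teven] := boolP (odd (size t0)); last by exists t0; split=> //; exact: pos.
exists (t0 ++ c); split; first by rewrite pos// all_cat tp.
  by rewrite size_cat oddD todd co.
by rewrite big_cat /= t1 c0 addr0.
Qed.

End StepLaw.

(** * Laws of the observations *)

Section Observations.
Variables (R : realType) (q : int -> R).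
Hypothesis hq : step_assumptions q.

Let w := half_law q.
Let w_ge0 k : 0 <= w k. Proof. exact: half_law_ge0. Qed.
Let w_total : series (fun k => w k *+ 2) @ \oo --> (1 : R). Proof. exact: half_law_total. Qed.
Let w_moment2 : cvgn (series (fun k => w k * k%:R ^+ 2)). Proof. exact: half_law_moment2. Qed.

Local Notation A := (avg (half_law q)).

(** The mean product of the functions [ms] at the successive positions of a walk started at the
    argument. *)
Fixpoint path_value (ms : seq (int -> R)) : int -> R :=
  if ms is m :: ms' then fun z => m z * A (path_value ms') z else fun=> 1.

Fixpoint all_bounded (ms : seq (int -> R)) : Prop :=
  if ms is m :: ms' then unif_bounded m /\ all_bounded ms' else True.

Lemma all_bounded_cat s t : all_bounded (s ++ t) <-> all_bounded s /\ all_bounded t.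
Proof.
elim: s => [|m s IH] /=; first by split=> [|[]].
by split=> [[bm /IH[]]|[[bm bs] bt]] //; split=> //; apply/IH.
Qed.

Lemma all_bounded_map (I : Type) (g : I -> int -> R) (s : seq I) :
  (forall i, unif_bounded (g i)) -> all_bounded (map g s).
Proof. by move=> h; elim: s => //= i s IH; split. Qed.

Lemma path_value_bounded ms : all_bounded ms -> unif_bounded (path_value ms).
Proof.
elim: ms => [|m ms IH] /=; first by move=> _; exact: unif_bounded_cst.
by move=> [bm bms]; apply: unif_boundedM => //; apply: avg_bounded => //; exact: IH.
Qed.

Lemma path_value_lin (ms1 ms2 : seq (int -> R)) (m m' m'' : int -> R) (a : R) z :
  all_bounded ms1 -> all_bounded ms2 -> unif_bounded m' -> unif_bounded m'' ->
  (forall y, m y = m' y - a * m'' y) ->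
  path_value (ms1 ++ m :: ms2) z =
  path_value (ms1 ++ m' :: ms2) z - a * path_value (ms1 ++ m'' :: ms2) z.
Proof.
move=> + b2 b' b'' mE; elim: ms1 z => [|n ms1 IH] z /=.
  by move=> _; rewrite mE; ring.
move=> [bn b1].
have b k : unif_bounded k -> unif_bounded (path_value (ms1 ++ k :: ms2)).
  by move=> bk; apply: path_value_bounded; apply/all_bounded_cat; split.
have -> : path_value (ms1 ++ m :: ms2) =
    fun y => 1 * path_value (ms1 ++ m' :: ms2) y + (- a) * path_value (ms1 ++ m'' :: ms2) y.
  by apply/funext => y; rewrite IH//; ring.
by rewrite avg_lin//; [ring | exact: b | exact: b].
Qed.

Variables (d : measure_display) (Omega : measurableType d) (P : probability Omega R).
Variables (eta : int -> probability R R) (S : nat -> Omega -> int) (X : nat -> Omega -> R).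
Hypothesis hobs : walk_observations P q eta S X.

Let S_meas n z : measurable [set x | S n x = z]. Proof. by have [h _] := hobs. Qed.
Let X_meas n : measurable_fun [set: Omega] (X n). Proof. by have [_ [h _]] := hobs. Qed.

Definition law_of (z : int) (B : set R) : R := fine (eta z B).

Lemma law_of_itv z B : measurable B -> 0 <= law_of z B <= 1.
Proof.
move=> mB; rewrite /law_of fine_ge0//=.
have := probability_le1 (eta z) mB.
have : (0 <= eta z B)%E by [].
by case: (eta z B) => //= r r0; rewrite lee_fin.
Qed.

Lemma law_of_bounded B : measurable B -> unif_bounded (law_of ^~ B).
Proof.
move=> mB; exists 1 => z; have /andP[h0 h1] := law_of_itv z mB.
by rewrite ger0_norm.
Qed.

Section Cylinders.
Variables (n : nat) (B : nat -> set R).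
Hypothesis mB : forall i, measurable (B i).

Let ev k (zs : nat -> int) : set Omega :=
  [set x | forall i, (i <= n)%N -> ((i <= k)%N -> S i x = zs i) /\ B i (X i x)].

Let ev_meas k zs : measurable (ev k zs).
Proof.
have -> : ev k zs = \bigcap_(i in [set i | (i <= n)%N])
   ((if (i <= k)%N then [set x | S i x = zs i] else setT) `&` (X i @^-1` B i)).
  apply/seteqP; split=> x h i /= hi; have := h i hi.
    by move=> [h1 h2]; split=> //; case: ifP => // ik; exact: h1.
  by move=> [h1 h2]; split=> // ik; move: h1; rewrite ik.
apply: bigcap_measurable => [|i _]; first by exists 0%N.
apply: measurableI; first by case: ifP.
by rewrite -[X in measurable X]setTI; exact: X_meas.
Qed.

Let pref k (zs : nat -> int) : R := (zs 0%N == 0)%:R * (\prod_(i < k) q (zs i.+1 - zs i)) *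
  (\prod_(i < k) law_of (zs i) (B i)).

(** Backward induction on the time k up to which the path is prescribed: k = n is the given joint
    law, and a position is released by summing over the next step. *)
Lemma cylinder_prob k zs : (k <= n)%N -> P (ev k zs) =
  (pref k zs * path_value [seq law_of ^~ (B i) | i <- iota k (n - k).+1] (zs k))%:E.
Proof.
move=> kn; have [j jE] : exists j, (n - k = j)%N by exists (n - k)%N.
elim: j k zs kn jE => [|j IH] k zs kn jE.
  have kE : k = n by lia.
  subst k; rewrite subnn /= avg_cst ?mulr1//.
  have -> : ev n zs = [set x | forall i, (i <= n)%N -> S i x = zs i /\ B i (X i x)].
    by apply/seteqP; split=> x h i hi; have [h1 h2] := h i hi; split=> //; exact: h1.
  have [_ [_ hP]] := hobs; rewrite hP//.
  by rewrite /pref [\prod_(i < n.+1) _]big_ord_recr /= -/(law_of _ _) mulrA.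
pose zs' (u : int) i := if (i <= k)%N then zs i else zs k + u.
pose b := path_value [seq law_of ^~ (B i) | i <- iota k.+1 (n - k.+1).+1].
have step u : P (ev k.+1 (zs' u)) = (pref k zs * law_of (zs k) (B k) * (q u * b (zs k + u)))%:E.
  rewrite IH; [|lia|lia].
  rewrite {2}/zs' ltnn -/b /pref !big_ord_recr /=.
  have -> : zs' u 0%N = zs 0%N by [].
  have -> : zs' u k = zs k by rewrite /zs' leqnn.
  have -> : zs' u k.+1 = zs k + u by rewrite /zs' ltnn.
  have -> : \prod_(i < k) q (zs' u i.+1 - zs' u i) = \prod_(i < k) q (zs i.+1 - zs i).
    by apply: eq_bigr => i _; rewrite /zs' ltn_ord ltnW.
  have -> : \prod_(i < k) law_of (zs' u i) (B i) = \prod_(i < k) law_of (zs i) (B i).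
    by apply: eq_bigr => i _; rewrite /zs' ltnW.
  have -> : zs k + u - zs k = u by lia.
  by congr (_%:E); ring.
(* Opposite steps are grouped so that the measures add up in the order of [sym_term]. *)
pose F l := if l is 0 then ev k.+1 (zs' 0) else ev k.+1 (zs' l%:Z) `|` ev k.+1 (zs' (- l%:Z)).
have evS u x : ev k.+1 (zs' u) x <-> ev k zs x /\ S k.+1 x = zs k + u.
  split=> [h|[h e] i hi].
    split=> [i hi|].
      have [h1 h2] := h i hi; split=> // ik; rewrite h1 ?(leqW ik)//.
      by rewrite /zs' ik.
    have [|h1 _] := h k.+1; first lia.
    by rewrite h1// /zs' ltnn.
  have [h1 h2] := h i hi; split=> // ik; rewrite /zs'; case: ifP => ik'; first exact: h1.
  have -> : i = k.+1 by lia.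
  by [].
have FE l x : F l x <-> ev k zs x /\ `|S k.+1 x - zs k|%N = l.
  case: l => [|l] /=.
    by rewrite evS; split=> -[h e]; split=> //; lia.
  split=> [[/evS[h e]|/evS[h e]]|[h e]].
  - by split=> //; lia.
  - by split=> //; lia.
  - have [e'|e'] : S k.+1 x = zs k + l.+1%:Z \/ S k.+1 x = zs k + - l.+1%:Z by lia.
      by left; apply/evS.
    by right; apply/evS.
have mF l : measurable (F l).
  by case: l => [|l]; [exact: ev_meas | apply: measurableU; exact: ev_meas].
have tF : trivIset setT F.
  apply/trivIsetP => l l' _ _ ll'; apply/seteqP; split=> // x [].
  move=> /FE [_ e] /FE [_ e'].
  by move: ll'; rewrite -e -e' eqxx.
have UF : ev k zs = \bigcup_l F l.
  apply/seteqP; split=> [x h|x [l _ /FE[]//]].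
  by exists `|S k.+1 x - zs k|%N => //; apply/FE.
have PF l : P (F l) = (pref k zs * law_of (zs k) (B k) * sym_term w (fun u => b (zs k + u)) l)%:E.
  have q_even z : q (- z) = q z by have [_ [_ [_ [_ [h _]]]]] := hq; rewrite -h.
  rewrite /F; case: l => [|l].
    rewrite step /sym_term /w /=; congr (_%:E); rewrite oppr0; by field.
  transitivity (P (ev k.+1 (zs' l.+1%:Z)) + P (ev k.+1 (zs' (- l.+1%:Z)%R)))%E.
    apply: measureU; try exact: ev_meas.
    by apply/seteqP; split=> // x [/evS[_ e] /evS[_ e']]; move: e; rewrite e'; lia.
  by rewrite !step -EFinD /sym_term /w /= q_even; congr (_%:E); ring.
have bb : unif_bounded b.
  apply/path_value_bounded/all_bounded_map => i; exact: law_of_bounded.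
have cP : (fun l => \sum_(0 <= i < l) P (F i))%E @ \oo --> P (ev k zs).
  by rewrite UF; apply: measure_semi_sigma_additive => //; rewrite -UF.
have cE : (fun l => \sum_(0 <= i < l) P (F i))%E @ \oo -->
    (pref k zs * law_of (zs k) (B k) * A b (zs k))%:E.
  have -> : (fun l => \sum_(0 <= i < l) P (F i))%E = EFin \o
      (fun l => pref k zs * law_of (zs k) (B k) * series (sym_term w (fun u => b (zs k + u))) l).
    apply/funext => l /=; rewrite /series /= mulr_sumr -sumEFin.
    by apply: eq_bigr => i _; rewrite PF.
  apply/cvg_EFin; first exact: nearW.
  apply: cvgMr; apply: (cvg_Esym w_ge0 w_total w_moment2).
  exact/unif_bounded_quad/unif_bounded_comp.
rewrite -(cvg_lim _ cP)// (cvg_lim _ cE)//.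
have -> : (n - k = (n - k.+1).+1)%N by lia.
by rewrite /= mulrA.
Qed.

End Cylinders.

Lemma observation_prob n (B : nat -> set R) : (forall i, measurable (B i)) ->
  P [set x | forall i, (i <= n)%N -> B i (X i x)] =
  (path_value [seq law_of ^~ (B i) | i <- iota 0 n.+1] 0)%:E.
Proof.
move=> mB.
have S0 : P [set x | S 0%N x <> 0] = 0%E.
  have -> : [set x | S 0%N x <> 0] = ~` [set x | S 0%N x = 0] by [].
  rewrite probability_setC//.
  have [_ [_ h]] := hobs.
  have := h 0%N (fun=> 0) (fun=> setT) (fun=> measurableT).
  rewrite big_ord0 big_ord_recl big_ord0 eqxx !mul1r mulr1 probability_setT /= => e.
  have -> : [set x | S 0%N x = 0] =
      [set x | forall i : nat, (i <= 0)%N -> S i x = 0 /\ setT (X i x)].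
    apply/seteqP; split=> x /=; first by move=> e0 i; rewrite leqn0 => /eqP ->.
    by move=> /(_ 0%N (leqnn _))[].
  by rewrite e subee.
have := @cylinder_prob n B mB 0 (fun=> 0) (leq0n _).
rewrite subn0 !big_ord0 eqxx !mul1r => <-.
set E1 := [set x | _]; set E2 := [set x | _].
have mE2 : measurable E2.
  have -> : E2 = [set x | S 0%N x = 0] `&` \bigcap_(i in [set i | (i <= n)%N]) (X i @^-1` B i).
    apply/seteqP; split=> x /= h.
      by split=> [|i hi]; [have [h1 _] := h 0%N (leq0n _); exact: h1 | have [] := h i hi].
    by case: h => h1 h2 i hi; split; [rewrite leqn0 => /eqP -> | exact: h2].
  apply: measurableI => //; apply: bigcap_measurable => [|i _]; first by exists 0%N.
  by rewrite -[X in measurable X]setTI; exact: X_meas.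
have mE1 : measurable E1.
  have -> : E1 = \bigcap_(i in [set i | (i <= n)%N]) (X i @^-1` B i) by [].
  apply: bigcap_measurable => [|i _]; first by exists 0%N.
  by rewrite -[X in measurable X]setTI; exact: X_meas.
have m0 : measurable [set x | S 0%N x <> 0] by exact: (measurableC (S_meas 0 0)).
apply/eqP; rewrite eq_le; apply/andP; split.
  apply: (@le_trans _ _ (P (E2 `|` [set x | S 0%N x <> 0]))).
    apply: le_measure; rewrite ?inE//; first exact: measurableU.
    move=> x h; have [e|e] := pselect (S 0%N x = 0); last by right.
    by left=> i hi; split; [rewrite leqn0 => /eqP -> | exact: h].
  pose N0 := [set x | S 0%N x <> 0].
  have h : (P (E2 `|` N0) <= P E2 + P N0)%E.
    exact: measureU2.
  by rewrite /N0 S0 adde0 in h.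
by apply: le_measure; rewrite ?inE// => x h i hi; exact: (proj2 (h i hi)).
Qed.

(** * Expectations of products of observations *)

Definition bounded_rv (f : Omega -> R) : Prop :=
  measurable_fun [set: Omega] f /\ exists C, forall x, `|f x| <= C.

Definition Ex (f : Omega -> R) : R := \int[P]_(x in [set: Omega]) f x.

Lemma bounded_rv_integrable f : bounded_rv f -> P.-integrable setT (EFin \o f).
Proof.
move=> [mf [C hC]]; apply: measurable_bounded_integrable => //.
  by rewrite [X in (X < _)%E](_ : _ = 1%E) ?ltry//; exact: probability_setT.
exists C; split; first exact: num_real.
by move=> M CM x _; exact: le_trans (hC x) (ltW CM).
Qed.

Lemma bounded_rv_lin a b f g : bounded_rv f -> bounded_rv g ->
  bounded_rv (fun x => a * f x + b * g x).
Proof.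
move=> [mf [C hC]] [mg [D hD]]; split.
  by apply: measurable_funD; apply: measurable_funM => //; exact: measurable_cst.
exists (`|a| * C + `|b| * D) => x.
by rewrite (le_trans (ler_normD _ _))// !normrM lerD// ler_wpM2l.
Qed.

Lemma bounded_rv_cst c : bounded_rv (fun=> c).
Proof. by split; [exact: measurable_cst | exists `|c|]. Qed.

Lemma bounded_rvM f g : bounded_rv f -> bounded_rv g -> bounded_rv (fun x => f x * g x).
Proof.
move=> [mf [C hC]] [mg [D hD]]; split; first exact: measurable_funM.
by exists (C * D) => x; rewrite normrM ler_pM.
Qed.

Lemma Ex_lin a b f g : bounded_rv f -> bounded_rv g ->
  Ex (fun x => a * f x + b * g x) = a * Ex f + b * Ex g.
Proof.
move=> bf bg; have bZ c h : bounded_rv h -> bounded_rv (fun x => c * h x).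
  by move=> bh; apply: bounded_rvM => //; exact: bounded_rv_cst.
rewrite /Ex RintegralD//; try exact/bounded_rv_integrable/bZ.
by rewrite !RintegralZl//; exact: bounded_rv_integrable.
Qed.

Lemma Ex_cst c : Ex (fun=> c) = c.
Proof.
transitivity (c * fine (P setT)); first exact: Rintegral_cst.
by rewrite probability_setT mulr1.
Qed.

Lemma Ex_le f g : bounded_rv f -> bounded_rv g -> (forall x, f x <= g x) -> Ex f <= Ex g.
Proof. by move=> bf bg fg; apply: le_Rintegral => //; exact: bounded_rv_integrable. Qed.

Lemma Ex_indic (E : set Omega) : measurable E -> Ex (\1_E) = fine (P E).
Proof. by move=> mE; rewrite /Ex /Rintegral integral_indic// setIT. Qed.

Lemma bounded_rv_sum (I : Type) (s : seq I) (f : I -> Omega -> R) :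
  (forall i, bounded_rv (f i)) -> bounded_rv (fun x => \sum_(i <- s) f i x).
Proof.
move=> hf; elim: s => [|i s IH].
  rewrite (_ : (fun x => _) = fun=> 0); first exact: bounded_rv_cst.
  by apply/funext => x; rewrite big_nil.
rewrite (_ : (fun x => _) = fun x => 1 * f i x + 1 * \sum_(j <- s) f j x).
  exact: bounded_rv_lin.
by apply/funext => x; rewrite big_cons !mul1r.
Qed.

Lemma Ex_sum (I : Type) (s : seq I) (f : I -> Omega -> R) :
  (forall i, bounded_rv (f i)) -> Ex (fun x => \sum_(i <- s) f i x) = \sum_(i <- s) Ex (f i).
Proof.
move=> hf; elim: s => [|i s IH].
  rewrite big_nil -[RHS]Ex_cst; congr Ex; apply/funext => x; by rewrite big_nil.
rewrite big_cons -IH -[Ex (f i)]mul1r -[X in _ + X]mul1r -Ex_lin//; last exact: bounded_rv_sum.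
by congr Ex; apply/funext => x; rewrite big_cons !mul1r.
Qed.

Lemma ExZ c f : bounded_rv f -> Ex (fun x => c * f x) = c * Ex f.
Proof. by move=> bf; rewrite /Ex RintegralZl//; exact: bounded_rv_integrable. Qed.

Definition letter : Type := (set R * R)%type.

Fixpoint letter_prod (x : nat -> R) (t : nat) (L : seq letter) : R :=
  if L is l :: L' then (\1_(l.1) (x t) - l.2) * letter_prod x t.+1 L' else 1.

Definition letter_mean (l : letter) (z : int) : R := law_of z l.1 - l.2.

Fixpoint letters_meas (L : seq letter) : Prop :=
  if L is l :: L' then measurable l.1 /\ letters_meas L' else True.

Lemma letters_meas_cat L1 L2 : letters_meas (L1 ++ L2) <-> letters_meas L1 /\ letters_meas L2.
Proof.
elim: L1 => [|l L IH] /=; first by split=> [|[]].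
by split=> [[ml /IH[]]|[[ml m1] m2]] //; split=> //; apply/IH.
Qed.

Lemma letter_mean_bounded l : measurable l.1 -> unif_bounded (letter_mean l).
Proof.
move=> ml; have [C hC] := law_of_bounded ml; exists (C + `|l.2|) => z.
by rewrite (le_trans (ler_normB _ _))// lerD.
Qed.

Lemma letters_bounded L : letters_meas L -> all_bounded (map letter_mean L).
Proof. by elim: L => //= l L IH [ml mL]; split; [exact: letter_mean_bounded | exact: IH]. Qed.

Lemma indicX_rv t (B : set R) : measurable B -> bounded_rv (fun x => \1_B (X t x)).
Proof.
move=> mB; split; first by apply: measurableT_comp => //; exact: measurable_indic.
by exists 1 => x; rewrite indicE; case: (_ \in _); rewrite ?normr1 ?normr0.
Qed.

Lemma letter_prod_rv t L : letters_meas L -> bounded_rv (fun x => letter_prod (X ^~ x) t L).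
Proof.
elim: L t => [|l L IH] t /=; first by move=> _; exact: bounded_rv_cst.
move=> [ml mL]; apply: bounded_rvM; last exact: IH.
rewrite (_ : (fun x => _) = fun x => 1 * \1_(l.1) (X t x) + (-1) * l.2).
  by apply: bounded_rv_lin; [exact: indicX_rv | exact: bounded_rv_cst].
by apply/funext => x; rewrite mul1r mulN1r.
Qed.

Lemma letter_prod_cat x t L1 L2 :
  letter_prod x t (L1 ++ L2) = letter_prod x t L1 * letter_prod x (t + size L1) L2.
Proof.
elim: L1 t => [|l L IH] t /=; first by rewrite mul1r addn0.
by rewrite IH addSnnS mulrA.
Qed.

Lemma letter_prod_indic x t (Bs : seq (set R)) :
  letter_prod x t [seq (B, 0) | B <- Bs] =
  (`[< forall i, (i < size Bs)%N -> nth setT Bs i (x (t + i)%N) >])%:R.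
Proof.
elim: Bs t => [|B Bs IH] t /=; first by rewrite asboolT.
rewrite subr0 IH indicE -natrM mulnb; congr (nat_of_bool _)%:R.
apply/idP/asboolP => [/andP[/set_mem hB /asboolP h] [|i] hi|h].
- by rewrite addn0.
- by rewrite addnS -addSn; exact: h.
- apply/andP; split; first by apply/mem_set; have := h 0%N isT; rewrite addn0.
  by apply/asboolP => i hi; have := h i.+1 hi; rewrite addnS -addSn.
Qed.

Lemma letters_meas_nth (Bs : seq (set R)) i : letters_meas [seq (B, 0) | B <- Bs] ->
  measurable (nth setT Bs i).
Proof.
elim: Bs i => [|C Cs IH] [|i] //= []// mC mCs; exact: IH.
Qed.

Lemma Ex_letter_prod_indic (Bs : seq (set R)) : letters_meas [seq (B, 0) | B <- Bs] ->
  Ex (fun x => letter_prod (X ^~ x) 0 [seq (B, 0) | B <- Bs]) =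
  path_value [seq letter_mean (B, 0) | B <- Bs] 0.
Proof.
case: Bs => [|B0 Bs'] hm; first by rewrite /= Ex_cst.
set Bs := B0 :: Bs' in hm *.
pose B i := nth setT Bs i.
have mB i : measurable (B i) by exact: letters_meas_nth.
have meanE : [seq letter_mean (C, 0) | C <- Bs] = [seq law_of ^~ (B i) | i <- iota 0 (size Bs)].
  rewrite -[in LHS](mkseq_nth setT Bs) /mkseq -map_comp; apply: eq_map => i /=.
  by apply/funext => z; rewrite /letter_mean subr0.
rewrite meanE; have := observation_prob (size Bs').
move=> /(_ B mB) h; have := congr1 fine h => /= <-.
pose E := [set x | forall i, (i <= size Bs')%N -> B i (X i x)].
rewrite -[RHS]/(fine (P E)) -Ex_indic; last first.
  have -> : E = \bigcap_(i in [set i | (i <= size Bs')%N]) (X i @^-1` B i) by [].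
  apply: bigcap_measurable => [|i _]; first by exists 0%N.
  by rewrite -[Y in measurable Y]setTI; exact: X_meas.
congr Ex; apply/funext => x; rewrite -[LHS]/(letter_prod (X ^~ x) 0 [seq (C, 0) | C <- Bs]).
rewrite (letter_prod_indic _ 0 Bs) indicE; congr (nat_of_bool _)%:R.
Qed.

(** A letter [(B, a)] is [(B, 0)] minus [a] times [(setT, 0)], and both sides are linear in it.
    Letters are replaced from the left until only indicators remain, whose product is the indicator
    of a cylinder event. *)
Lemma Ex_letter_prod L : letters_meas L ->
  Ex (fun x => letter_prod (X ^~ x) 0 L) = path_value (map letter_mean L) 0.
Proof.
suff H L2 : forall Bs, letters_meas [seq (B, 0) | B <- Bs] -> letters_meas L2 ->
    Ex (fun x => letter_prod (X ^~ x) 0 ([seq (B, 0) | B <- Bs] ++ L2)) =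
    path_value ([seq letter_mean (B, 0) | B <- Bs] ++ map letter_mean L2) 0.
  by move=> mL; exact: (H L [::]).
elim: L2 => [|[B a] L2 IH] Bs mBs; first by rewrite !cats0 => _; exact: Ex_letter_prod_indic.
move=> /= [mB mL2].
have mrc (C : set R) : measurable C -> letters_meas [seq (B, 0) | B <- rcons Bs C].
  by move=> mC; rewrite map_rcons -cats1; apply/letters_meas_cat; split.
have E1 := IH (rcons Bs B) (mrc B mB) mL2.
have E2 := IH (rcons Bs setT) (mrc setT measurableT) mL2.
rewrite !map_rcons !cat_rcons in E1 E2.
rewrite (@path_value_lin _ _ (letter_mean (B, a)) (letter_mean (B, 0)) (letter_mean (setT, 0)) a).
- rewrite -E1 -E2 -[in RHS]mulNr -[in RHS](mul1r (Ex _)) -Ex_lin.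
  + congr Ex; apply/funext => x; rewrite !letter_prod_cat /= indicT /= !subr0; ring.
  + by apply: letter_prod_rv; apply/letters_meas_cat; split.
  + by apply: letter_prod_rv; apply/letters_meas_cat; split=> //; split=> //; exact: measurableT.
- rewrite (map_comp letter_mean (fun B => (B, 0)) Bs); exact: letters_bounded.
- exact: letters_bounded.
- exact: letter_mean_bounded.
- by apply: letter_mean_bounded; exact: measurableT.
- by move=> y; rewrite /letter_mean /law_of /= probability_setT /=; ring.
Qed.

Variables (alpha : probability R R) (Ds : seq int).
Hypothesis Ds_uniq : uniq Ds.
Hypothesis Ds_supp : forall z B, z \notin Ds -> measurable B -> eta z B = alpha B.

Definition ray (r : rat) : set R := `]-oo, ratr r[%classic.

Definition centred (r : rat) (x : R) : R := \1_(ray r) x - fine (alpha (ray r)).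

(* The pair [(k, r)] stands for a time lag of [2 (k + 1)] followed by the ray [r]. *)
Fixpoint word_prod (x : nat -> R) (t : nat) (u : seq (nat * rat)) : R :=
  if u is (k, r) :: u' then
    centred r (x (t + k.+1.*2)%N) * word_prod x (t + k.+1.*2) u'
  else 1.

Fixpoint word_len (u : seq (nat * rat)) : nat :=
  if u is (k, _) :: u' then (k.+1 + word_len u')%N else 0%N.

Definition excess (r : rat) (z : int) : R := law_of z (ray r) - fine (alpha (ray r)).

Definition blank : letter := (setT, 0).

(** One letter per time, from the time after the start on: a lag of 2 (k + 1) is 2k + 1 blanks
    followed by the ray. *)
Fixpoint spell (u : seq (nat * rat)) : seq letter :=
  if u is (k, r) :: u' then nseq k.*2.+1 blank ++ (ray r, fine (alpha (ray r))) :: spell u'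
  else [::].

Local Notation rk := (fun k => ret (half_law q) k.+1).

Lemma ray_meas r : measurable (ray r).
Proof. exact: measurable_itv. Qed.

Lemma spell_meas u : letters_meas (spell u).
Proof.
elim: u => //= -[k r] u IH; split; first exact: measurableT.
apply/letters_meas_cat; split; last by split=> //; exact: ray_meas.
by elim: (k.*2) => //= n IHn; split=> //; exact: measurableT.
Qed.

Lemma letter_prod_blank x t n L :
  letter_prod x t (nseq n blank ++ L) = letter_prod x (t + n) L.
Proof.
elim: n t => [|n IH] t /=; first by rewrite addn0.
by rewrite indicT /= subr0 mul1r IH addSnnS.
Qed.

Lemma word_prodE x t u : word_prod x t u = letter_prod x t.+1 (spell u).
Proof.
elim: u t => //= -[k r] u IH t.
rewrite -[blank :: _]/(nseq k.*2.+1 blank ++ _) -[LHS]/(_ * _) IH.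
have := letter_prod_blank x t.+1 k.*2.+1 ((ray r, fine (alpha (ray r))) :: spell u).
rewrite /= => ->.
by have -> : (t.+1 + k.*2.+1)%N = (t + k.+1.*2)%N by lia.
Qed.

Lemma iter_avg_sum n (c g : int -> R) x : unif_bounded g ->
  iter n A (fun x => \sum_(y <- Ds) c y * g (x - y)) x =
  \sum_(y <- Ds) c y * iter n A g (x - y).
Proof.
move=> bg; elim: n x => [//|n IH] x; rewrite !iterS.
have bi : unif_bounded (iter n A g).
  by elim: n {IH} => //= n IHn; exact: avg_bounded.
rewrite (_ : iter n A _ = fun x => \sum_(y <- Ds) c y * iter n A g (x - y)); last exact/funext.
have bs y : unif_bounded (fun u => c y * iter n A g (x + u - y)).
  by apply: unif_boundedZ; exact: (@unif_bounded_comp _ (iter n A g) (fun u => x + u - y)).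
rewrite /avg Esym_sum//; apply: eq_bigr => y _.
rewrite EsymZ//; last first.
  by apply: unif_bounded_quad; exact: (@unif_bounded_comp _ (iter n A g) (fun u => x + u - y)).
by congr (_ * _); apply: eq_Esym => u; rewrite addrAC.
Qed.

Lemma ret_iter n : ret (half_law q) n = iter n.*2 A (@delta0 R).
Proof. by elim: n => // n IH; rewrite doubleS !iterS -IH. Qed.

Lemma excess_supp r z : z \notin Ds -> excess r z = 0.
Proof. by move=> zD; rewrite /excess /law_of Ds_supp ?subrr//; exact: ray_meas. Qed.

(** Blanks act as plain averaging. The excess vanishes outside [Ds], so the function averaged over a
    lag is a finite combination of translates of [delta0], each of which becomes a translate of
    [ret k.+1]. *)
Lemma path_value_spell u x :
  A (path_value (map letter_mean (spell u))) x = word_sum rk excess Ds u (fun=> 1) x.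
Proof.
elim: u x => [|[k r] u IH] x; first by rewrite /= avg_cst.
have blanks n ms : path_value (map letter_mean (nseq n blank) ++ ms) = iter n A (path_value ms).
  elim: n => //= n IHn; apply/funext => z; rewrite IHn /letter_mean /law_of /=.
  by rewrite probability_setT subr0 mul1r.
rewrite [spell _]/= -[blank :: _]/(nseq k.*2.+1 blank ++ _) map_cat blanks -iterS.
pose G y := excess r y * word_sum rk excess Ds u (fun=> 1) y.
have -> : path_value (map letter_mean ((ray r, fine (alpha (ray r))) :: spell u)) =
    fun z => \sum_(y <- Ds) G y * @delta0 R (z - y).
  apply/funext => z; rewrite /= IH -/(excess r z) -/(G z).
  have [zD|zD] := boolP (z \in Ds).
    rewrite (bigD1_seq z)//= subrr /delta0 eqxx mulr1 big1 ?addr0// => y yz.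
    by rewrite subr_eq0 eq_sym (negbTE yz) mulr0.
  rewrite big1_seq => [|y /andP[_ yD]]; first by rewrite /G excess_supp ?mul0r.
  rewrite /delta0 subr_eq0; case: eqP => [zy|]; last by rewrite mulr0.
  by rewrite zy yD in zD.
rewrite -doubleS iter_avg_sum; last exact: delta0_bounded.
by apply: eq_bigr => y _; rewrite ret_iter mulrC.
Qed.

Lemma word_prod_rv t u : bounded_rv (fun o => word_prod (X ^~ o) t u).
Proof.
rewrite (_ : (fun o => _) = fun o => letter_prod (X ^~ o) t.+1 (spell u)).
  by apply: letter_prod_rv; exact: spell_meas.
by apply/funext => o; rewrite word_prodE.
Qed.

Lemma Ex_word_prod u :
  Ex (fun o => word_prod (X ^~ o) 0 u) = word_sum rk excess Ds u (fun=> 1) 0.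
Proof.
rewrite -path_value_spell.
have := @Ex_letter_prod (blank :: spell u); rewrite /= => h.
transitivity (letter_mean blank 0 * A (path_value [seq letter_mean i | i <- spell u]) 0).
  rewrite -h; last by split; [exact: measurableT | exact: spell_meas].
  by congr Ex; apply/funext => o; rewrite word_prodE indicT /= subr0 mul1r.
by rewrite /letter_mean /law_of /= probability_setT subr0 mul1r.
Qed.

Lemma word_prod_cat x t u1 u2 : word_prod x t (u1 ++ u2) =
  word_prod x t u1 * word_prod x (t + (word_len u1).*2) u2.
Proof.
elim: u1 t => [|[k r] u1 IH] t /=; first by rewrite mul1r addn0.
by rewrite IH mulrA; congr (_ * word_prod x _ u2); lia.
Qed.

Lemma word_prod_shift x s j r u :
  word_prod x s.*2 ((j, r) :: u) = word_prod x 0 ((s + j, r)%N :: u).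
Proof. by rewrite /=; have -> : (s.*2 + j.+1.*2 = 0 + (s + j).+1.*2)%N by lia. Qed.

Lemma alpha_ray_itv r : 0 <= fine (alpha (ray r)) <= 1.
Proof.
rewrite fine_ge0//=; have := probability_le1 alpha (ray_meas r).
have : (0 <= alpha (ray r))%E by [].
by case: (alpha (ray r)) => //= a a0; rewrite lee_fin.
Qed.

Lemma centred_le1 r x : `|centred r x| <= 1.
Proof.
have : 0 <= fine (alpha (ray r)) <= 1.
  exact: alpha_ray_itv.
rewrite /centred indicE; case: (_ \in _) => /= /andP[h0 h1].
  by rewrite ger0_norm ?subr_ge0// lerBlDr lerDl.
by rewrite sub0r normrN ger0_norm.
Qed.

Lemma word_prod_le1 x t u : `|word_prod x t u| <= 1.
Proof.
elim: u t => [|[k r] u IH] t /=; first by rewrite normr1.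
by rewrite normrM mulr_ile1// centred_le1.
Qed.

Definition statistic (r : rat) (u : seq (nat * rat)) (N : nat) (x : nat -> R) : R :=
  \sum_(n < N) v (half_law q) n.+1 * word_prod x 0 ((nat_of_ord n, r) :: u).

Definition weight (N : nat) : R := \sum_(n < N) v (half_law q) n.+1 ^+ 2.

Lemma statistic_rv r u N : bounded_rv (fun o => statistic r u N (X ^~ o)).
Proof.
apply: bounded_rv_sum => n; apply: bounded_rvM; first exact: bounded_rv_cst.
exact: word_prod_rv.
Qed.

(** If the second word starts after the end of the first, their product is again a word, so both
    moments are path weights and the abstract variance bound applies. The constant may depend on
    [eta], the weights only on [q]. *)
Lemma statistic_second_moment r u : exists C, forall N,
  Ex (fun o => (statistic r u N (X ^~ o) - word_total rk excess Ds r u (fun=> 1) * weight N) ^+ 2)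
  <= C * weight N.
Proof.
have [t [tp te t1]] := aperiodic_steps hq.
have [C1 C1p hC1] := avg2_gap_ge w_ge0 w_total w_moment2 tp te t1.
have [C2 C20 hC2] := cov_sum_le w_ge0 w_total w_moment2 C1p hC1.
set a := fun n => v (half_law q) n.+1; set dd := fun n => gap (half_law q) n.+1.
have v0 n : 0 <= v (half_law q) n by exact: v_ge0.
have v1 n : v (half_law q) n <= 1 by exact: v_le1.
have ex_le1 i z : `|excess i z| <= 1.
  have mr := ray_meas i; have /andP[h0 h1] := law_of_itv z mr.
  have /andP[h2 h3] := alpha_ray_itv i; rewrite /excess ler_norml; apply/andP; split; lra.
have rk0 k z : 0 <= ret (half_law q) k.+1 z by exact: ret_ge0.
have rkle k z : ret (half_law q) k.+1 z <= a k by exact: ret_le.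
have rkgap k z : a k - ret (half_law q) k.+1 z <= z%:~R ^+ 2 * dd k by exact: ret_gap.
have dd0 n : 0 <= dd n by exact: gap_ge0.
have [B B0 [hB1 hB2]] := word_moments_close (rk := rk) (f := excess) (vk := a) (dk := dd) Ds
  ex_le1 rk0 rkle (fun k => v1 k.+1) rkgap dd0 r u.
set H := word_total _ _ _ _ _ _ in hB1 hB2 *.
pose Y n o := word_prod (X ^~ o) 0 ((n, r) :: u).
have Yrv n : bounded_rv (Y n) by exact: word_prod_rv.
pose m1 n := Ex (Y n); pose m2 n m := Ex (fun o => Y n o * Y m o).
have dsum n : \sum_(i < n) dd i <= C1.
  have := sum_gap_le w_ge0 w_total w_moment2 C1p hC1 n.+1; apply: le_trans.
  by rewrite big_ord_recl lerDr; exact: gap_ge0.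
(* Times are shifted by one against [cov_sum_le]; the term left out is non-negative. *)
have cov L N : \sum_(j < N) a (L + j)%N * (a j - a (L + j)%N) <= C2.
  apply: le_trans (hC2 L N.+1); rewrite big_ord_recl /= addn0.
  rewrite (_ : \sum_(j < N) _ = \sum_(i < N) v (half_law q) (L + bump 0 i)%N *
    (v (half_law q) (bump 0 i) - v (half_law q) (L + bump 0 i)%N)); last first.
    by apply: eq_bigr => i _; rewrite /a /bump /= add1n addnS.
  by rewrite lerDr mulr_ge0// subr_ge0; apply: v_mono.
have amono m n : (m <= n)%N -> a n <= a m by move=> mn; apply: v_mono.
have m1c n : `|m1 n - H * a n| <= B * dd n by rewrite /m1 Ex_word_prod.
have m2s n m : m2 n m = m2 m n.
  by congr Ex; apply/funext => o; rewrite mulrC.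
have m2le n m : m2 n m <= 1.
  rewrite -[X in _ <= X](Ex_cst 1); apply: Ex_le.
  - exact: bounded_rvM.
  - exact: bounded_rv_cst.
  - move=> o; apply: (le_trans (ler_norm _)); rewrite normrM.
    by rewrite mulr_ile1//; exact: word_prod_le1.
have m2c n j : `|m2 n (n + (word_len u).+1 + j)%N - H ^+ 2 * a n * a j| <=
    B * (a j * dd n + a n * dd j).
  have -> : m2 n (n + (word_len u).+1 + j)%N =
      Ex (fun o => word_prod (X ^~ o) 0 (((n, r) :: u) ++ (j, r) :: u)).
    congr Ex; apply/funext => o; rewrite word_prod_cat /Y; congr (_ * _).
    rewrite add0n word_prod_shift; congr (word_prod _ _ ((_, r) :: u)).
    by rewrite /=; lia.
  by rewrite Ex_word_prod.
have := second_moment_le (fun n => v0 n.+1) (fun n => v1 n.+1) amono dd0 dsum cov B0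
  m1c m2s m2le m2c.
move=> h.
exists (2 * ((word_len u).+1%:R + H ^+ 2 * C2 + B * C1 + B * C1) +
  2 * (`|H| * (B * C1))) => N.
apply: le_trans (h N); rewrite le_eqVlt; apply/orP; left; apply/eqP.
rewrite -/(weight N).
pose st o := statistic r u N (X ^~ o).
have strv : bounded_rv st by exact: statistic_rv.
have -> : (fun o => (statistic r u N (X ^~ o) - H * weight N) ^+ 2) =
  fun o => 1 * (1 * (st o * st o) + (- (2 * (H * weight N))) * st o) + 1 * (H * weight N) ^+ 2.
  by apply/funext => o; rewrite -/(st o); ring.
rewrite Ex_lin; [|apply: bounded_rv_lin => //; exact: bounded_rvM|exact: bounded_rv_cst].
rewrite Ex_cst !mul1r Ex_lin ?mul1r//; last exact: bounded_rvM.
rewrite mulNr; congr (_ - _ * _ + _).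
  transitivity (Ex (fun o => \sum_(n < N) \sum_(m < N) (a n * a m) * (Y n o * Y m o))).
    congr Ex; apply/funext => o; rewrite /st /statistic mulr_suml.
    apply: eq_bigr => n _; rewrite mulr_sumr; apply: eq_bigr => m _.
    rewrite -/(Y n o) -/(Y m o) -/(a n) -/(a m); ring.
  rewrite Ex_sum => [|n]; last first.
    by apply: bounded_rv_sum => m; apply: bounded_rvM; [exact: bounded_rv_cst | exact: bounded_rvM].
  apply: eq_bigr => n _; rewrite Ex_sum => [|m]; last first.
    by apply: bounded_rvM; [exact: bounded_rv_cst | exact: bounded_rvM].
  by apply: eq_bigr => m _; rewrite ExZ//; exact: bounded_rvM.
rewrite /st /statistic Ex_sum => [|n]; last first.
  by apply: bounded_rvM; [exact: bounded_rv_cst | exact: Yrv].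
by apply: eq_bigr => n _; rewrite ExZ//; exact: Yrv.
Qed.

Lemma weight_unbounded M : exists N, M <= weight N.
Proof.
have [t [tp te t1]] := aperiodic_steps hq.
have [C1 C1p hC1] := avg2_gap_ge w_ge0 w_total w_moment2 tp te t1.
have [n hn] := V_unbounded w_ge0 w_total w_moment2 C1p (M + 1).
exists n; have : V (half_law q) n <= V (half_law q) n.+1.
  by rewrite /V big_ord_recr /= lerDl sqr_ge0.
by rewrite {2}/V big_ord_recl v_0 expr1n -/(weight n); lra.
Qed.

End Observations.

(** * Almost sure reconstruction *)

(** By monotone convergence the sum of the [f k] is integrable, hence almost everywhere finite, and
    the terms of a convergent series tend to 0. *)
Lemma ae_summable_cvg0 (R : realType) (d : measure_display) (Omega : measurableType d)
    (P : probability Omega R) (f : nat -> Omega -> R) (C : R) :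
  (forall k, bounded_rv (f k)) -> (forall k o, 0 <= f k o) ->
  (forall k, Ex P (f k) <= C / 2 ^+ k) ->
  {ae P, forall o, f ^~ o @ \oo --> (0 : R)}.
Proof.
move=> bf f0 hC.
have C0 : 0 <= C.
  have := hC 0%N; rewrite expr0 divr1; apply: le_trans.
  by apply: Rintegral_ge0 => o _.
pose g o := (\sum_(0 <= k <oo) (f k o)%:E)%E.
have mf k : measurable_fun setT (EFin \o f k).
  by apply/measurable_EFinP; have [] := bf k.
have g0 o : (0 <= g o)%E by apply: nneseries_ge0 => k _ _; rewrite lee_fin.
have Exf k : (\int[P]_o (f k o)%:E)%E = (Ex P (f k))%:E.
  by rewrite /Ex /Rintegral fineK//; apply: integrable_fin_num => //; exact: bounded_rv_integrable.
have ig : (\int[P]_o g o < +oo)%E.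
  rewrite /g integral_nneseries//; last by move=> k o _; rewrite lee_fin.
  apply: (@le_lt_trans _ _ (2 * C)%:E); last exact: ltry.
  apply: lime_le.
    by apply: is_cvg_nneseries => k _ _; apply: integral_ge0 => o _; rewrite lee_fin.
  apply: nearW => n; rewrite (eq_bigr (fun k => (Ex P (f k))%:E)); last by move=> k _; rewrite Exf.
  rewrite sumEFin lee_fin (le_trans (ler_sum _ (fun k _ => hC k)))//.
  rewrite -mulr_sumr big_mkord mulrC ler_wpM2r//.
  have -> : \sum_(i < n) (2 ^+ i)^-1 = 2 - 2 / 2 ^+ n :> R.
    elim: n => [|n IH]; first by rewrite big_ord0 expr0; field.
    by rewrite big_ord_recr /= IH exprS; field; rewrite expf_neq0.
  by rewrite lerBlDr lerDl divr_ge0// exprn_ge0.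
have intg : P.-integrable setT g.
  apply/integrableP; split.
    have := @ge0_emeasurable_sum _ _ _ setT (fun k o => (f k o)%:E) xpredT; apply=> [k o _ _|k _].
      by rewrite lee_fin.
    exact: mf.
  by rewrite (eq_integral g)// => o _; rewrite gee0_abs.
have := integrable_ae measurableT intg; apply: filterS => o /(_ I) fin.
apply: cvg_series_cvg_0; apply: nondecreasing_is_cvgn.
  by apply/nondecreasing_seqP => n; rewrite /series /= big_nat_recr//= lerDl.
exists (fine (g o)) => _ [n _ <-].
rewrite -lee_fin fineK// /series /= -sumEFin.
by apply: nneseries_lim_ge => k _ _; rewrite lee_fin.
Qed.

Section Rays.
Variable R : realType.

Lemma rays_generate : @measurable _ R = <<s range (@ray R) >>.
Proof.
apply/seteqP; split=> A; last first.
  apply: smallest_sub => //; first exact: sigma_algebra_measurable.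
  by move=> _ [r _ <-]; exact: ray_meas.
have mE : @measurable _ R = <<s RGenInftyO.G (R:=R) >> := RGenInftyO.measurableE R.
rewrite mE; move: A; apply: smallest_sub; first exact: smallest_sigma_algebra.
move=> _ [x ->].
have -> : `]-oo, x[%classic = \bigcup_k (if @unpickle rat k is Some r then
    (if ratr r < x then @ray R r else set0) else set0).
  apply/seteqP; split=> y /=.
    rewrite in_itv /= => /rat_in_itvoo[r]; rewrite in_itv /= => /andP[yr rx].
    exists (pickle r); first exact: I.
    by rewrite pickleK rx /ray /= in_itv.
  move=> [k _]; case: (unpickle k) => // r; case: ifP => // rx.
  by rewrite /ray /= !in_itv /= => /lt_trans; apply.
have [s0 sC sU] := smallest_sigma_algebra setT (range (@ray R)).
apply: sU => k; case: (unpickle k) => // r; case: ifP => // _.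
by apply: sub_sigma_algebra; exists r.
Qed.

(** Rational rays are countable, generate the Borel sets and are closed under intersection, so
    countably many statistics suffice for a whole law. *)
Lemma rays_determine (mu nu : probability R R) :
  (forall r, fine (mu (@ray R r)) = fine (nu (@ray R r))) ->
  forall A, measurable A -> mu A = nu A.
Proof.
move=> h A mA.
apply: (measure_unique (range (@ray R)) (fun k => @ray R k%:R)) => //.
- exact: rays_generate.
- move=> _ _ [r _ <-] [s _ <-]; exists (Order.min r s) => //.
  apply/seteqP; split=> x; rewrite /ray /= !in_itv /=.
    by rewrite minEle; case: ifP => rs xr; split=> //; apply: (lt_le_trans xr); rewrite ler_rat;
      rewrite // ltW// ltNge rs.
  by move=> [xr xs]; rewrite minEle; case: ifP.
- apply/seteqP; split=> // x _; exists (Num.truncn `|x|).+1 => //.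
  rewrite /ray /= in_itv /= ratr_nat (le_lt_trans (ler_norm x))//.
  by have /andP[] := Num.Theory.truncn_itv (normr_ge0 x).
- move=> _ [r _ <-].
  have fm (m : probability R R) : m (@ray R r) \is a fin_num.
    by apply: fin_num_measure; exact: ray_meas.
  exact: etrans (esym (fineK (fm mu))) (etrans (congr1 EFin (h r)) (fineK (fm nu))).
- move=> k; apply: (@le_lt_trans _ _ 1%E); last exact: ltry.
  by apply: probability_le1; exact: ray_meas.
Qed.

End Rays.

Section Enlarge.
Variables (R : realType) (I : Type) (rk : nat -> int -> R) (f : I -> int -> R).
Variables D1 D2 : seq int.
Hypotheses (D1_uniq : uniq D1) (D2_uniq : uniq D2) (D12 : {subset D1 <= D2}).
Hypothesis f_supp : forall i z, z \notin D1 -> f i z = 0.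

Lemma sum_enlarge (F : int -> R) : (forall z, z \notin D1 -> F z = 0) ->
  \sum_(z <- D1) F z = \sum_(z <- D2) F z.
Proof.
move=> hF; rewrite [RHS](bigID (mem D1)) /= [X in _ = _ + X]big1 ?addr0; last by move=> z /hF.
rewrite -[RHS]big_filter; apply: perm_big; apply: uniq_perm => //; first exact: filter_uniq.
move=> z; rewrite mem_filter; apply/idP/andP => [zD|[]//].
by split=> //; exact: D12.
Qed.

Lemma word_sum_enlarge u g x : word_sum rk f D1 u g x = word_sum rk f D2 u g x.
Proof.
elim: u x => //= -[k i] u IH x; rewrite -sum_enlarge => [|z zD].
  by apply: eq_bigr => y _; rewrite IH.
by rewrite f_supp// mul0r mulr0.
Qed.

(** Two sceneries come with different finite sets; their totals are compared on a common larger
    one. *)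
Lemma word_total_enlarge i u g : word_total rk f D1 i u g = word_total rk f D2 i u g.
Proof.
rewrite /word_total -sum_enlarge => [|z zD]; last by rewrite f_supp// mul0r.
by apply: eq_bigr => y _; rewrite word_sum_enlarge.
Qed.

End Enlarge.

Theorem theorem2p1 (R : realType) (q : int -> R) (alpha : probability R R) :
  step_assumptions q ->
  exists F : (nat -> R) -> int -> probability R R,
    forall (eta : int -> probability R R),
      finitely_differs alpha eta ->
      forall (d : measure_display) (Omega : measurableType d)
             (P : probability Omega R) (S : nat -> Omega -> int)
             (X : nat -> Omega -> R),
        walk_observations P q eta S X ->
        {ae P, forall w : Omega, exists c : int,
            (forall (z : int) (A : set R), measurable A ->
               F (fun n => X n w) z A = eta (z + c) A) \/
            (forall (z : int) (A : set R), measurable A ->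
               F (fun n => X n w) z A = eta (- z + c) A)}.
Proof.
move=> hq.
(* Along [N] the mean square errors are summable, and [N] is chosen from [q] alone. *)
have [N hN] := choice (fun k : nat => weight_unbounded hq (2 ^+ k)).
pose rk k := ret (half_law q) k.+1.
pose supported (eta : int -> probability R R) (Ds : seq int) := uniq Ds /\
  forall z B, z \notin Ds -> measurable B -> eta z B = alpha B.
pose typical (x : nat -> R) (eta : int -> probability R R) := exists Ds, supported eta Ds /\
  forall r u, (fun k => statistic q alpha r u (N k) x / weight q (N k)) @ \oo -->
    word_total rk (excess eta alpha) Ds r u (fun=> 1).
(* Any scenery for which [x] is typical will do; if there is none, [alpha] everywhere is a
   default. *)
pose F x := if pselect (exists eta, typical x eta) is left h then projT1 (cid h) else fun=> alpha.
have Fspec x eta : typical x eta -> typical x (F x).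
  move=> h; rewrite /F; case: pselect => [h'|[]]; last by exists eta.
  exact: (projT2 (cid h')).
exists F => eta fd d Omega P S X hobs.
have [Ds [Du Dsupp]] : exists Ds, supported eta Ds.
  exists (finmap.enum_fset (fset_set
    [set z : int | exists A : set R, measurable A /\ eta z A <> alpha A])).
  split; first exact: finmap.fset_uniq.
  move=> z B; rewrite in_fset_set// => /negP zD mB; apply: contrapT => ne.
  by apply: zD; apply/mem_set; exists B.
have w_ge0 := half_law_ge0 hq; have w_total := half_law_total hq.
have w_moment2 := half_law_moment2 hq.
have ae1 r u : {ae P, forall o,
   (fun k => statistic q alpha r u (N k) (X ^~ o) / weight q (N k)) @ \oo -->
    word_total rk (excess eta alpha) Ds r u (fun=> 1)}.
  set H := word_total _ _ _ _ _ _.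
  have [C hC] := statistic_second_moment hq hobs Du Dsupp r u.
  have Wp k : 0 < weight q (N k) by apply: lt_le_trans (hN k); rewrite exprn_gt0.
  pose f k o := (weight q (N k))^-1 ^+ 2 *
    (statistic q alpha r u (N k) (X ^~ o) - H * weight q (N k)) ^+ 2.
  have srv k : bounded_rv (fun o => statistic q alpha r u (N k) (X ^~ o)).
    exact: (statistic_rv hobs alpha Du).
  have sqrv k : bounded_rv (fun o =>
      (statistic q alpha r u (N k) (X ^~ o) - H * weight q (N k)) ^+ 2).
    have b1 : bounded_rv (fun o =>
        1 * statistic q alpha r u (N k) (X ^~ o) + (-1) * (H * weight q (N k))).
      by apply: bounded_rv_lin => //; exact: bounded_rv_cst.
    rewrite (_ : (fun o => _) = fun o =>
      (1 * statistic q alpha r u (N k) (X ^~ o) + (-1) * (H * weight q (N k))) *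
      (1 * statistic q alpha r u (N k) (X ^~ o) + (-1) * (H * weight q (N k)))).
      exact: bounded_rvM.
    by apply/funext => o; ring.
  have C0 : 0 <= C.
    have := hC (N 0); rewrite -(pmulr_lge0 _ (Wp 0%N)); apply: le_trans.
    by apply: Rintegral_ge0 => o _; exact: sqr_ge0.
  have : {ae P, forall o, f ^~ o @ \oo --> (0 : R)}.
    apply: (@ae_summable_cvg0 _ _ _ P f C).
    - by move=> k; apply: bounded_rvM => //; exact: bounded_rv_cst.
    - by move=> k o; rewrite mulr_ge0// sqr_ge0.
    - move=> k; rewrite ExZ//.
      apply: (@le_trans _ _ ((weight q (N k))^-1 ^+ 2 * (C * weight q (N k)))).
        by rewrite ler_wpM2l// sqr_ge0.
      have -> : (weight q (N k))^-1 ^+ 2 * (C * weight q (N k)) = C / weight q (N k).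
        by field; rewrite gt_eqF.
      by rewrite ler_wpM2l// lef_pV2 ?posrE ?exprn_gt0 ?hN.
  apply: filterS => o f0.
  apply/cvgrPdist_le => e e0.
  have e2 : 0 < e ^+ 2 by rewrite exprn_gt0.
  move/cvgr0Pnorm_le : f0 => /(_ _ e2); apply: filterS => k.
  rewrite ger0_norm; last by rewrite mulr_ge0// sqr_ge0.
  have -> : f k o = (H - statistic q alpha r u (N k) (X ^~ o) / weight q (N k)) ^+ 2.
    by rewrite /f; field; rewrite gt_eqF.
  rewrite -[X in X <= _]real_normK ?num_real// => h.
  by rewrite -(ler_pXn2r (ltn0Sn 1)) ?nnegrE// ltW.
(* Words over the rationals are countable, so all limits hold outside one null set. *)
have ae2 : {ae P, forall o, typical (X ^~ o) eta}.
  have := @ae_foralln _ _ _ P (fun n o => if @unpickle (rat * seq (nat * rat))%type n is Some (r, u)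
    then (fun k => statistic q alpha r u (N k) (X ^~ o) / weight q (N k)) @ \oo -->
      word_total rk (excess eta alpha) Ds r u (fun=> 1) else True).
  have step n : {ae P, forall o, if @unpickle (rat * seq (nat * rat))%type n is Some (r, u)
    then (fun k => statistic q alpha r u (N k) (X ^~ o) / weight q (N k)) @ \oo -->
      word_total rk (excess eta alpha) Ds r u (fun=> 1) else True}.
    by case: (unpickle n) => [[r u]|]; [exact: ae1 | exact: aeW].
  move=> /(_ step); apply: filterS => o h; exists Ds; split; first by split.
  by move=> r u; have := h (pickle (r, u)); rewrite pickleK.
move: ae2; apply: filterS => o h; have h' := Fspec _ _ h.
have {h} [D1 [[D1u D1s] h1]] := h; have {h'} [D2 [[D2u D2s] h2]] := h'.
set x := X ^~ o in h1 h2 *.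
pose D := undup (D1 ++ D2).
have ex_supp (zeta : int -> probability R R) E : supported zeta E ->
    forall r z, z \notin E -> excess zeta alpha r z = 0.
  by move=> [_ sE] r z; exact: excess_supp sE _ _.
have sub1 : {subset D1 <= D} by move=> z zD; rewrite mem_undup mem_cat zD.
have sub2 : {subset D2 <= D} by move=> z zD; rewrite mem_undup mem_cat zD orbT.
(* Both sceneries are typical for the same observations, so their totals are limits of the same
   sequences. *)
have m : matched rk D (excess eta alpha) (excess (F x) alpha) (fun=> 1) (fun=> 1).
  move=> r u.
  rewrite -(word_total_enlarge rk D1u (undup_uniq _) sub1 (ex_supp _ _ (conj D1u D1s))).
  rewrite -(word_total_enlarge rk D2u (undup_uniq _) sub2 (ex_supp _ _ (conj D2u D2s))).
  by rewrite -(cvg_lim _ (h1 r u))// (cvg_lim _ (h2 r u)).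
have [t [tp te t1]] := aperiodic_steps hq.
have [C1 C1p hC1] := avg2_gap_ge w_ge0 w_total w_moment2 tp te t1.
have rk_even k z : rk k (- z) = rk k z.
  by have [_ _ e] := nice_ret w_ge0 w_total w_moment2 k.+1; exact: e.
have rk_indep M (beta : nat -> R) : (forall k, \sum_(d < M) beta d * rk k d%:Z = 0) ->
    forall d, (d < M)%N -> beta d = 0.
  exact: (ret_indep w_ge0 w_total w_moment2 C1p hC1).
have supp1 i z : z \notin D -> excess eta alpha i z = 0.
  by move=> zD; apply: (ex_supp _ _ (conj D1u D1s)); apply: contra zD; exact: sub1.
have supp2 i z : z \notin D -> excess (F x) alpha i z = 0.
  by move=> zD; apply: (ex_supp _ _ (conj D2u D2s)); apply: contra zD; exact: sub2.
have law z y : (forall r, excess (F x) alpha r z = excess eta alpha r y) ->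
    forall A, measurable A -> F x z A = eta y A.
  by move=> e; apply: rays_determine => r; have := e r; rewrite /excess /law_of; lra.
have [c [hc|hc]] := matched_congruent (undup_uniq _) rk_even rk_indep supp1 supp2 m.
  by exists c; left => z; apply: law => r; exact: hc.
by exists c; right => z; apply: law => r; exact: hc.
Qed.
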